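(* Let $f:\mathbb R\to\mathbb C$ be a continuous function with $f(0)=1$ and $f(t)\neq 0$ for all $t\in\mathbb R$. Fix one choice of sign, $+$ or $-$ (the upper signs are read throughout for $+$, the lower signs throughout for $-$), and let $$\varphi_{\pm}(t,h)=\biggl(\frac{f(t)^2}{f(t-h)f(t+h)}\biggr)^{\pm1}-1,\quad t,h\in\mathbb R.$$ Suppose that $$\varphi_{\pm}(t,h)=\pm 2I(t,h)+\rho(t,h)\quad\text{for any } t\geqslant 0,\ h>0,$$ where the function $I$ admits the representation $$I(t,h)=\int_{\mathbb R} e^{itx}\bigl(1-\cos(hx)\bigr)\tfrac{1+x^2}{x^2}\,dG(x)\quad\text{for any } t\geqslant 0,\ h>0,$$ with some $G\in\boldsymbol V$, and the function $\rho$ satisfies $$\sum_{k=0}^{n_{t,l}-1}(n_{t,l}-k)\,|\rho(kh_l,h_l)|\to 0,\quad l\to\infty,\quad\text{for any } t>0.$$ Suppose also that $$\sum_{k=0}^{n_{t,l}-1}(n_{t,l}-k)\,|\varphi_{\pm}(kh_l,h_l)|^2\to 0,\quad l\to\infty,\quad\text{for any } t>0.$$ Here $(h_l)_{l\in\mathbb N}$ is a fixed sequence of positive reals with $h_l\to 0$ as $l\to\infty$, and $n_{t,l}=\lfloor t/h_l\rfloor$ for $t>0$, $l\in\mathbb N$. Then, with this function $G$ and with $\gamma=\mathrm{Arg} f(1)$, $$f(t)=\exp\biggl\{it\gamma+\int_{\mathbb R}\bigl(e^{itx}-1-it\sin(x)\bigr)\tfrac{1+x^2}{x^2}\,dG(x)\biggr\},\quad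 t\in\mathbb R.$$ If it is additionally known that $f$ is the characteristic function of some distribution function $F$, then $F\in\boldsymbol Q$.
   Context: For continuous $f:\mathbb R\to\mathbb C$ with $f(0)=1$ and $f(t)\ne0$ for all $t$, $\mathrm{Arg} f$ is the unique continuous argument of $f$ on $\mathbb R$ with $\mathrm{Arg} f(0)=0$. $\boldsymbol V$ is the class of all functions $G:\mathbb R\to\mathbb R$ of bounded variation on $\mathbb R$ that are right-continuous at every point and satisfy $G(-\infty)=0$. Integrals with respect to $dG$ are Lebesgue–Stieltjes integrals. At $x=0$ the integrands are defined by continuity: $\bigl(1-\cos(hx)\bigr)\frac{1+x^2}{x^2}\big|_{x=0}=\frac{h^2}{2}$ and $\bigl(e^{itx}-1-it\sin(x)\bigr)\frac{1+x^2}{x^2}\big|_{x=0}=-\frac{t^2}{2}$. The characteristic function of a distribution function $F$ on $\mathbb R$ is $f(t)=\int_{\mathbb R}e^{itx}\,dF(x)$. $F$ is infinitely divisible if for every positive integer $n$ there is a distribution function $F_{1/n}$ whose $n$-fold convolution power is $F$. $\boldsymbol Q$ is the class of rational-infinitely divisible distribution functions, i.e. distribution functions $F$ for which there exist infinitely divisible distribution functions $F_1,F_2$ with $F_1=F*F_2$ (convolution). $\lfloor\cdot\rfloor$ is the floor function; empty sums ($\sum_{j=n}^{m}$ with $n>m$) equal $0$.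
   Formalization: The formula for f is proved under the added assumption that f(-t) is the complex conjugate of f(t) for all t, which the formula itself entails; without it the claim fails, e.g. for f(t)=e^t, G=0. The claim F in Q needs no added assumption. *)

(* Defs.v *)
From HB Require Import structures.
From mathcomp Require Import all_boot all_order all_algebra.
From mathcomp Require Import all_classical all_reals all_analysis.
From mathcomp Require Import complex lra.

Set Implicit Arguments.
Unset Strict Implicit.
Unset Printing Implicit Defensive.
Import Order.TTheory GRing.Theory Num.Theory.
Import numFieldNormedType.Exports.
Local Open Scope classical_set_scope.
Local Open Scope ring_scope.
Local Open Scope complex_scope.

Section complex_functions.
Context {R : realType}.

Definition cexp (z : R[i]) : R[i] :=
  (expR (complex.Re z))%:C * (cos (complex.Im z) +i* sin (complex.Im z)).

(* e^{i s} for real s *)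
Definition cis (s : R) : R[i] := cexp ('i * s%:C).

(* For f continuous and zero-free with f 0 = 1 there is exactly one such
   function; the value of [get] is a dummy otherwise. *)
Definition Arg (f : R -> R[i]) : R -> R :=
  [get a : R -> R | [/\ continuous a, a 0 = 0 &
     forall t, f t = (Normc.normc (f t))%:C * cis (a t)]].

Definition cintegral d (T : measurableType d) (mu : {measure set T -> \bar R})
    (g : T -> R[i]) : R[i] :=
  (\int[mu]_x complex.Re (g x)) +i* (\int[mu]_x complex.Im (g x)).

End complex_functions.

Record classV (R : realType) := ClassV {
  classV_fun :> R -> R;
  classV_bv : exists M : R, forall a b, a <= b ->
    (total_variation a b classV_fun <= M%:E)%E;
  classV_rc : right_continuous classV_fun;
  classV_Ny : classV_fun x @[x --> -oo] --> (0 : R) }.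

Section stieltjes.
Context {R : realType}.
Implicit Type G : classV R.

Definition tv_upto (G : R -> R) (x : R) : R :=
  sup [set fine (total_variation a x G) | a in [set a | a <= x]].

(* Jordan decomposition: G = pos_part G - neg_part G, because G(-oo) = 0. *)
Definition pos_part (G : R -> R) (x : R) : R := (tv_upto G x + G x) / 2.
Definition neg_part (G : R -> R) (x : R) : R := (tv_upto G x - G x) / 2.

Lemma classV_bvab G a b : a <= b -> bounded_variation a b G.
Proof.
move=> ab; have [M hM] := classV_bv G.
apply/(bounded_variationP _ ab).
by rewrite ge0_fin_numE ?total_variation_ge0// (le_lt_trans (hM _ _ ab))// ltry.
Qed.

Lemma classV_tv_fin G a b : a <= b -> total_variation a b G \is a fin_num.
Proof. by move=> ab; apply/(bounded_variationP _ ab)/classV_bvab. Qed.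

Lemma classV_tvD G a x y : a <= x -> x <= y ->
  fine (total_variation a y G) =
  fine (total_variation a x G) + fine (total_variation x y G).
Proof.
by move=> ax xy; rewrite (total_variationD _ ax xy) fineD ?classV_tv_fin.
Qed.

Lemma classV_has_sup G x :
  has_sup [set fine (total_variation a x G) | a in [set a | a <= x]].
Proof.
split; first by exists (fine (total_variation x x G)), x => /=.
have [M hM] := classV_bv G; exists M => _ /= [a ax <-].
by rewrite -lee_fin fineK ?classV_tv_fin// hM.
Qed.

Lemma tv_uptoB G x y : x <= y ->
  tv_upto G y - tv_upto G x = fine (total_variation x y G).
Proof.
move=> xy.
have T0 : 0 <= tv_upto G x.
  apply: ub_le_sup; first exact: (classV_has_sup G x).2.
  by exists x => //=; rewrite total_variationxx.
apply/eqP; rewrite eq_le; apply/andP; split.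
- rewrite lerBlDl; apply: ge_sup; first exact: (classV_has_sup G y).1.
  move=> _ /= [a ay <-]; have [ax|/ltW xa] := leP a x.
    rewrite (classV_tvD G ax xy) lerD2r.
    by apply: ub_le_sup; [exact: (classV_has_sup G x).2|exists a].
  rewrite (classV_tvD G xa ay) addrA lerDr addr_ge0//.
  exact/fine_ge0/total_variation_ge0.
- rewrite lerBrDl -lerBrDr; apply: ge_sup; first exact: (classV_has_sup G x).1.
  move=> _ /= [a ax <-]; rewrite lerBrDr -(classV_tvD G ax xy).
  apply: ub_le_sup; first exact: (classV_has_sup G y).2.
  by exists a => //=; exact: le_trans xy.
Qed.

Lemma classV_tv_ge G x y : x <= y ->
  `|G y - G x| <= fine (total_variation x y G).
Proof.
by move=> xy; rewrite -lee_fin fineK ?classV_tv_fin// total_variation_ge.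
Qed.

Lemma tv_upto_rc G : right_continuous (tv_upto G).
Proof.
move=> x.
have x1 : x < x + 1 by rewrite ltrDl.
have := total_variation_right_continuous (lexx x) x1 (@classV_rc _ G x)
  (classV_bvab G (ltW x1)).
rewrite total_variationxx /= => H.
have : tv_upto G x + fine (total_variation x y G) @[y --> x^'+] -->
    tv_upto G x.
  by rewrite -[X in _ --> X]addr0; apply: cvgD H; exact: cvg_cst.
apply: cvg_trans; apply: near_eq_cvg; near=> y.
by rewrite -tv_uptoB ?subrKC.
Unshelve. all: by end_near. Qed.

Let pos_part_nd G : nondecreasing (pos_part G).
Proof.
move=> x y xy; have := classV_tv_ge G xy; rewrite -tv_uptoB// ler_norml.
by rewrite /pos_part => /andP[? ?]; lra.
Qed.

Let neg_part_nd G : nondecreasing (neg_part G).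
Proof.
move=> x y xy; have := classV_tv_ge G xy; rewrite -tv_uptoB// ler_norml.
by rewrite /neg_part => /andP[? ?]; lra.
Qed.

Let pos_part_rc G : right_continuous (pos_part G).
Proof.
move=> x; apply: cvgM; last exact: cvg_cst.
by apply: cvgD; [exact: tv_upto_rc|exact: classV_rc].
Qed.

Let neg_part_rc G : right_continuous (neg_part G).
Proof.
move=> x; apply: cvgM; last exact: cvg_cst.
by apply: cvgB; [exact: tv_upto_rc|exact: classV_rc].
Qed.

HB.instance Definition _ G :=
  isCumulative.Build R _ R (pos_part G) (@pos_part_nd G) (@pos_part_rc G).
HB.instance Definition _ G :=
  isCumulative.Build R _ R (neg_part G) (@neg_part_nd G) (@neg_part_rc G).

(* int g dG, for g bounded and measurable *)
Definition stieltjes (G : classV R) (g : R -> R[i]) : R[i] :=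
  cintegral (lebesgue_stieltjes_measure (pos_part G)) g -
  cintegral (lebesgue_stieltjes_measure (neg_part G)) g.

End stieltjes.

Section distribution_functions.
Context {R : realType}.

Definition dfun := cumulativeBounded (0 : R) 1.
Implicit Type F : dfun.

Definition charfun F (t : R) : R[i] :=
  cintegral (lebesgue_stieltjes_measure F) (fun x => cis (t * x)).

(* The first argument is a bare function so that convolution can be iterated
   without packaging the result. *)
Definition conv (H : R -> R) F : R -> R :=
  fun x => \int[lebesgue_stieltjes_measure F]_y H (x - y).

(* n-fold convolution power, for n >= 1 *)
Definition conv_pow (n : nat) F : R -> R := iter n.-1 (conv^~ F) F.

Definition infinitely_divisible F : Prop :=
  forall n, (0 < n)%N -> exists Fn : dfun, conv_pow n Fn = F.

Definition classQ F : Prop :=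
  exists F1 F2 : dfun, [/\ infinitely_divisible F1, infinitely_divisible F2 &
    (F1 : R -> R) = conv F F2].

End distribution_functions.
Arguments dfun : clear implicits.

Section kernels.
Context {R : realType}.

(* (1 - cos (h x)) (1 + x^2) / x^2 *)
Definition ker_cos (h x : R) : R :=
  if x == 0 then h ^+ 2 / 2 else (1 - cos (h * x)) * ((1 + x ^+ 2) / x ^+ 2).

(* (e^{i t x} - 1 - i t sin x) (1 + x^2) / x^2 *)
Definition ker_LK (t x : R) : R[i] :=
  if x == 0 then (- (t ^+ 2 / 2))%:C
  else (cis (t * x) - 1 - 'i * (t * sin x)%:C) * ((1 + x ^+ 2) / x ^+ 2)%:C.

(* eps = 1 or -1 plays the role of the sign in the exponent. *)
Definition phi (eps : int) (f : R -> R[i]) (t h : R) : R[i] :=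
  (f t ^+ 2 / (f (t - h) * f (t + h))) ^ eps - 1.

End kernels.

(* Main.v *)
Require Import Defs.
From HB Require Import structures.
From mathcomp Require Import all_boot all_order all_algebra.
From mathcomp Require Import all_classical all_reals all_analysis.
From mathcomp Require Import measurable_realfun.
From mathcomp Require Import complex ring lra.

Set Implicit Arguments.
Unset Strict Implicit.
Unset Printing Implicit Defensive.
Import Order.TTheory GRing.Theory Num.Theory.
Import numFieldNormedType.Exports.
Local Open Scope classical_set_scope.
Local Open Scope ring_scope.
Local Open Scope complex_scope.

(** The representation comes from second differences of a logarithm. Let L be
the continuous logarithm ln |f| + i Arg f and psi the integral in the exponent.
The ratio f(t)^2 / (f(t-h) f(t+h)) is the exponential of the second difference
2 L(t) - L(t-h) - L(t+h), and the corresponding second difference of psi is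
exactly 2 I(t,h). When the second differences of L are small, which uniform
continuity ensures on bounded intervals, each of them agrees with 2 I up to
16 |phi|^2 + |rho| (w_estimate). Weighting the second differences on the grid
of step h by n - k and summing by parts recovers the value at n h
(sum_second_diff, ker_LK_sum), so the two assumed limits make L - psi close on
the grid to an imaginary linear function of time (grid_estimate). In the limit Re L = Re psi, and Im (L - psi) is linear; its
slope is Arg f(1), because the integrand of psi is real at time 1.

For the last claim, split psi into the integrals against the two finite measures
of the Jordan decomposition of G. It is enough to show that, for a finite
measure mu, the function
exp (i t g + a * int ker_LK t dmu - c |t|), with 0 <= a and 0 < c, is a
characteristic function (levy_khinchine_dfun): taking a and c to be 1/n gives
n-th roots of the case a = c = 1, hence infinite divisibility, and the
quotient of the two functions with c = 1 is f. The Cauchy factor exp (- |t|)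
cancels in this quotient. It is there because it makes the function integrable,
so that no compactness argument is needed: the weighted transforms
int psi(t) exp (- i x t) exp (- c |t|) dt are nonnegative numbers for psi = 1,
and this property (pos_transform) is preserved by multiplication by characters,
by nonnegative mixtures, by sums and by bounded pointwise limits. Expanding
(1 + m/n)^n reaches the exponential of every compound Poisson exponent
(exp_mixture_pos), and cutting the singularity of the kernel at 0 reaches the
general one. By Fourier inversion the nonnegative transform is then the
density of a probability measure with the wanted characteristic function
(positive_inversion). Distribution functions are compared through their
characteristic functions (cf_unique), by integrating Cauchy kernels to
arctangents. *)

Local Notation Re := complex.Re.
Local Notation Im := complex.Im.
Local Notation normc := Normc.normc.

(** * The complex exponential *)

Section complex_basics.
Context {R : realType}.
Implicit Types (z w : R[i]) (x y s t : R).

Lemma complex_ext z w : Re z = Re w -> Im z = Im w -> z = w.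
Proof. by case: z w => [a b] [c d] /= -> ->. Qed.

Lemma ReD z w : Re (z + w) = Re z + Re w. Proof. by case: z w => [a b] []. Qed.
Lemma ImD z w : Im (z + w) = Im z + Im w. Proof. by case: z w => [a b] []. Qed.
Lemma ReN z : Re (- z) = - Re z. Proof. by case: z. Qed.
Lemma ImN z : Im (- z) = - Im z. Proof. by case: z. Qed.
Lemma ReM z w : Re (z * w) = Re z * Re w - Im z * Im w.
Proof. by case: z w => [a b] []. Qed.
Lemma ImM z w : Im (z * w) = Re z * Im w + Im z * Re w.
Proof. by case: z w => [a b] []. Qed.
Lemma Re_cexp z : Re (cexp z) = expR (Re z) * cos (Im z).
Proof. by rewrite /cexp /= mul0r subr0. Qed.
Lemma Im_cexp z : Im (cexp z) = expR (Re z) * sin (Im z).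
Proof. by rewrite /cexp /= mul0r addr0. Qed.
Lemma Re_cis t : Re (cis t) = cos t.
Proof.
rewrite /cis Re_cexp ReM ImM /=.
by rewrite !(mul0r, mul1r, mulr0, oppr0, addr0, add0r) ?expR0 ?mul1r.
Qed.
Lemma Im_cis t : Im (cis t) = sin t.
Proof.
rewrite /cis Im_cexp ReM ImM /=.
by rewrite !(mul0r, mul1r, mulr0, oppr0, addr0, add0r) ?expR0 ?mul1r.
Qed.
Lemma Re_conj z : Re z^* = Re z. Proof. by case: z. Qed.
Lemma Im_conj z : Im z^* = - Im z. Proof. by case: z. Qed.
Lemma Re_nat n : Re (n%:R : R[i]) = n%:R.
Proof. by elim: n => // n IH; rewrite -!natr1 ReD IH. Qed.
Lemma Im_nat n : Im (n%:R : R[i]) = 0.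
Proof. by elim: n => // n IH; rewrite -natr1 ImD IH add0r. Qed.
Lemma Re_real x : Re x%:C = x. Proof. by []. Qed.
Lemma Im_real x : Im x%:C = 0. Proof. by []. Qed.
Lemma Re_i : Re ('i : R[i]) = 0. Proof. by []. Qed.
Lemma Im_i : Im ('i : R[i]) = 1. Proof. by []. Qed.
Lemma Re_0 : Re (0 : R[i]) = 0. Proof. by []. Qed.
Lemma Im_0 : Im (0 : R[i]) = 0. Proof. by []. Qed.
Lemma Re_1 : Re (1 : R[i]) = 1. Proof. by []. Qed.
Lemma Im_1 : Im (1 : R[i]) = 0. Proof. by []. Qed.

Definition ReImE := (Re_conj, Im_conj, Re_cexp, Im_cexp, Re_cis, Im_cis,
  Re_nat, Im_nat, Re_i, Im_i, Re_0, Im_0, Re_1, Im_1, ReN, ImN, ReD, ImD,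
  ReM, ImM).

Local Opaque cexp cis real_complex_def.

Lemma cexpD z w : cexp (z + w) = cexp z * cexp w.
Proof. by apply: complex_ext; rewrite !ReImE expRD ?cosD ?sinD; ring. Qed.

Lemma cexp0 : cexp (0 : R[i]) = 1.
Proof. by apply: complex_ext; rewrite !ReImE expR0 ?cos0 ?sin0 ?mulr0 ?mulr1. Qed.

Lemma cexpMn z n : cexp (z *+ n) = cexp z ^+ n.
Proof.
by elim: n => [|n IH]; rewrite ?mulr0n ?cexp0 ?expr0// mulrS cexpD IH exprS.
Qed.

Lemma cexp_conj z : cexp z^* = (cexp z)^*.
Proof.
apply: complex_ext; rewrite !ReImE; first by rewrite cosN.
by rewrite sinN mulrN.
Qed.

Lemma cexp_neq0 z : cexp z != 0.
Proof.
apply/eqP => h; have := cexpD z (- z).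
by rewrite subrr cexp0 h mul0r => /eqP; rewrite oner_eq0.
Qed.

Lemma cexpN z : cexp (- z) = (cexp z)^-1.
Proof.
apply: (mulfI (cexp_neq0 z)); rewrite -cexpD subrr cexp0 mulfV//.
exact: cexp_neq0.
Qed.

Lemma cexp_real x : cexp x%:C = (expR x)%:C.
Proof. by apply: complex_ext; rewrite !ReImE /= ?expR0 ?cos0 ?sin0 ?mulr0 ?mulr1. Qed.

Lemma cisD s t : cis (s + t) = cis s * cis t.
Proof. by apply: complex_ext; rewrite !ReImE ?cosD ?sinD; ring. Qed.

Lemma cis0 : cis 0 = 1 :> R[i].
Proof. by apply: complex_ext; rewrite !ReImE ?cos0 ?sin0. Qed.

Lemma cisN t : cis (- t) = (cis t)^* :> R[i].
Proof.
apply: complex_ext; rewrite !ReImE; [exact: cosN|exact: sinN].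
Qed.

Lemma normcE2 z : normc z = Num.sqrt (Re z ^+ 2 + Im z ^+ 2).
Proof. by case: z. Qed.

Lemma normc_ge0 z : 0 <= normc z.
Proof. by rewrite normcE2 sqrtr_ge0. Qed.

Lemma sqr_normcE z : normc z ^+ 2 = Re z ^+ 2 + Im z ^+ 2.
Proof. by rewrite normcE2 sqr_sqrtr// addr_ge0// sqr_ge0. Qed.

Lemma normc_eq0 z : (normc z == 0) = (z == 0).
Proof.
apply/eqP/eqP => [/Normc.eq0_normc//|->].
by rewrite Normc.normc0.
Qed.

Lemma normc_gt0 z : (0 < normc z) = (z != 0).
Proof. by rewrite lt_neqAle normc_ge0 andbT eq_sym normc_eq0. Qed.

Lemma Re_le_normc z : `|Re z| <= normc z.
Proof.
by rewrite normcE2 -sqrtr_sqr ler_wsqrtr// lerDl sqr_ge0.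
Qed.

Lemma Im_le_normc z : `|Im z| <= normc z.
Proof.
by rewrite normcE2 -sqrtr_sqr ler_wsqrtr// lerDr sqr_ge0.
Qed.

Lemma normc_le_ReIm z : normc z <= `|Re z| + `|Im z|.
Proof.
rewrite -(@ler_pXn2r _ 2)// ?nnegrE ?normc_ge0 ?addr_ge0//.
rewrite sqr_normcE sqrrD !real_normK ?num_real// addrAC lerDl.
by rewrite mulrn_wge0// mulr_ge0.
Qed.

Lemma normcM z w : normc (z * w) = normc z * normc w.
Proof. exact: Normc.normcM. Qed.

Lemma normcX z n : normc (z ^+ n) = normc z ^+ n.
Proof.
by elim: n => [|n IH]; rewrite ?expr0 ?Normc.normc1// !exprS normcM IH.
Qed.

Lemma normcD z w : normc (z + w) <= normc z + normc w.
Proof. exact: le_normcD. Qed.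

Lemma normc_sum (I : Type) (r : seq I) (F : I -> R[i]) :
  normc (\sum_(i <- r) F i) <= \sum_(i <- r) normc (F i).
Proof.
elim/big_ind2 : _ => //; first by rewrite Normc.normc0.
by move=> a b c d ab cd; rewrite (le_trans (normcD _ _))// lerD.
Qed.

Lemma normc_real x : normc x%:C = `|x|.
Proof. by rewrite normcE2 /= expr0n addr0 sqrtr_sqr. Qed.

Lemma normc_conj z : normc z^* = normc z.
Proof. by rewrite !normcE2 !ReImE sqrrN. Qed.

Lemma normc_cexp z : normc (cexp z) = expR (Re z).
Proof.
rewrite normcE2 !ReImE !exprMn -mulrDr cos2Dsin2 mulr1 sqrtr_sqr.
by rewrite ger0_norm// expR_ge0.
Qed.

Lemma normc_cis t : normc (cis t) = 1 :> R.
Proof. by rewrite normcE2 !ReImE cos2Dsin2 sqrtr1. Qed.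

(** The elementary bounds on sine and cosine follow from one another by the
mean value theorem, each bound feeding the derivative in the next. *)
Lemma norm_sin_le x : `|sin x| <= `|x|.
Proof.
wlog x0 : x / 0 <= x.
  move=> h; have [/h//|/ltW x0] := leP 0 x.
  by rewrite -normrN -sinN -(normrN x) h// oppr_ge0.
have [c _] := @MVT_segment _ sin cos _ _ x0 (fun y _ => is_derive_sin y)
  (continuous_subspaceT (@continuous_sin R)).
rewrite sin0 !subr0 => ->; rewrite normrM -[leRHS]mul1r.
by rewrite ler_wpM2r// cos_max.
Qed.
End complex_basics.

Local Opaque cexp cis real_complex_def.

Section elementary_bounds.
Context {R : realType}.
Implicit Types (z w : R[i]) (x y s t : R).

Lemma cosB1_mvt x : 0 <= x ->
  exists2 c, 0 <= c <= x & cos x - 1 = - sin c * x.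
Proof.
move=> x0.
have dcos y : y \in `]0, x[ -> is_derive y 1 (cos : R -> R) (- sin y).
  by move=> _; exact: is_derive_cos.
have [c] := MVT_segment x0 dcos (continuous_subspaceT (@continuous_cos R)).
by rewrite in_itv/= cos0 subr0 => cx e; exists c.
Qed.

Lemma sinB_mvt x : 0 <= x ->
  exists2 c, 0 <= c <= x & sin x - x = (cos c - 1) * x.
Proof.
move=> x0.
have dsin y : y \in `]0, x[ -> is_derive y 1 (sin \- id : R -> R) (cos y - 1).
  by move=> _; exact: is_deriveB.
have csin : continuous (sin \- id : R -> R).
  by move=> y; apply: cvgB; [exact: continuous_sin|exact: cvg_id].
have [c] := MVT_segment x0 dsin (continuous_subspaceT csin).
by rewrite in_itv/= sin0 !subr0 => cx e; exists c.
Qed.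

Lemma sinB_odd x : sin x - x = - (sin (- x) - - x).
Proof. by rewrite sinN opprB opprK addrC. Qed.

Lemma norm_cosB1_le x : `|cos x - 1| <= x ^+ 2.
Proof.
wlog x0 : x / 0 <= x.
  move=> h; have [/h//|/ltW x0] := leP 0 x.
  by rewrite -cosN -sqrrN h// oppr_ge0.
have [c /andP[c0 cx] ->] := cosB1_mvt x0.
rewrite normrM normrN expr2 (ger0_norm x0) ler_wpM2r//.
by rewrite (le_trans (norm_sin_le _))// ger0_norm.
Qed.

Lemma norm_cosB1_le1 x : `|cos x - 1| <= `|x|.
Proof.
wlog x0 : x / 0 <= x.
  move=> h; have [/h//|/ltW x0] := leP 0 x.
  by rewrite -cosN -(normrN x) h// oppr_ge0.
have [c /andP[c0 cx] ->] := cosB1_mvt x0.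
by rewrite normrM normrN -[leRHS]mul1r ler_wpM2r// sin_max.
Qed.

Lemma norm_cosB1_le2 x : `|cos x - 1| <= 2.
Proof.
by have := cos_le1 x; have := cos_geN1 x; rewrite ler_norml; lra.
Qed.

Lemma norm_sinB_le3 x : `|sin x - x| <= `|x| ^+ 3.
Proof.
wlog x0 : x / 0 <= x.
  move=> h; have [/h//|/ltW x0] := leP 0 x.
  by rewrite sinB_odd normrN -(normrN x) h// oppr_ge0.
have [c /andP[c0 cx] ->] := sinB_mvt x0.
rewrite normrM (ger0_norm x0) exprSr ler_wpM2r//.
by rewrite (le_trans (norm_cosB1_le _))// lerXn2r// nnegrE.
Qed.

Lemma norm_sinB_le2 x : `|sin x - x| <= x ^+ 2.
Proof.
wlog x0 : x / 0 <= x.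
  move=> h; have [/h//|/ltW x0] := leP 0 x.
  by rewrite sinB_odd normrN -sqrrN h// oppr_ge0.
have [c /andP[c0 cx] ->] := sinB_mvt x0.
rewrite normrM (ger0_norm x0) expr2 ler_wpM2r//.
by rewrite (le_trans (norm_cosB1_le1 _))// ger0_norm.
Qed.

Lemma norm_expRB1B_le x : `|x| <= 1 / 2 -> `|expR x - 1 - x| <= 2 * x ^+ 2.
Proof.
rewrite ler_norml => /andP[x1 x2].
have h1 := expR_ge1Dx x; have h2 := expR_ge1Dx (- x).
have h3 := expR_gt0 x; have h4 := expR_gt0 (- x).
have h5 : expR x * expR (- x) = 1 by rewrite -expRD subrr expR0.
rewrite ger0_norm; last lra.
have : expR x * (1 - x) <= 1 by rewrite -[leRHS]h5 ler_pM2l.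
by nra.
Qed.

Lemma expR_le2 x : x <= 1 / 2 -> expR x <= 2.
Proof.
move=> x2.
have h2 := expR_ge1Dx (- x); have h3 := expR_gt0 x.
have h5 : expR x * expR (- x) = 1 by rewrite -expRD subrr expR0.
have : expR x * (1 - x) <= 1 by rewrite -[leRHS]h5 ler_pM2l.
by nra.
Qed.

Lemma normc_cexpB_le w : normc w <= 1 / 2 ->
  normc (cexp w - 1 - w) <= 4 * normc w ^+ 2.
Proof.
move=> w2; have := le_trans (Re_le_normc w) w2.
have := le_trans (Im_le_normc w) w2.
rewrite sqr_normcE; case: w {w2} => a b /= b2 a2.
apply: (le_trans (normc_le_ReIm _)).
rewrite !ReImE/=.
have ea := norm_expRB1B_le a2.
have e2 : expR a <= 2.
  by apply: expR_le2; move: a2; rewrite ler_norml => /andP[].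
have e0 := expR_gt0 a.
have cb := norm_cosB1_le b; have sb := norm_sin_le b.
have sb2 := norm_sinB_le2 b.
have hr : `|expR a * cos b - 1 - a| <= 2 * a ^+ 2 + 2 * b ^+ 2.
  have -> : expR a * cos b - 1 - a = (expR a - 1 - a) + expR a * (cos b - 1) by ring.
  rewrite (le_trans (ler_normD _ _))// lerD// normrM (gtr0_norm e0).
  by rewrite ler_pM// ltW.
have hi : `|expR a * sin b - 0 - b| <= 2 * `|a| * `|b| + b ^+ 2.
  have -> : expR a * sin b - 0 - b = (expR a - 1) * sin b + (sin b - b) by ring.
  rewrite (le_trans (ler_normD _ _))// lerD// normrM ler_pM//.
  have -> : expR a - 1 = (expR a - 1 - a) + a by ring.
  rewrite (le_trans (ler_normD _ _))//.
  have : 2 * a ^+ 2 <= `|a|.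
    by rewrite -(real_normK (num_real a)); have := normr_ge0 a; nra.
  by move: ea; set u := `|_ - _|; lra.
have : 2 * `|a| * `|b| <= a ^+ 2 + b ^+ 2.
  rewrite -(real_normK (num_real a)) -(real_normK (num_real b)).
  by have := sqr_ge0 (`|a| - `|b|); nra.
by have := sqr_ge0 a; lra.
Qed.

(** Near the origin the exponential is invertible with a quadratic error, which
is how a small second difference of the logarithm is read off from the ratio of
the values of the function. *)
Lemma normc_cexp_log w : normc w <= 1 / 8 ->
  normc (w - (cexp w - 1)) <= 16 * normc (cexp w - 1) ^+ 2.
Proof.
move=> w8.
have := @normc_cexpB_le w _; have := normcD (- (cexp w - 1 - w)) (cexp w - 1).
rewrite normcN.
have -> : - (cexp w - 1 - w) + (cexp w - 1) = w by ring.
rewrite -(normcN (w - _)).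
have -> : - (w - (cexp w - 1)) = cexp w - 1 - w by ring.
set n := normc w in w8 *; set d := normc (_ - w); set p := normc _.
move=> h1 h2; have {}h2 : d <= 4 * n ^+ 2 by apply: h2; lra.
have n0 : 0 <= n by exact: normc_ge0.
have np : n <= 2 * p.
  have : 4 * n ^+ 2 <= n / 2 by nra.
  by lra.
by nra.
Qed.

End elementary_bounds.

(** * Bounded complex functions and their integrals *)

Section bounded_measurable.
Context d {T : measurableType d} {R : realType}.
Implicit Types (g h : T -> R) (u v : T -> R[i]).

(** Bounded measurable functions are integrable for every finite measure and
stable under the algebraic operations, so this predicate discharges all
integrability conditions below. *)
Definition bmf g := measurable_fun setT g /\ exists M, forall x, `|g x| <= M.

Definition bmc u := bmf (fun x => Re (u x)) /\ bmf (fun x => Im (u x)).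

Lemma bmf_cst (r : R) : bmf (fun=> r).
Proof. by split; [exact: measurable_cst|exists `|r|]. Qed.

Lemma bmfD g h : bmf g -> bmf h -> bmf (fun x => g x + h x).
Proof.
move=> [mg [M hM]] [mh [N hN]]; split; first exact: measurable_funD.
by exists (M + N) => x; rewrite (le_trans (ler_normD _ _))// lerD.
Qed.

Lemma bmfM g h : bmf g -> bmf h -> bmf (fun x => g x * h x).
Proof.
move=> [mg [M hM]] [mh [N hN]]; split; first exact: measurable_funM.
by exists (M * N) => x; rewrite normrM ler_pM.
Qed.

Lemma bmfN g : bmf g -> bmf (fun x => - g x).
Proof.
move=> [mg [M hM]]; split; first exact: measurableT_comp.
by exists M => x; rewrite normrN.
Qed.

Lemma bmfB g h : bmf g -> bmf h -> bmf (fun x => g x - h x).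
Proof. by move=> bg bh; apply: bmfD => //; exact: bmfN. Qed.

Lemma bmf_norm g : bmf g -> bmf (fun x => `|g x|).
Proof.
move=> [mg [M hM]]; split; first exact: measurableT_comp.
by exists M => x; rewrite normr_id.
Qed.

Lemma bmc_cst (c : R[i]) : bmc (fun=> c).
Proof. by split; exact: bmf_cst. Qed.

Lemma bmc_real g : bmf g -> bmc (fun x => (g x)%:C).
Proof. by move=> bg; split => //; exact: bmf_cst. Qed.

Lemma bmcD u v : bmc u -> bmc v -> bmc (fun x => u x + v x).
Proof.
move=> [ru iu] [rv iv]; split.
  by under eq_fun do rewrite ReD; exact: bmfD.
by under eq_fun do rewrite ImD; exact: bmfD.
Qed.

Lemma bmcN u : bmc u -> bmc (fun x => - u x).
Proof.
move=> [ru iu]; split.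
  by under eq_fun do rewrite ReN; exact: bmfN.
by under eq_fun do rewrite ImN; exact: bmfN.
Qed.

Lemma bmcB u v : bmc u -> bmc v -> bmc (fun x => u x - v x).
Proof. by move=> bu bv; apply: bmcD => //; exact: bmcN. Qed.

Lemma bmcM u v : bmc u -> bmc v -> bmc (fun x => u x * v x).
Proof.
move=> [ru iu] [rv iv]; split.
  by under eq_fun do rewrite ReM; apply: bmfB; exact: bmfM.
by under eq_fun do rewrite ImM; apply: bmfD; exact: bmfM.
Qed.

Lemma bmc_sum (I : Type) (r : seq I) (F : I -> T -> R[i]) :
  (forall i, bmc (F i)) -> bmc (fun x => \sum_(i <- r) F i x).
Proof.
move=> bF; elim: r => [|i r IH].
  by under eq_fun do rewrite big_nil; exact: bmc_cst.
by under eq_fun do rewrite big_cons; exact: bmcD.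
Qed.

Lemma bmc_cis g : measurable_fun setT g -> bmc (fun x => cis (g x)).
Proof.
move=> mg; split.
  under eq_fun do rewrite Re_cis; split.
    apply: (measurableT_comp _ mg).
    exact: (continuous_measurable_fun (@continuous_cos R)).
  by exists 1 => x; exact: cos_max.
under eq_fun do rewrite Im_cis; split.
  apply: (measurableT_comp _ mg).
  exact: (continuous_measurable_fun (@continuous_sin R)).
by exists 1 => x; exact: sin_max.
Qed.

Lemma bmc_bounded u : bmc u -> exists M, forall x, normc (u x) <= M.
Proof.
move=> [[_ [M hM]] [_ [N hN]]]; exists (M + N) => x.
by rewrite (le_trans (normc_le_ReIm _))// lerD.
Qed.

Lemma bmc_intro u M : measurable_fun setT (fun x => Re (u x)) ->
  measurable_fun setT (fun x => Im (u x)) -> (forall x, normc (u x) <= M) ->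
  bmc u.
Proof.
move=> mr mi hM; split; split => //; exists M => x.
  exact: le_trans (Re_le_normc _) _.
exact: le_trans (Im_le_normc _) _.
Qed.

End bounded_measurable.

Section complex_limits.
Context {R : realType}.
Implicit Types (u v : nat -> R[i]) (a b : R[i]).

(** Convergence of complex sequences is taken componentwise, so that the real
limit theorems apply to each component. *)
Definition ccvg u a :=
  (Re (u n) @[n --> \oo] --> Re a) /\ (Im (u n) @[n --> \oo] --> Im a).

Lemma ccvg_unique u a b : ccvg u a -> ccvg u b -> a = b.
Proof.
move=> [ra ia] [rb ib].
by apply: complex_ext; [exact: cvg_unique ra rb|exact: cvg_unique ia ib].
Qed.

Lemma ccvg_cst a : ccvg (fun=> a) a.
Proof. by split; exact: cvg_cst. Qed.

Lemma ccvgD u v a b : ccvg u a -> ccvg v b -> ccvg (fun n => u n + v n) (a + b).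
Proof.
move=> [ra ia] [rb ib]; split.
  by rewrite ReD; under eq_fun do rewrite ReD; exact: cvgD.
by rewrite ImD; under eq_fun do rewrite ImD; exact: cvgD.
Qed.

Lemma ccvgN u a : ccvg u a -> ccvg (fun n => - u n) (- a).
Proof.
move=> [ra ia]; split.
  by rewrite ReN; under eq_fun do rewrite ReN; exact: cvgN.
by rewrite ImN; under eq_fun do rewrite ImN; exact: cvgN.
Qed.

Lemma ccvgB u v a b : ccvg u a -> ccvg v b -> ccvg (fun n => u n - v n) (a - b).
Proof. by move=> hu hv; apply: ccvgD => //; exact: ccvgN. Qed.

Lemma ccvgM u v a b : ccvg u a -> ccvg v b -> ccvg (fun n => u n * v n) (a * b).
Proof.
move=> [ra ia] [rb ib]; split.
  by rewrite ReM; under eq_fun do rewrite ReM; apply: cvgB; exact: cvgM.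
by rewrite ImM; under eq_fun do rewrite ImM; apply: cvgD; exact: cvgM.
Qed.

Lemma ccvg_real (x : nat -> R) (y : R) :
  x n @[n --> \oo] --> y -> ccvg (fun n => (x n)%:C) y%:C.
Proof. by move=> xy; split => //; exact: cvg_cst. Qed.

Lemma ccvg_cexp u a : ccvg u a -> ccvg (fun n => cexp (u n)) (cexp a).
Proof.
move=> [ra ia]; split.
  rewrite Re_cexp; under eq_fun do rewrite Re_cexp.
  apply: cvgM; apply: continuous_cvg => //; first exact: continuous_expR.
  exact: continuous_cos.
rewrite Im_cexp; under eq_fun do rewrite Im_cexp.
apply: cvgM; apply: continuous_cvg => //; first exact: continuous_expR.
exact: continuous_sin.
Qed.

End complex_limits.

Section finite_integrals.
Context d {T : measurableType d} {R : realType}.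
Variable mu : {finite_measure set T -> \bar R}.
Implicit Types (g h : T -> R) (u v : T -> R[i]).

Lemma bmf_integrable g : bmf g -> mu.-integrable setT (EFin \o g).
Proof.
move=> [mg [M hM]]; apply: measurable_bounded_integrable => //.
  by rewrite -ge0_fin_numE// fin_num_measure.
exists M; split; first exact: num_real.
by move=> x Mx y _ /=; rewrite (le_trans (hM y))// ltW.
Qed.

Lemma bmf_int_le g M : bmf g -> (forall x, `|g x| <= M) ->
  `|\int[mu]_x g x| <= M * fine (mu setT).
Proof.
move=> bg hM.
rewrite (le_trans (le_normr_Rintegral _ (bmf_integrable bg)))//.
rewrite -Rintegral_cst//; apply: le_Rintegral => //.
  exact: (bmf_integrable (bmf_norm bg)).
exact: (bmf_integrable (bmf_cst M)).
Qed.

Lemma bounded_convergence (g : nat -> T -> R) h M :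
  (forall n, measurable_fun setT (g n)) -> (forall n x, `|g n x| <= M) ->
  (forall x, g n x @[n --> \oo] --> h x) ->
  (\int[mu]_x g n x) @[n --> \oo] --> \int[mu]_x h x.
Proof.
move=> mg gM gh.
have mh : measurable_fun setT h.
  by apply: (measurable_fun_cvg mg) => x _; exact: gh.
have hM x : `|h x| <= M.
  apply: (@cvgr_to_le _ eventually _ _ (fun n => `|g n x|)).
    by apply: cvg_norm; exact: gh.
  by apply: nearW => n; exact: gM.
apply: fine_cvg; rewrite fineK; last first.
  apply: integrable_fin_num => //; apply: (bmf_integrable (g := h)).
  by split => //; exists M.
apply: (@dominated_cvg _ _ _ mu setT measurableT
  (fun n x => (g n x)%:E) (EFin \o h) (cst M%:E)) => //.
- by move=> n; exact/measurable_EFinP.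
- by move=> x _; apply: cvg_EFin; [exact: nearW|exact: gh].
- exact: (bmf_integrable (bmf_cst M)).
- by move=> n x _ /=; rewrite lee_fin.
Qed.

Lemma cintegralD u v : bmc u -> bmc v ->
  cintegral mu (fun x => u x + v x) = cintegral mu u + cintegral mu v.
Proof.
move=> [ru iu] [rv iv]; apply: complex_ext; rewrite ?ReD ?ImD/=.
  rewrite -RintegralD//; try exact: bmf_integrable.
  by apply: eq_Rintegral => x _; rewrite ReD.
rewrite -RintegralD//; try exact: bmf_integrable.
by apply: eq_Rintegral => x _; rewrite ImD.
Qed.

Lemma cintegralZ (c : R[i]) u : bmc u ->
  cintegral mu (fun x => c * u x) = c * cintegral mu u.
Proof.
move=> [ru iu]; apply: complex_ext; rewrite ?ReM ?ImM/=.
  rewrite -!RintegralZl// ?bmf_integrable//.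
  rewrite -RintegralB//; try exact/bmf_integrable/(bmfM (bmf_cst _)).
  by apply: eq_Rintegral => x _; rewrite ReM.
rewrite -!RintegralZl// ?bmf_integrable//.
rewrite -RintegralD//; try exact/bmf_integrable/(bmfM (bmf_cst _)).
by apply: eq_Rintegral => x _; rewrite ImM.
Qed.

Lemma cintegralN u : bmc u ->
  cintegral mu (fun x => - u x) = - cintegral mu u.
Proof.
move=> bu; rewrite -mulN1r -cintegralZ//; congr cintegral.
by apply/funext => x; rewrite mulN1r.
Qed.

Lemma cintegralB u v : bmc u -> bmc v ->
  cintegral mu (fun x => u x - v x) = cintegral mu u - cintegral mu v.
Proof. by move=> bu bv; rewrite cintegralD ?cintegralN//; exact: bmcN. Qed.

Lemma cintegral_sum (I : Type) (r : seq I) (F : I -> T -> R[i]) :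
  (forall i, bmc (F i)) ->
  cintegral mu (fun x => \sum_(i <- r) F i x) =
  \sum_(i <- r) cintegral mu (F i).
Proof.
move=> bF; elim: r => [|i r IH].
  rewrite big_nil; under [X in cintegral _ X]eq_fun do rewrite big_nil.
  by apply: complex_ext => /=; rewrite Rintegral_cst// mul0r.
rewrite big_cons -IH -cintegralD//; last exact: bmc_sum.
by congr cintegral; apply/funext => x; rewrite big_cons.
Qed.

Lemma cintegral_cst (c : R[i]) :
  cintegral mu (fun=> c) = c * (fine (mu setT))%:C.
Proof.
apply: complex_ext; rewrite ?ReM ?ImM /= Rintegral_cst//.
  by rewrite mulr0 subr0.
by rewrite mulr0 add0r.
Qed.

Lemma cintegral_conj u : bmc u ->
  cintegral mu (fun x => (u x)^*) = (cintegral mu u)^*.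
Proof.
move=> [ru iu]; apply: complex_ext; rewrite ?Re_conj ?Im_conj/=.
  by apply: eq_Rintegral => x _; rewrite Re_conj.
rewrite -mulN1r -RintegralZl ?bmf_integrable//.
by apply: eq_Rintegral => x _; rewrite Im_conj mulN1r.
Qed.

Lemma cintegral_real g : cintegral mu (fun x => (g x)%:C) = (\int[mu]_x g x)%:C.
Proof. by apply: complex_ext => //=; rewrite Rintegral_cst// mul0r. Qed.

Lemma cbounded_convergence (u : nat -> T -> R[i]) v M :
  (forall n, bmc (u n)) -> (forall n x, normc (u n x) <= M) ->
  (forall x, ccvg (u^~ x) (v x)) ->
  ccvg (fun n => cintegral mu (u n)) (cintegral mu v).
Proof.
move=> bu uM uv; split => /=; apply: (@bounded_convergence _ _ M).
- by move=> n; have [[]] := bu n.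
- by move=> n x; exact: le_trans (Re_le_normc _) _.
- by move=> x; have [] := uv x.
- by move=> n; have [_ []] := bu n.
- by move=> n x; exact: le_trans (Im_le_normc _) _.
- by move=> x; have [] := uv x.
Qed.

End finite_integrals.

Section bounded_Fubini.
Context d1 d2 {T1 : measurableType d1} {T2 : measurableType d2} {R : realType}.
Variables (m1 : {finite_measure set T1 -> \bar R}).
Variables (m2 : {finite_measure set T2 -> \bar R}).
Implicit Types (h : T1 * T2 -> R) (u : T1 * T2 -> R[i]).

Lemma bmf_section1 h x : bmf h -> bmf (fun y => h (x, y)).
Proof.
by move=> [mh [M hM]]; split; [exact: measurable_fun_pair2|exists M].
Qed.

Lemma bmf_section2 h y : bmf h -> bmf (fun x => h (x, y)).
Proof.
by move=> [mh [M hM]]; split; [exact: measurable_fun_pair1|exists M].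
Qed.

Lemma product_measure_fin : ((m1 \x m2)%E setT < +oo)%E.
Proof.
have : (product_measure1 m1 m2 (setT `*` setT) < +oo)%E.
  rewrite product_measure1E// lte_mul_pinfty//.
    by rewrite fin_num_measure.
  by rewrite -ge0_fin_numE// fin_num_measure.
by rewrite setXTT.
Qed.

Lemma bmf_integrable_prod h : bmf h ->
  (m1 \x m2)%E.-integrable setT (EFin \o h).
Proof.
move=> [mh [M hM]]; apply: measurable_bounded_integrable => //.
  exact: product_measure_fin.
exists M; split; first exact: num_real.
by move=> x Mx y _ /=; rewrite (le_trans (hM y))// ltW.
Qed.

Lemma bmf_int2 h : bmf h -> bmf (fun x => \int[m2]_y h (x, y)).
Proof.
move=> bh; split.
  apply: (measurableT_comp (fine_measurable measurableT)).
  exact: (measurable_fubini_F (bmf_integrable_prod bh)).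
have [_ [M hM]] := bh; exists (M * fine (m2 setT)) => x.
by apply: bmf_int_le => //; exact: bmf_section1.
Qed.

Lemma bmf_Fubini h : bmf h ->
  \int[m1]_x (\int[m2]_y h (x, y)) = \int[m2]_y (\int[m1]_x h (x, y)).
Proof.
move=> bh; rewrite /Rintegral; congr fine.
transitivity (\int[m1]_x \int[m2]_y (h (x, y))%:E)%E.
  apply: eq_integral => x _; rewrite fineK//.
  by apply: integrable_fin_num => //; exact: bmf_integrable (bmf_section1 _ bh).
rewrite (Fubini (bmf_integrable_prod bh)); apply: eq_integral => y _.
rewrite fineK//.
by apply: integrable_fin_num => //; exact: bmf_integrable (bmf_section2 _ bh).
Qed.

Lemma bmc_int2 u : bmc u -> bmc (fun x => cintegral m2 (fun y => u (x, y))).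
Proof. by move=> [ru iu]; split; [exact: (bmf_int2 ru)|exact: (bmf_int2 iu)]. Qed.

Lemma bmc_Fubini u : bmc u ->
  cintegral m1 (fun x => cintegral m2 (fun y => u (x, y))) =
  cintegral m2 (fun y => cintegral m1 (fun x => u (x, y))).
Proof.
move=> [ru iu]; apply: complex_ext.
  exact: (bmf_Fubini ru).
exact: (bmf_Fubini iu).
Qed.

End bounded_Fubini.

Section fst_snd.
Context d1 d2 {T1 : measurableType d1} {T2 : measurableType d2} {R : realType}.

Lemma bmc_fst (u : T1 -> R[i]) : bmc u -> bmc (fun z : T1 * T2 => u z.1).
Proof.
move=> [[mr [M hM]] [mi [N hN]]]; split; split.
- exact: (measurableT_comp mr measurable_fst).
- by exists M.
- exact: (measurableT_comp mi measurable_fst).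
- by exists N.
Qed.

Lemma bmc_snd (u : T2 -> R[i]) : bmc u -> bmc (fun z : T1 * T2 => u z.2).
Proof.
move=> [[mr [M hM]] [mi [N hN]]]; split; split.
- exact: (measurableT_comp mr measurable_snd).
- by exists M.
- exact: (measurableT_comp mi measurable_snd).
- by exists N.
Qed.

End fst_snd.

(** * Exponential and Cauchy kernels *)

Section density.
Context d {T : measurableType d} {R : realType}.
Variable mu : {sigma_finite_measure set T -> \bar R}.
Variable p : T -> R.
Hypothesis p_ge0 : forall x, 0 <= p x.
Hypothesis p_int : mu.-integrable setT (EFin \o p).

Let dens (A : set T) : \bar R := (\int[mu]_(x in A) (p x)%:E)%E.

Let mp : measurable_fun setT p.
Proof. by apply/measurable_EFinP; exact: measurable_int p_int. Qed.

Let dens0 : dens set0 = 0%E.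
Proof. by rewrite /dens integral_set0. Qed.

Let dens_ge0 A : (0 <= dens A)%E.
Proof. by apply: integral_ge0 => x _; rewrite lee_fin. Qed.

Let dens_sigma_additive : semi_sigma_additive dens.
Proof.
move=> /= F mF tF mUF; rewrite /dens; apply: cvg_toP.
  apply: ereal_nondecreasing_is_cvgn => m n mn.
  apply: lee_sum_nneg_natr => // k _ _; apply: integral_ge0 => /= x Fkx.
  by rewrite lee_fin.
rewrite ge0_integral_bigcup//=.
- by apply/measurable_funTS/measurable_EFinP.
- by move=> x _; rewrite lee_fin.
Qed.

HB.instance Definition _ := isMeasure.Build _ _ _ dens
  dens0 dens_ge0 dens_sigma_additive.

Let dens_fin : fin_num_fun dens.
Proof.
move=> A mA; rewrite ge0_fin_numE//.
have pA := integrableS measurableT mA (@subsetT _ _) p_int.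
have /integrableP[_] := pA.
apply: le_lt_trans; apply: ge0_le_integral => //.
- by move=> x _; rewrite lee_fin.
- exact: (measurable_int _ pA).
- by apply/measurableT_comp => //; exact: (measurable_int _ pA).
- by move=> x _; rewrite lee_fin ler_norm.
Qed.

HB.instance Definition _ := Measure_isFinite.Build _ _ _ dens dens_fin.

(** The finite measure is packaged existentially: all that is used of it is how
it integrates bounded functions. *)
Lemma density_measure : exists nu : {finite_measure set T -> \bar R},
  forall g, bmf g ->
  (\int[nu]_x (g x)%:E = \int[mu]_x (g x * p x)%:E)%E.
Proof.
exists dens => g bg.
have dom : dens `<< mu.
  apply/null_content_dominatesP => A mA A0; rewrite /dens/=.
  by apply: null_set_integral => //; apply/measurable_funTS/measurable_EFinP.
rewrite -(Radon_Nikodym_change_of_variables dom)//=; last exact: bmf_integrable.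
apply: ae_eq_integral => //.
- apply: emeasurable_funM => //.
  by apply/measurable_EFinP; case: bg.
- by apply/measurable_EFinP/measurable_funM => //; case: bg.
- under [X in ae_eq _ _ _ X]eq_fun do rewrite EFinM.
  apply: ae_eqe_mul2l => /=.
  rewrite Radon_NikodymE//=.
  case: cid => /= h [h1 h2 h3].
  apply: integral_ae_eq => //=.
  + exact/measurable_EFinP.
  + by move=> E E01 mE; rewrite -h3.
Qed.

End density.

Section laplace.
Context {R : realType}.
Local Notation leb := (@lebesgue_measure R).

Lemma ge0_integral_fold (G : R -> R) : (forall x, 0 <= G x) -> continuous G ->
  (\int[leb]_x (G x)%:E = \int[leb]_(x in `[0%R, +oo[) (G x + G (- x))%:E)%E.
Proof.
move=> G0 cG.
have mG : measurable_fun [set: R] G by exact: continuous_measurable_fun.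
have mGN : measurable_fun [set: R] (fun x => G (- x)).
  by apply: (measurableT_comp mG); exact: oppr_measurable.
rewrite -(setUv `[0, +oo[%classic) ge0_integral_setU//= ; last 4 first.
  exact: measurableC.
  by apply/measurable_EFinP; rewrite setUv.
  by move=> x _; rewrite lee_fin.
  exact/disj_setPCl.
under [RHS]eq_integral do rewrite EFinD.
rewrite ge0_integralD//=; last 4 first.
  by move=> x _; rewrite lee_fin.
  by apply/measurable_EFinP; exact: measurable_funTS.
  by move=> x _; rewrite lee_fin.
  by apply/measurable_EFinP; exact: measurable_funTS.
congr (_ + _)%E.
rewrite setCitvr.
rewrite integral_itv_bndo_bndc; last exact/measurable_EFinP/measurable_funTS.
rewrite -{1}oppr0 ge0_integration_by_substitutionNy//.
exact: continuous_subspaceT.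
Qed.

(** The measure with density exp(- c |t|), together with its Fourier transform,
which is a Cauchy kernel. *)
Definition is_laplace (c : R)
    (nu : {finite_measure set (measurableTypeR R) -> \bar R}) :=
  (forall g, bmf g ->
    (\int[nu]_t (g t)%:E = \int[leb]_t (g t * expR (- c * `|t|))%:E)%E) /\
  (forall x, cintegral nu (fun t => cis (x * t)) =
    (2 * c / (c ^+ 2 + x ^+ 2))%:C).

Variable c : R.
Hypothesis c0 : 0 < c.

(** For t >= 0, an antiderivative of 2 (1 + k cos(x t)) exp(- c t). Adding 1
keeps the integrand nonnegative, so that improper integrals need no
integrability; k = 1 gives the cosine transform and k = 0 the total mass. *)
Let F (k x t : R) : R := - (2 / c) * expR (- c * t) +
  (2 * k / (c ^+ 2 + x ^+ 2)) * (expR (- c * t) * (x * sin (x * t) - c * cos (x * t))).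

Let den_gt0 x : 0 < c ^+ 2 + x ^+ 2.
Proof. by rewrite ltr_wpDr ?sqr_ge0// exprn_gt0. Qed.

Let dF (k x t : R) : is_derive t 1 (F k x) (2 * (1 + k * cos (x * t)) * expR (- c * t)).
Proof.
have d1 : is_derive t 1 (fun t => - c * t) (- c).
  by apply: is_derive_eq; rewrite /GRing.scale/=; ring.
have d2 : is_derive t 1 (fun t => x * t) x.
  by apply: is_derive_eq; rewrite /GRing.scale/=; ring.
have de : is_derive t 1 (fun t => expR (- c * t)) (- c * expR (- c * t)).
  by apply: is_derive_eq; rewrite /GRing.scale/=; ring.
have ds : is_derive t 1 (fun t => sin (x * t)) (x * cos (x * t)).
  by apply: is_derive_eq; rewrite /GRing.scale/=; ring.
have dc : is_derive t 1 (fun t => cos (x * t)) (- x * sin (x * t)).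
  by apply: is_derive_eq; rewrite /GRing.scale/=; ring.
apply: is_derive_eq; rewrite /GRing.scale/=; field.
by rewrite gt_eqF//= gt_eqF.
Qed.

Let F_cvg k x : F k x t @[t --> +oo] --> (0 : R).
Proof.
pose M := 2 / c + `|2 * k / (c ^+ 2 + x ^+ 2)| * (`|x| + c).
have M0 : 0 <= M.
  by rewrite addr_ge0// ?mulr_ge0// ?invr_ge0 ?addr_ge0// ltW.
have e0 : M * expR (- c * t) @[t --> +oo] --> (0 : R).
  rewrite -[X in _ --> X](mulr0 M); apply: cvgMr.
  under eq_fun do rewrite mulNr.
  apply: (@cvg_comp _ _ _ ( *%R c) (fun z => expR (- z)) _ (pinfty_nbhs R)).
    exact: gt0_cvgMry.
  exact: cvgr_expR.
apply: (@squeeze_cvgr _ _ _ _ (fun t => - (M * expR (- c * t)))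
  (fun t => M * expR (- c * t))) => //; last first.
  by rewrite -[X in _ --> X]oppr0; exact: cvgN.
apply: nearW => t; rewrite -ler_norml /F.
have -> : - (2 / c) * expR (- c * t) + 2 * k / (c ^+ 2 + x ^+ 2) *
   (expR (- c * t) * (x * sin (x * t) - c * cos (x * t))) =
   (- (2 / c) + (2 * k / (c ^+ 2 + x ^+ 2)) *
    (x * sin (x * t) - c * cos (x * t))) * expR (- c * t) by ring.
rewrite normrM (ger0_norm (expR_ge0 _)) ler_wpM2r ?expR_ge0//.
rewrite (le_trans (ler_normD _ _))// normrN (@ger0_norm _ (2 / c)); last first.
  by rewrite divr_ge0// ltW.
rewrite /M lerD2l normrM ler_wpM2l// (le_trans (ler_normB _ _))//.
rewrite !normrM (gtr0_norm c0) lerD//.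
  by rewrite ler_piMr// sin_max.
by rewrite ler_piMr ?cos_max// ltW.
Qed.

Let cint (k x : R) : continuous (fun t : R => 2 * (1 + k * cos (x * t)) * expR (- c * t)).
Proof.
move=> t; apply: cvgM.
  apply: cvgM; first exact: cvg_cst.
  apply: cvgD; first exact: cvg_cst.
  apply: cvgM; first exact: cvg_cst.
  apply: continuous_comp; first exact: mulrl_continuous.
  exact: continuous_cos.
apply: continuous_comp; first exact: mulrl_continuous.
exact: continuous_expR.
Qed.

Let cos_ge0 (k x t : R) : 0 <= k <= 1 -> 0 <= 1 + k * cos (x * t).
Proof.
move=> /andP[k0 k1]; have := cos_geN1 (x * t); have := cos_le1 (x * t).
by nra.
Qed.

Let half_integral (k x : R) : 0 <= k <= 1 ->
  (\int[leb]_(t in `[0%R, +oo[) (2 * (1 + k * cos (x * t)) * expR (- c * t))%:E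
   = (2 / c + 2 * k * c / (c ^+ 2 + x ^+ 2))%:E)%E.
Proof.
move=> k01.
rewrite (@ge0_continuous_FTC2y _ _ (F k x) 0 0).
- rewrite /F !mulr0 expR0 sin0 cos0 -EFinB; congr EFin; ring.
- by move=> t _; rewrite !mulr_ge0 ?expR_ge0// cos_ge0.
- exact/continuous_subspaceT/cint.
- exact: F_cvg.
- by move=> t _; have [] := dF k x t.
- apply: cvg_at_right_filter.
  apply: (@differentiable_continuous _ R^o R^o).
  by apply/derivable1_diffP; have [] := dF k x 0.
- by move=> t _; rewrite derive1E; have [_ ->] := dF k x t.
Qed.

Let csym (h : R -> R) : continuous h ->
  continuous (fun t : R => h t * expR (- c * `|t|)).
Proof.
move=> ch t; apply: cvgM; first exact: ch.
apply: continuous_cvg; first exact: continuous_expR.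
by apply: cvgM; [exact: cvg_cst|exact: norm_continuous].
Qed.

Let cos_cont (x : R) : continuous (fun t : R => 1 + cos (x * t)).
Proof.
move=> t; apply: cvgD; first exact: cvg_cst.
by apply: continuous_comp; [exact: mulrl_continuous|exact: continuous_cos].
Qed.

Let sin_cont (x : R) : continuous (fun t : R => 1 + sin (x * t)).
Proof.
move=> t; apply: cvgD; first exact: cvg_cst.
by apply: continuous_comp; [exact: mulrl_continuous|exact: continuous_sin].
Qed.

Let cos_integral (x : R) : (\int[leb]_t ((1 + cos (x * t)) * expR (- c * `|t|))%:E =
  (2 / c + 2 * c / (c ^+ 2 + x ^+ 2))%:E)%E.
Proof.
rewrite ge0_integral_fold; last 2 first.
- move=> t; apply: mulr_ge0; last exact: expR_ge0.
  by have := cos_geN1 (x * t); lra.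
- exact/csym/cos_cont.
rewrite (_ : 2 * c = 2 * 1 * c); last by rewrite mulr1.
rewrite -half_integral ?lexx ?ler01//.
apply: eq_integral => t; rewrite inE/= in_itv/= andbT => t0.
by rewrite normrN ger0_norm// mulrN cosN; congr EFin; ring.
Qed.

Let sin_integral (x : R) : (\int[leb]_t ((1 + sin (x * t)) * expR (- c * `|t|))%:E =
  (2 / c)%:E)%E.
Proof.
rewrite ge0_integral_fold; last 2 first.
- move=> t; apply: mulr_ge0; last exact: expR_ge0.
  by have := sin_geN1 (x * t); lra.
- exact/csym/sin_cont.
rewrite -[2 / c]addr0 -[X in _ + X](_ : 2 * 0 * c / (c ^+ 2 + x ^+ 2) = 0); last first.
  by rewrite mulr0 !mul0r.
rewrite -half_integral ?lexx ?ler01//.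
apply: eq_integral => t; rewrite inE/= in_itv/= andbT => t0.
by rewrite normrN ger0_norm// mulrN sinN; congr EFin; ring.
Qed.

Let laplace_integrable : leb.-integrable setT (fun t => (expR (- c * `|t|))%:E).
Proof.
have ce : continuous (fun t : R => expR (- c * `|t|)).
  move=> t; apply: continuous_cvg; first exact: continuous_expR.
  by apply: cvgM; [exact: cvg_cst|exact: norm_continuous].
apply/integrableP; split.
  by apply/measurable_EFinP; exact: continuous_measurable_fun.
have h : (\int[leb]_t ((1 + 1) * expR (- c * `|t|))%:E < +oo)%E.
  rewrite [ltLHS](_ : _ = (2 / c + 2 * c / (c ^+ 2 + 0 ^+ 2))%:E) ?ltry//.
  rewrite -(cos_integral 0); apply: eq_integral => t _.
  by rewrite mul0r cos0.
apply: le_lt_trans h.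
apply: ge0_le_integral => //.
- by apply/measurableT_comp/measurable_EFinP => //; exact: continuous_measurable_fun.
- by apply/measurable_EFinP; apply: measurable_funM => //; exact: continuous_measurable_fun.
- move=> t _; rewrite /= (ger0_norm (expR_ge0 _)) lee_fin.
  by rewrite ler_peMl ?expR_ge0//; lra.
Qed.

Lemma laplace_measure : exists nu, is_laplace c nu.
Proof.
have [nu hnu] := density_measure
  (fun t : measurableTypeR R => expR_ge0 (- c * `|t|)) laplace_integrable.
exists nu; split => // x.
have bcos : bmf (fun t : measurableTypeR R => cos (x * t)).
  have [] := @bmc_cis _ (measurableTypeR R) R _ (mulrl_measurable (D := setT) x).
  by under eq_fun do rewrite Re_cis.
have bsin : bmf (fun t : measurableTypeR R => sin (x * t)).
  have [_] := @bmc_cis _ (measurableTypeR R) R _ (mulrl_measurable (D := setT) x).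
  by under eq_fun do rewrite Im_cis.
have b1 := @bmf_cst _ (measurableTypeR R) R 1.
have hs y : \int[nu]_t (1 + sin (y * t)) = 2 / c.
  rewrite /Rintegral hnu; last first.
    apply: bmfD => //.
    have [_] := @bmc_cis _ (measurableTypeR R) R _ (mulrl_measurable (D := setT) y).
    by under eq_fun do rewrite Im_cis.
  by rewrite sin_integral.
have hc : \int[nu]_t (1 + cos (x * t)) = 2 / c + 2 * c / (c ^+ 2 + x ^+ 2).
  rewrite /Rintegral hnu; last exact: bmfD.
  by rewrite cos_integral.
have h1 : \int[nu]_t (1 : R) = 2 / c.
  rewrite -(hs 0); apply: eq_Rintegral => t _.
  by rewrite mul0r sin0 addr0.
apply: complex_ext => /=.
  under eq_Rintegral do rewrite Re_cis.
  apply: (addrI (2 / c)); rewrite -hc -h1 -RintegralD//; exact: bmf_integrable.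
under eq_Rintegral do rewrite Im_cis.
apply: (addrI (2 / c)); rewrite -{1}h1 addr0 -(hs x) -RintegralD//; exact: bmf_integrable.
Qed.

End laplace.

Section cauchy_kernel.
Context {R : realType}.
Local Notation leb := (@lebesgue_measure R).
Local Notation TR := (measurableTypeR R).

Let oneDsqr_ge0 (x : R) : 0 <= 1 + x ^+ 2.
Proof. by rewrite addr_ge0// sqr_ge0. Qed.

Let cauchyT : (\int[leb]_s (2 / (1 + s ^+ 2))%:E = (2 * pi)%:E)%E.
Proof.
rewrite ge0_integral_fold.
- have mV : measurable_fun [set: R] (fun x : R => (1 + x ^+ 2)^-1).
    by apply: continuous_measurable_fun; exact: continuous_oneDsqrV.
  transitivity (\int[leb]_(x in `[0%R, +oo[) (4%:E * (1 + x ^+ 2)^-1%:E))%E.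
    apply: eq_integral => x _; rewrite sqrrN -EFinM; congr EFin.
    by rewrite -mulrDl; congr (_ * _); lra.
  rewrite ge0_integralZl//.
  - rewrite integral0y_oneDsqr -EFinM; congr EFin; lra.
  - by apply/measurable_EFinP/measurable_funTS.
  - by move=> x _; rewrite lee_fin invr_ge0 oneDsqr_ge0.
- by move=> s; rewrite divr_ge0// oneDsqr_ge0.
- by move=> s; apply: cvgM; [exact: cvg_cst|exact: continuous_oneDsqrV].
Qed.

Let affine (u e : R) (G : R -> R) : 0 < e -> (forall x, 0 <= G x) ->
  continuous G ->
  (\int[leb]_x (G x)%:E = \int[leb]_s (G (u + e * s) * e)%:E)%E.
Proof.
move=> e0 G0 cG.
have d (s : R) : is_derive s 1 (fun s => u + e * s) e.
  by apply: is_derive_eq; rewrite /GRing.scale/=; ring.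
have dE : (fun s => u + e * s)^`()%classic = cst e.
  by apply/funext => s; rewrite derive1E; have [_ ->] := d s.
rewrite (@increasing_ge0_integration_by_substitutionT _ (fun s => u + e * s) G)//.
- by rewrite dE.
- by move=> x y xy; rewrite ltrD2l ltr_pM2l.
- by rewrite dE; exact: cst_continuous.
- by rewrite dE; exact: is_cvg_cst.
- by rewrite dE; exact: is_cvg_cst.
- apply/cvgrNyPle => A; near=> s.
  rewrite -lerBrDl -ler_pdivlMl//; near: s; exact: nbhs_ninfty_le.
- apply/cvgryPge => A; near=> s.
  rewrite -lerBlDl -ler_pdivrMl//; near: s; exact: nbhs_pinfty_ge.
Unshelve. all: by end_near. Qed.

(** The kernel of width e centred at u is the image of one fixed finite measure
under the affine map of slope e, so it concentrates at u as e vanishes. *)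
Definition is_cauchy (kappa : {finite_measure set TR -> \bar R}) :=
  fine (kappa setT) = 2 * pi /\
  forall (r : R -> R) (M u e : R), continuous r -> (forall t, `|r t| <= M) ->
    0 < e ->
    \int[leb]_t (r t * (2 * e / (e ^+ 2 + (t - u) ^+ 2))) =
    \int[kappa]_s r (u + e * s).

Lemma cauchy_measure : exists kappa, is_cauchy kappa.
Proof.
have cc : continuous (fun s : R => 2 / (1 + s ^+ 2)).
  by move=> s; apply: cvgM; [exact: cvg_cst|exact: continuous_oneDsqrV].
have c_ge0 (s : TR) : 0 <= 2 / (1 + s ^+ 2) by rewrite divr_ge0// oneDsqr_ge0.
have ge0_intble (h : R -> R) : (forall x, 0 <= h x) -> continuous h ->
    (\int[leb]_x (h x)%:E < +oo)%E -> leb.-integrable setT (EFin \o h).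
  move=> h0 ch hy; apply/integrableP; split.
    by apply/measurable_EFinP; exact: continuous_measurable_fun.
  by under eq_integral do rewrite /= ger0_norm//.
have c_int : leb.-integrable setT (fun s : R => (2 / (1 + s ^+ 2))%:E).
  by apply: ge0_intble => //; rewrite cauchyT ltry.
have [kappa hk] := density_measure c_ge0 c_int.
exists kappa; split.
  rewrite -[LHS]mul1r -Rintegral_cst// /Rintegral hk; last exact: bmf_cst.
  by under eq_integral do rewrite mul1r; rewrite cauchyT.
move=> r M u e cr rM e0.
have M0 : 0 <= M by apply: le_trans (rM 0).
pose K (t : R) := 2 * e / (e ^+ 2 + (t - u) ^+ 2).
have den_gt0 (t : R) : 0 < e ^+ 2 + (t - u) ^+ 2.
  by rewrite ltr_wpDr ?sqr_ge0// exprn_gt0.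
have K0 t : 0 <= K t by rewrite divr_ge0 ?ltW// mulr_gt0.
have cK : continuous K.
  move=> t; apply: cvgM; first exact: cvg_cst.
  apply: cvgV; first by rewrite gt_eqF.
  apply: cvgD; first exact: cvg_cst.
  apply: (@continuous_comp _ _ _ (fun t => t - u) (fun y : R => y ^+ 2)).
    by apply: cvgB; [exact: cvg_id|exact: cvg_cst].
  exact: exprn_continuous.
have Ke s : K (u + e * s) * e = 2 / (1 + s ^+ 2).
  have h1 : 0 < 1 + s ^+ 2 by rewrite ltr_wpDr ?sqr_ge0.
  rewrite /K (_ : e ^+ 2 + _ = e ^+ 2 * (1 + s ^+ 2)); last by ring.
  by field; rewrite (gt_eqF e0) (gt_eqF h1).
have key (h : R -> R) N : continuous h -> (forall t, 0 <= h t) ->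
    (forall t, `|h t| <= N) ->
    leb.-integrable setT (EFin \o (fun t => h t * K t)) /\
    \int[leb]_t (h t * K t) = \int[kappa]_s h (u + e * s).
  move=> ch h0 hN.
  have chK : continuous (fun t => h t * K t).
    by move=> t; apply: cvgM; [exact: ch|exact: cK].
  have bh : bmf (fun s : TR => h (u + e * s)).
    split; last by exists N.
    apply: continuous_measurable_fun => s.
    apply: (@continuous_comp _ _ _ (fun s => u + e * s) h); last exact: ch.
    by apply: cvgD; [exact: cvg_cst|exact: mulrl_continuous].
  have E : (\int[leb]_t (h t * K t)%:E = \int[kappa]_s (h (u + e * s))%:E)%E.
    rewrite hk// (@affine u e)//; last by move=> x; rewrite mulr_ge0.
    by apply: eq_integral => s _; rewrite -mulrA Ke.
  split; last by rewrite /Rintegral E.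
  apply: ge0_intble => //; first by move=> x; rewrite mulr_ge0.
  by rewrite E ltey_eq integrable_fin_num//; exact: bmf_integrable.
(* The change of variables is available for nonnegative functions: shift r by its bound. *)
have rM0 t : 0 <= r t + M.
  by have := rM t; rewrite ler_norml => /andP[]; lra.
have rMM t : `|r t + M| <= M + M.
  by rewrite (le_trans (ler_normD _ _))// lerD// ger0_norm.
have crM : continuous (fun t => r t + M).
  by move=> t; apply: cvgD; [exact: cr|exact: cvg_cst].
have MM (t : R) : `|M| <= M by rewrite ger0_norm.
have [i1 e1] := key _ _ crM rM0 rMM.
have [i2 e2] := key (cst M) M (@cst_continuous _ _ M) (fun=> M0) MM.
have -> : (fun t => r t * K t) = (fun t => (r t + M) * K t - M * K t).
  by apply/funext => t; ring.
have bc (N : R) : kappa.-integrable setT (EFin \o (fun=> N)).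
  by apply: bmf_integrable; exact: bmf_cst.
rewrite RintegralB// e1 e2 -RintegralB//.
- by apply: eq_Rintegral => s _ /=; rewrite addrK.
- apply: bmf_integrable; apply: bmfD; last exact: bmf_cst.
  split; last by exists M.
  apply: continuous_measurable_fun => s.
  apply: (@continuous_comp _ _ _ (fun s => u + e * s) r); last exact: cr.
  by apply: cvgD; [exact: cvg_cst|exact: mulrl_continuous].
- exact: bc.
Qed.

End cauchy_kernel.

(** * Fourier inversion of a nonnegative transform *)

Section inversion.
Context {R : realType}.
Local Notation TR := (measurableTypeR R).

Lemma bmc_continuous (r : R -> R[i]) M : continuous (fun t => Re (r t)) ->
  continuous (fun t => Im (r t)) -> (forall t, normc (r t) <= M) ->
  bmc (r : TR -> R[i]).
Proof.
move=> cr ci rM; apply: bmc_intro rM; exact: continuous_measurable_fun.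
Qed.

Lemma bmc_cis_prod (a b : TR * TR -> R) : measurable_fun setT a ->
  measurable_fun setT b -> bmc (fun z => cis (a z * b z)).
Proof. by move=> ma mb; apply: bmc_cis; exact: measurable_funM. Qed.

Lemma mfst : measurable_fun setT (fun z : TR * TR => z.1 : R).
Proof. exact: measurable_fst. Qed.

Lemma msnd : measurable_fun setT (fun z : TR * TR => z.2 : R).
Proof. exact: measurable_snd. Qed.

(** A smoothed form of Fourier inversion: integrating the transform of psi
against a character and a two-sided exponential replaces psi by its average
against a Cauchy kernel, whose width is the rate of the exponential. *)
Lemma smoothed_inversion (c : R) (lap : {finite_measure set TR -> \bar R})
    (kappa : {finite_measure set TR -> \bar R}) (psi : R -> R[i]) (M : R) :
  0 < c -> is_laplace c lap -> is_cauchy kappa ->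
  continuous (fun t => Re (psi t)) -> continuous (fun t => Im (psi t)) ->
  (forall t, normc (psi t) <= M) ->
  forall (e u : R) (lape : {finite_measure set TR -> \bar R}), 0 < e ->
  is_laplace e lape ->
  cintegral lape (fun x => cis (u * x) *
    cintegral lap (fun t => psi t * cis (- (x * t)))) =
  cintegral kappa (fun s => psi (u + e * s) * (expR (- c * `|u + e * s|))%:C).
Proof.
move=> c0 [hlap _] [_ hk] cr ci psiM e u lape e0 [_ hlape].
have bpsi := bmc_continuous cr ci psiM.
have -> : cintegral lape (fun x => cis (u * x) *
    cintegral lap (fun t => psi t * cis (- (x * t)))) =
  cintegral lape (fun x => cintegral lap (fun t =>
    psi t * cis ((u - t) * x))).
  congr cintegral; apply/funext => x; rewrite -cintegralZ; last first.
    apply: bmcM => //; apply: bmc_cis; under eq_fun do rewrite -mulNr.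
    exact: mulrl_measurable.
  congr cintegral; apply/funext => t.
  by rewrite mulrBl cisD mulrCA -mulNr (mulrC t) mulNr.
have bz : bmc (fun z : TR * TR => psi z.2 * cis ((u - z.2) * z.1)).
  apply: bmcM; first exact: (bmc_snd bpsi).
  apply: bmc_cis_prod; last exact: mfst.
  by apply: measurable_funB; [exact: measurable_cst|exact: msnd].
rewrite (bmc_Fubini _ _ bz)/=.
have -> : (fun t => cintegral lape (fun x => psi t * cis ((u - t) * x))) =
    (fun t => psi t * (2 * e / (e ^+ 2 + (t - u) ^+ 2))%:C).
  apply/funext => t; rewrite cintegralZ ?hlape -?[(t - u) ^+ 2]sqrrN ?opprB//.
  by apply: bmc_cis; exact: mulrl_measurable.
have den_gt0 (t : R) : 0 < e ^+ 2 + (t - u) ^+ 2.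
  by rewrite ltr_wpDr ?sqr_ge0// exprn_gt0.
pose K (t : R) := 2 * e / (e ^+ 2 + (t - u) ^+ 2).
have K0 t : 0 <= K t by rewrite divr_ge0 ?ltW// mulr_gt0.
have cK : continuous K.
  move=> t; apply: cvgM; first exact: cvg_cst.
  apply: cvgV; first by rewrite gt_eqF.
  apply: cvgD; first exact: cvg_cst.
  apply: (@continuous_comp _ _ _ (fun t => t - u) (fun y : R => y ^+ 2)).
    by apply: cvgB; [exact: cvg_id|exact: cvg_cst].
  exact: exprn_continuous.
have bK : bmf (K : TR -> R).
  split; first exact: continuous_measurable_fun.
  exists (2 / e) => t; rewrite ger0_norm// /K ler_pdivrMr//.
  rewrite mulrDr -[2 * e]addr0 lerD//.
    by rewrite expr2 mulrA divfK ?gt_eqF.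
  by rewrite mulr_ge0 ?sqr_ge0// divr_ge0// ltW.
have part (r : R -> R) : continuous r -> (forall t, `|r t| <= M) ->
    \int[lap]_t (r t * K t) =
    \int[kappa]_s (r (u + e * s) * expR (- c * `|u + e * s|)).
  move=> cr' rM.
  have br : bmf (r : TR -> R).
    by split; [exact: continuous_measurable_fun|exists M].
  rewrite /Rintegral hlap; last exact: bmfM.
  rewrite -/(Rintegral _ _ _) -(hk (fun t => r t * expR (- c * `|t|)) M)//.
  - by apply: eq_Rintegral => t _; rewrite mulrAC.
  - move=> t; apply: cvgM; first exact: cr'.
    apply: continuous_cvg; first exact: continuous_expR.
    by apply: cvgM; [exact: cvg_cst|exact: norm_continuous].
  - move=> t; rewrite normrM (le_trans _ (rM t))// (ger0_norm (expR_ge0 _)).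
    apply: ler_piMr => //.
    by rewrite expR_le1 mulNr oppr_le0 mulr_ge0// ltW.
have zr (z : R[i]) (x : R) : Re (z * x%:C) = Re z * x.
  by rewrite ReM/= mulr0 subr0.
have zi (z : R[i]) (x : R) : Im (z * x%:C) = Im z * x.
  by rewrite ImM/= mulr0 add0r.
apply: complex_ext => /=.
  transitivity (\int[lap]_t (Re (psi t) * K t)).
    by apply: eq_Rintegral => t _; exact: zr.
  rewrite (part (fun t => Re (psi t)))//.
    by apply: eq_Rintegral => t _; rewrite zr.
  by move=> t; exact: le_trans (Re_le_normc _) _.
transitivity (\int[lap]_t (Im (psi t) * K t)).
  by apply: eq_Rintegral => t _; exact: zi.
rewrite (part (fun t => Im (psi t)))//.
  by apply: eq_Rintegral => t _; rewrite zi.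
by move=> t; exact: le_trans (Im_le_normc _) _.
Qed.

End inversion.

Section positive_inversion.
Context {R : realType}.
Local Notation leb := (@lebesgue_measure R).
Local Notation TR := (measurableTypeR R).

(** Up to normalization, this says that psi(t) exp(- c |t|) is a characteristic
function; in this form the property visibly passes to translates, mixtures and
limits. *)
Definition pos_transform (lap : {finite_measure set TR -> \bar R})
    (psi : R -> R[i]) :=
  forall x, 0 <= cintegral lap (fun t => psi t * cis (- (x * t))).

Lemma bmc_character (u : R) : bmc (fun x : TR => cis (u * x)).
Proof. by apply: bmc_cis; exact: mulrl_measurable. Qed.

Lemma bmc_characterN (u : R) : bmc (fun x : TR => cis (- (u * x))).
Proof.
by apply: bmc_cis; under eq_fun do rewrite -mulNr; exact: mulrl_measurable.
Qed.

Lemma bmc_transform (lap : {finite_measure set TR -> \bar R}) (psi : TR -> R[i]) :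
  bmc psi ->
  bmc (fun x : TR => cintegral lap (fun t => psi t * cis (- (x * t)))).
Proof.
move=> bpsi.
have bz : bmc (fun z : TR * TR => psi z.2 * cis (- z.1 * z.2)).
  apply: bmcM; first exact: (bmc_snd bpsi).
  apply: bmc_cis_prod; last exact: msnd.
  by apply: measurable_funN; exact: mfst.
have := bmc_int2 lap lap bz; congr bmc; apply/funext => x /=.
by congr cintegral; apply/funext => t; rewrite mulNr.
Qed.

Lemma expR_bmf (e : R) : 0 <= e -> bmf (fun x : TR => expR (- e * `|x|)).
Proof.
move=> e0; split.
  apply: continuous_measurable_fun => t.
  apply: continuous_cvg; first exact: continuous_expR.
  by apply: cvgM; [exact: cvg_cst|exact: norm_continuous].
exists 1 => x; rewrite (ger0_norm (expR_ge0 _)) expR_le1 mulNr oppr_le0.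
by rewrite mulr_ge0.
Qed.

Lemma expR_cvg1 (x : R) : expR (- (n.+1%:R^-1) * `|x|) @[n --> \oo] --> (1 : R).
Proof.
rewrite -[X in _ --> X]expR0; apply: continuous_cvg; first exact: continuous_expR.
rewrite -[X in _ --> X](mul0r `|x|); apply: cvgMl.
by rewrite -[X in _ --> X]oppr0; apply: cvgN; exact: cvg_harmonic.
Qed.

(** A function whose damped transform is nonnegative is, after damping, a
characteristic function: the transform is its density up to the factor 2 pi.
Letting the extra smoothing vanish, monotone convergence gives the total mass
and then bounded convergence the characteristic function. *)
Lemma positive_inversion (c : R) (lap : {finite_measure set TR -> \bar R})
    (psi : R -> R[i]) (M : R) :
  0 < c -> is_laplace c lap ->
  continuous (fun t => Re (psi t)) -> continuous (fun t => Im (psi t)) ->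
  (forall t, normc (psi t) <= M) -> psi 0 = 1 -> pos_transform lap psi ->
  exists P : {finite_measure set TR -> \bar R}, P setT = 1%E /\
    forall u, cintegral P (fun x => cis (u * x)) =
      psi u * (expR (- c * `|u|))%:C.
Proof.
move=> c0 lapc cr ci psiM psi0 pos.
have bpsi := bmc_continuous cr ci psiM.
pose H x := Re (cintegral lap (fun t => psi t * cis (- (x * t)))).
have HE x : cintegral lap (fun t => psi t * cis (- (x * t))) = (H x)%:C.
  by apply: complex_ext => //; exact/ger0_Im/pos.
have H0 x : 0 <= H x by have := pos x; rewrite HE lecR.
have bH : bmf (H : TR -> R) by have [] := bmc_transform lap bpsi.
have [kappa hk] := @cauchy_measure R.
pose e n : R := n.+1%:R^-1.
have e0 n : 0 < e n by rewrite invr_gt0.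
have [ln hln] := choice (fun n => laplace_measure (e0 n)).
pose phi t := psi t * (expR (- c * `|t|))%:C.
pose A u n := cintegral (ln n) (fun x => cis (u * x) * (H x)%:C).
have AE u n : A u n = cintegral kappa (fun s => phi (u + e n * s)).
  rewrite -(smoothed_inversion c0 lapc hk cr ci psiM u (e0 n) (hln n)).
  by congr cintegral; apply/funext => x; rewrite HE.
have cphi u : ccvg (fun n => A u n) (phi u * (2 * pi)%:C).
  have [<- _] := hk; rewrite -cintegral_cst.
  under [X in ccvg X _]eq_fun do rewrite AE.
  have ce s : u + e n * s @[n --> \oo] --> u.
    rewrite -[X in _ --> X]addr0; apply: cvgD; first exact: cvg_cst.
    by rewrite -[X in _ --> X](mul0r s); apply: cvgMl; exact: cvg_harmonic.
  have bb n : bmc (fun s : TR => phi (u + e n * s)).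
    have ca : continuous (fun s : R => u + e n * s).
      by move=> s; apply: cvgD; [exact: cvg_cst|exact: mulrl_continuous].
    apply: bmcM.
      apply: (@bmc_continuous _ (fun s => psi (u + e n * s)) M) => [s|s|s] //.
        by apply: (@continuous_comp _ _ _ (fun s => u + e n * s)
          (fun t => Re (psi t))); [exact: ca|exact: cr].
      by apply: (@continuous_comp _ _ _ (fun s => u + e n * s)
        (fun t => Im (psi t))); [exact: ca|exact: ci].
    apply: bmc_real; split; last first.
      have [_ [N hN]] := expR_bmf (ltW c0).
      by exists N => s; exact: hN.
    apply: (measurableT_comp (expR_bmf (ltW c0)).1).
    exact: continuous_measurable_fun.
  apply: (@cbounded_convergence _ _ _ _ _ _ M) => // [n s|s].
    rewrite normcM normc_real (ger0_norm (expR_ge0 _)).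
    rewrite (le_trans _ (psiM (u + e n * s)))// ler_piMr ?normc_ge0//.
    by rewrite expR_le1 mulNr oppr_le0 mulr_ge0// ltW.
  apply: ccvgM.
    split.
      apply: (@continuous_cvg _ _ _ _ _ _ (fun t => Re (psi t))).
        exact: cr.
      exact: ce.
    apply: (@continuous_cvg _ _ _ _ _ _ (fun t => Im (psi t))).
      exact: ci.
    exact: ce.
  apply: ccvg_real; apply: continuous_cvg; first exact: continuous_expR.
  by apply: cvgMr; apply: cvg_norm; exact: ce.
have mH : measurable_fun setT (fun x : R => H x) by case: bH.
have lebH : (\int[leb]_x (H x)%:E = (2 * pi)%:E)%E.
  have [c1 _] := cphi 0.
  have h1 : (\int[leb]_x (H x * expR (- e n * `|x|))%:E)%E @[n --> \oo] -->
      (2 * pi)%:E.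
    have -> : (fun n => \int[leb]_x (H x * expR (- e n * `|x|))%:E)%E =
        (fun n => (Re (A 0 n))%:E).
      apply/funext => n; rewrite -(hln n).1//.
      rewrite /A /= /Rintegral fineK; last first.
        under eq_integral do rewrite mul0r cis0 mul1r.
        by apply: integrable_fin_num => //; exact: bmf_integrable.
      by under [RHS]eq_integral do rewrite mul0r cis0 mul1r.
    apply: cvg_EFin; first exact: nearW.
    move: c1; rewrite /phi normr0 mulr0 expR0 psi0 ReM/=.
    by rewrite !mul1r !mulr0 !subr0.
  have h2 : (\int[leb]_x (H x * expR (- e n * `|x|))%:E)%E @[n --> \oo] -->
      (\int[leb]_x (H x)%:E)%E.
    have := @cvg_monotone_convergence _ _ R leb setT measurableT
      (fun n x => (H x * expR (- e n * `|x|))%:E).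
    rewrite [X in _ -> _ -> _ -> _ --> X](_ : _ = \int[leb]_x (H x)%:E)%E; last first.
      apply: eq_integral => x _; apply/cvg_lim => //.
      apply: cvg_EFin; first exact: nearW.
      by rewrite -[X in _ --> X]mulr1; apply: cvgMr; exact: expR_cvg1.
    apply.
    - move=> n; apply/measurable_EFinP/measurable_funM => //.
      by have [] := expR_bmf (ltW (e0 n)).
    - by move=> n x _; rewrite lee_fin mulr_ge0// expR_ge0.
    - move=> x _ n m nm; rewrite lee_fin ler_wpM2l// ler_expR.
      rewrite ler_wpM2r// lerN2 lef_pV2 ?posrE ?ltr0n// ler_nat ltnS.
      exact: nm.
  exact: (cvg_unique _ h2 h1).
have pi2 : 0 < 2 * pi :> R by rewrite mulr_gt0// pi_gt0.
have p0 (x : TR) : 0 <= H x / (2 * pi) by rewrite divr_ge0// ltW.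
have lebp : (\int[leb]_x (H x / (2 * pi))%:E = 1)%E.
  under eq_integral do rewrite mulrC EFinM.
  rewrite ge0_integralZl//.
  - by rewrite lebH -EFinM mulVf// gt_eqF.
  - exact/measurable_EFinP.
  - by move=> x _; rewrite lee_fin.
  - by rewrite lee_fin invr_ge0 ltW.
have pint : leb.-integrable setT (fun x : TR => (H x / (2 * pi))%:E).
  apply/integrableP; split.
    by apply/measurable_EFinP/measurable_funM => //; exact: measurable_cst.
  by under eq_integral do rewrite /= ger0_norm//; rewrite lebp ltry.
have [P hP] := density_measure p0 pint.
exists P; split.
  have := hP _ (bmf_cst 1); rewrite integral_cst// mul1e => ->.
  by under eq_integral do rewrite mul1r.
move=> u; apply: (@ccvg_unique _ (fun n => A u n * (2 * pi)^-1%:C)); last first.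
  have -> : psi u * (expR (- c * `|u|))%:C = phi u * (2 * pi)%:C * (2 * pi)^-1%:C.
    by rewrite -mulrA -rmorphM/= mulfV ?gt_eqF// mulr1.
  by apply: ccvgM; [exact: cphi|exact: ccvg_cst].
have Ee n x : cis (u * x) * (expR (- e n * `|x|))%:C =
    cos (u * x) * expR (- e n * `|x|) +i* (sin (u * x) * expR (- e n * `|x|)).
  apply: complex_ext; first by rewrite ReM Re_cis/= mulr0 subr0.
  by rewrite ImM Im_cis/= mulr0 add0r.
have part n (r : R -> R) : bmf (r : TR -> R) ->
    \int[P]_x (r x * expR (- e n * `|x|)) =
    (\int[ln n]_x (r x * H x)) * (2 * pi)^-1.
  move=> br; rewrite -RintegralZr//; last by apply: bmf_integrable; exact: bmfM.
  have be := expR_bmf (ltW (e0 n)).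
  rewrite /Rintegral hP; last exact: bmfM.
  rewrite (hln n).1; last by apply: bmfM; [exact: bmfM|exact: bmf_cst].
  by congr fine; apply: eq_integral => x _; congr EFin; ring.
have -> : (fun n => A u n * (2 * pi)^-1%:C) =
    (fun n => cintegral P (fun x => cis (u * x) * (expR (- e n * `|x|))%:C)).
  apply/funext => n; apply: complex_ext.
    rewrite ReM /A /= mulr0 subr0.
    under [RHS]eq_Rintegral do rewrite Ee/=.
    rewrite part; last first.
      have [] := bmc_character u.
      by under eq_fun do rewrite Re_cis.
    congr (_ * _); apply: eq_Rintegral => x _.
    by rewrite ReM Re_cis /= mulr0 subr0.
  rewrite ImM /A /= mulr0 add0r.
  under [RHS]eq_Rintegral do rewrite Ee/=.
  rewrite part; last first.
    have [_] := bmc_character u.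
    by under eq_fun do rewrite Im_cis.
  congr (_ * _); apply: eq_Rintegral => x _.
  by rewrite ImM Im_cis /= mulr0 add0r.
apply: (@cbounded_convergence _ _ _ _ _ _ 1).
- move=> n; apply: bmcM; first exact: bmc_character.
  exact/bmc_real/expR_bmf/ltW.
- move=> n x; rewrite normcM normc_cis mul1r normc_real (ger0_norm (expR_ge0 _)).
  by rewrite expR_le1 mulNr oppr_le0 mulr_ge0// ltW.
- move=> x; rewrite -[X in ccvg _ X]mulr1; apply: ccvgM; first exact: ccvg_cst.
  by apply: ccvg_real; exact: expR_cvg1.
Qed.

End positive_inversion.

(** * Uniqueness of the characteristic function *)

Section cf_uniqueness.
Context {R : realType}.
Local Notation leb := (@lebesgue_measure R).
Local Notation TR := (measurableTypeR R).

Let K (c x : R) : R := 2 * c / (c ^+ 2 + x ^+ 2).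

Let den_gt0 (c x : R) : 0 < c -> 0 < c ^+ 2 + x ^+ 2.
Proof. by move=> c0; rewrite ltr_wpDr ?sqr_ge0// exprn_gt0. Qed.

Let K_cont c : 0 < c -> continuous (K c).
Proof.
move=> c0 t; apply: cvgM; first exact: cvg_cst.
apply: cvgV; first by rewrite gt_eqF// den_gt0.
by apply: cvgD; [exact: cvg_cst|exact: exprn_continuous].
Qed.

Let K_bmf c : 0 < c -> bmf (K c : TR -> R).
Proof.
move=> c0; split; first exact: (continuous_measurable_fun (K_cont c0)).
exists (2 / c) => t; rewrite ger0_norm; last first.
  by rewrite divr_ge0 ?ltW ?den_gt0// mulr_gt0.
rewrite /K ler_pdivrMr ?den_gt0// mulrDr -[2 * c]addr0 lerD//.
  by rewrite expr2 mulrA divfK ?gt_eqF.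
by rewrite mulr_ge0 ?sqr_ge0// divr_ge0// ltW.
Qed.

Let atan_integral (c a b x : R) : 0 < c -> a < b ->
  \int[leb]_(y in `[a, b]) K c (x - y) =
  2 * (atan ((b - x) / c) - atan ((a - x) / c)).
Proof.
move=> c0 ab.
have d (y : R) : is_derive y 1 (fun y => 2 * atan ((y - x) / c)) (K c (x - y)).
  have d1 : is_derive y 1 (fun y => (y - x) / c) (c^-1).
    by apply: is_derive_eq; rewrite /GRing.scale/=; ring.
  apply: is_derive_eq; rewrite /GRing.scale/= /K.
  have c_neq0 : c != 0 by rewrite gt_eqF.
  have h1 : 0 < 1 + ((y - x) / c) ^+ 2 by rewrite ltr_wpDr ?sqr_ge0.
  rewrite (_ : c ^+ 2 + _ = c ^+ 2 * (1 + ((y - x) / c) ^+ 2)); last by field.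
  set u := 1 + _ in h1 *.
  by field; rewrite c_neq0 gt_eqF.
have cF : continuous (fun y => 2 * atan ((y - x) / c)).
  move=> y; apply: (@differentiable_continuous _ R^o R^o).
  by apply/derivable1_diffP; have [] := d y.
rewrite /Rintegral (@continuous_FTC2 _ _ (fun y => 2 * atan ((y - x) / c)))//.
- by rewrite -EFinB /= mulrBr.
- apply: continuous_subspaceT => y.
  apply: (@continuous_comp _ _ _ (fun y => x - y)); last exact: K_cont.
  by apply: cvgB; [exact: cvg_cst|exact: cvg_id].
- split.
  + by move=> y _; have [] := d y.
  + by apply: cvg_at_right_filter; exact: cF.
  + by apply: cvg_at_left_filter; exact: cF.
- by move=> y _; rewrite derive1E; have [_ ->] := d y.
Qed.

(** Integration over an interval as a finite measure, for use in Fubini's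
theorem. *)
Let interval_measure (a b : R) : exists nu : {finite_measure set TR -> \bar R},
  forall g, bmf g -> \int[nu]_x g x = \int[leb]_(x in `[a, b]) g x.
Proof.
have i0 (x : TR) : 0 <= \1_`[a, b] x :> R by [].
have ii : leb.-integrable setT (EFin \o (\1_`[a, b] : TR -> R)).
  apply/integrableP; split.
    by apply/measurable_EFinP; exact: measurable_indic.
  under eq_integral do rewrite /= ger0_norm//.
  rewrite integral_indic//= setIT.
  by rewrite lebesgue_measure_itv/=; case: ifPn => _; rewrite -?EFinB ltry.
have [nu hnu] := density_measure i0 ii; exists nu => g bg.
rewrite [RHS]Rintegral_mkcond /Rintegral (hnu _ bg); congr fine.
apply: eq_integral => x _; rewrite patchE indicE.
by case: ifPn => _; rewrite ?mulr1 ?mulr0.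
Qed.

Variables mu nu : {finite_measure set TR -> \bar R}.
Hypothesis same_cf : forall t,
  cintegral mu (fun x => cis (t * x)) = cintegral nu (fun x => cis (t * x)).

(** The Cauchy kernel centred at y is a mixture of characters. *)
Let same_K c y : 0 < c ->
  \int[mu]_x K c (x - y) = \int[nu]_x K c (x - y).
Proof.
move=> c0; have [lap [_ hlap]] := laplace_measure c0.
have E (m : {finite_measure set TR -> \bar R}) :
    cintegral m (fun x => (K c (x - y))%:C) =
    cintegral lap (fun t => cis (- (y * t)) * cintegral m (fun x => cis (t * x))).
  have bz : bmc (fun z : TR * TR => cis ((z.1 - y) * z.2)).
    apply: bmc_cis_prod; last exact: msnd.
    by apply: measurable_funB; [exact: mfst|exact: measurable_cst].
  transitivity (cintegral m (fun x => cintegral lap (fun t => cis ((x - y) * t)))).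
    by congr cintegral; apply/funext => x; rewrite hlap.
  rewrite (bmc_Fubini _ _ bz)/=; congr cintegral; apply/funext => t.
  rewrite -cintegralZ; last exact: bmc_character.
  congr cintegral; apply/funext => x.
  by rewrite -cisD; congr cis; ring.
have : cintegral mu (fun x => (K c (x - y))%:C) =
       cintegral nu (fun x => (K c (x - y))%:C).
  by rewrite !E; congr cintegral; apply/funext => t; rewrite same_cf.
by rewrite !cintegral_real => /complexI.
Qed.

(** Integrating over the centres turns Cauchy kernels into arctangents. *)
Let same_atan c a b : 0 < c -> a < b ->
  \int[mu]_x (2 * (atan ((b - x) / c) - atan ((a - x) / c))) =
  \int[nu]_x (2 * (atan ((b - x) / c) - atan ((a - x) / c))).
Proof.
move=> c0 ab; have [rho hrho] := interval_measure a b.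
have bK : bmf (fun z : TR * TR => K c (z.1 - z.2)).
  have [mK [M hM]] := K_bmf c0; split; last by exists M.
  apply: (measurableT_comp mK).
  by apply: measurable_funB; [exact: mfst|exact: msnd].
have E (m : {finite_measure set TR -> \bar R}) :
    \int[m]_x (2 * (atan ((b - x) / c) - atan ((a - x) / c))) =
    \int[rho]_y \int[m]_x K c (x - y).
  rewrite -(bmf_Fubini m rho bK)/=; apply: eq_Rintegral => x _.
  by rewrite hrho ?atan_integral//; exact: (bmf_section1 x bK).
by rewrite !E; apply: eq_Rintegral => y _; exact: same_K.
Qed.

Let w (n : nat) : R := (n.+1%:R ^+ 2)^-1.
Let be b (n : nat) : R := b + n.+1%:R^-1.

Let large (A : R) : \forall n \near \oo, A <= n.+1%:R.
Proof.
near=> n; rewrite (@le_trans _ _ n%:R) ?ler_nat//.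
by near: n; exact: nbhs_infty_ger.
Unshelve. all: by end_near. Qed.

Let sep_right b x : x <= b -> (be b n - x) / w n @[n --> \oo] --> +oo.
Proof.
move=> xb; apply/cvgryPge => A; near=> n.
have n1 : A <= n.+1%:R :> R by near: n; exact: large.
rewrite /w invrK /be; set N : R := n.+1%:R in n1 *.
have N0 : 0 < N by rewrite /N ltr0n.
have -> : (b + N^-1 - x) * N ^+ 2 = (b - x) * N ^+ 2 + N.
  by field; rewrite gt_eqF.
by rewrite (le_trans n1)// lerDr mulr_ge0 ?subr_ge0// sqr_ge0.
Unshelve. all: by end_near. Qed.

Let sep_left b x : b < x -> (be b n - x) / w n @[n --> \oo] --> -oo.
Proof.
move=> bx; apply/cvgrNyPle => A; near=> n.
have n1 : (1 + `|A|) / (x - b) <= n.+1%:R :> R by near: n; exact: large.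
have n2 : (1 : R) <= n.+1%:R by rewrite ler1n.
rewrite /w invrK /be; set N : R := n.+1%:R in n1 n2 *.
have N0 : 0 < N by rewrite /N ltr0n.
have -> : (b + N^-1 - x) * N ^+ 2 = N * (1 - N * (x - b)).
  by field; rewrite gt_eqF.
have A0 := ler_norm (- A); rewrite normrN in A0.
have {}n1 : 1 + `|A| <= N * (x - b) by rewrite -ler_pdivrMr ?subr_gt0.
have h : N * (1 - N * (x - b)) <= 1 * (1 - N * (x - b)).
  rewrite ler_wnM2r// subr_le0 (le_trans _ n1)// lerDl; exact: normr_ge0.
by lra.
Unshelve. all: by end_near. Qed.

Let sep_low (x : R) : (- n%:R - x) / w n @[n --> \oo] --> -oo.
Proof.
apply/cvgrNyPle => A; near=> n.
have n1 : 1 - x + `|A| <= n.+1%:R :> R by near: n; exact: large.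
have n2 : (1 : R) <= n.+1%:R by rewrite ler1n.
rewrite /w invrK.
have -> : - n%:R - x = 1 - n.+1%:R - x :> R by rewrite -natr1; ring.
set N : R := n.+1%:R in n1 n2 *.
have A0 := ler_norm (- A); rewrite normrN in A0.
have h1 : 1 <= N ^+ 2 by rewrite exprn_ege1.
have h : (1 - N - x) * N ^+ 2 <= (1 - N - x) * 1.
  by rewrite ler_wnM2l//; have := normr_ge0 A; lra.
by lra.
Unshelve. all: by end_near. Qed.

Let cvgNy_atan : atan x @[x --> -oo] --> - (pi / 2 : R).
Proof.
apply/cvgNy_compNP; rewrite (_ : _ \o _ = \- (@atan R)); last first.
  by apply/funext => x /=; rewrite atanN.
by apply: cvgN; exact: cvgy_atan.
Qed.

(** Smoothing both measures by a Cauchy kernel of width c makes them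
comparable through their characteristic functions, and the smoothed mass of an
interval is a difference of arctangents. With the right end moved by 1/(n+1),
which is much larger than the width 1/(n+1)^2, the limit is the mass of the
closed half line, whatever the atoms. *)
Lemma cf_unique (b : R) : mu `]-oo, b]%classic = nu `]-oo, b]%classic.
Proof.
have w0 n : 0 < w n by rewrite invr_gt0 exprn_gt0.
pose g n (x : TR) : R :=
  2 * (atan ((be b n - x) / w n) - atan ((- n%:R - x) / w n)).
have g_lim x : g n x @[n --> \oo] --> 2 * pi * \1_`]-oo, b] x.
  have lo : atan ((- n%:R - x) / w n) @[n --> \oo] --> - (pi / 2).
    exact: (cvg_comp _ _ (sep_low x) cvgNy_atan).
  rewrite indicE mem_setE in_itv/=; case: (leP x b) => xb.
    rewrite mulr1 (_ : 2 * pi = 2 * (pi / 2 - - (pi / 2))); last by field.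
    apply: cvgMr; apply: cvgB lo.
    exact: (cvg_comp _ _ (sep_right xb) (@cvgy_atan R)).
  rewrite mulr0 (_ : 0 = 2 * (- (pi / 2) - - (pi / 2))); last by ring.
  apply: cvgMr; apply: cvgB lo.
  exact: (cvg_comp _ _ (sep_left xb) cvgNy_atan).
have g_le n x : `|g n x| <= 2 * pi.
  rewrite /g normrM ger0_norm// ler_pM2l// ler_norml.
  set p := atan _; set q := atan _.
  have p1 : - (pi / 2) < p by exact: atan_gtNpi2.
  have p2 : p < pi / 2 by exact: atan_ltpi2.
  have q1 : - (pi / 2) < q by exact: atan_gtNpi2.
  have q2 : q < pi / 2 by exact: atan_ltpi2.
  by apply/andP; split; lra.
have mg n : measurable_fun setT (g n).
  have ma (a e : R) : measurable_fun setT (fun x : TR => atan ((a - x) / e)).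
    apply: continuous_measurable_fun => x.
    apply: (@continuous_comp _ _ _ (fun x => (a - x) / e)); last exact: continuous_atan.
    by apply: cvgM; [apply: cvgB; [exact: cvg_cst|exact: cvg_id]|exact: cvg_cst].
  by apply: measurable_funM; [exact: measurable_cst|exact: measurable_funB].
have lim (m : {finite_measure set TR -> \bar R}) :
    \int[m]_x g n x @[n --> \oo] --> 2 * pi * fine (m `]-oo, b]%classic).
  rewrite (_ : 2 * pi * _ = \int[m]_x (2 * pi * \1_`]-oo, b] x)).
    exact: (bounded_convergence mg g_le g_lim).
  rewrite RintegralZl//; last first.
    apply: bmf_integrable; split; first exact: measurable_indic.
    by exists 1 => x; rewrite indicE; case: (_ \in _); rewrite ?normr1 ?normr0.
  by rewrite /Rintegral integral_indic// setIT.
have eqn : \forall n \near \oo, \int[mu]_x g n x = \int[nu]_x g n x.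
  near=> n; apply: same_atan; first exact: w0.
  have nb : - b <= n%:R by near: n; exact: nbhs_infty_ger.
  by rewrite /be (@le_lt_trans _ _ b) ?ltrDl ?invr_gt0// lerNl.
suff : fine (mu `]-oo, b]%classic) = fine (nu `]-oo, b]%classic).
  by move=> h; rewrite -[LHS]fineK ?fin_num_measure// h fineK// fin_num_measure.
have pi0 : 2 * pi != 0 :> R by rewrite mulf_neq0// gt_eqF// pi_gt0.
have h : \int[mu]_x g n x @[n --> \oo] --> 2 * pi * fine (nu `]-oo, b]%classic).
  apply: cvg_trans (lim nu); apply: near_eq_cvg.
  by near=> n; symmetry; near: n; exact: eqn.
exact: (mulfI pi0 (cvg_unique _ (lim mu) h)).
Unshelve. all: by end_near. Qed.

End cf_uniqueness.

(** * Distribution functions and convolution *)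

Section finite_measure_of_mass.
Context d {T : measurableType d} {R : realType}.
Variable mu : {measure set T -> \bar R}.
Hypothesis mu_fin : (mu setT < +oo)%E.

Let nu : set T -> \bar R := mu.

HB.instance Definition _ := Measure.copy nu mu.

Let nu_fin : fin_num_fun nu.
Proof.
move=> A mA; rewrite ge0_fin_numE// (le_lt_trans _ mu_fin)//.
by apply: le_measure; rewrite ?inE.
Qed.

HB.instance Definition _ := Measure_isFinite.Build _ _ _ nu nu_fin.

Lemma finite_measure_of_mass :
  exists m : {finite_measure set T -> \bar R}, forall A, m A = mu A.
Proof. by exists nu. Qed.

End finite_measure_of_mass.

Section distribution_functions_of_measures.
Context {R : realType}.
Local Notation LS := lebesgue_stieltjes_measure.

Lemma cintegral_eq_measure d (T : measurableType d)
    (mu nu : {measure set T -> \bar R}) (u : T -> R[i]) :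
  (forall A, measurable A -> mu A = nu A) -> cintegral mu u = cintegral nu u.
Proof.
move=> munu; apply: complex_ext => /=;
  by rewrite /Rintegral; congr fine; apply: eq_measure_integral => A mA _; exact: munu.
Qed.

Lemma dfun_Ny (F : dfun R) r : LS F `]-oo, r]%classic = (F r)%:E.
Proof.
have := cdf_lebesgue_stieltjes_id F r.
by rewrite /cdf /distribution /= /pushforward preimage_id.
Qed.

End distribution_functions_of_measures.

Section dfun_of_measure.
Context {R : realType}.
Local Notation TR := (measurableTypeR R).
Local Notation LS := lebesgue_stieltjes_measure.
Variable mu : {finite_measure set TR -> \bar R}.
Hypothesis mu1 : mu setT = 1%E.

Let P : set TR -> \bar R := mu.

HB.instance Definition _ := Measure.copy P mu.
HB.instance Definition _ := Measure_isProbability.Build _ _ _ P mu1.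

Let idTR : TR -> R := idfun.

HB.instance Definition _ :=
  @isMeasurableFun.Build _ _ _ _ idTR (@measurable_id _ _ setT).

Let f r := fine (cdf (idTR : {RV P >-> R}) r).

Let f_nd : nondecreasing f.
Proof. by move=> *; rewrite fine_le ?fin_num_measure// cdf_nondecreasing. Qed.

Let f_rc : right_continuous f.
Proof.
move=> a; apply: fine_cvg.
by rewrite fineK ?fin_num_measure//; exact: cdf_right_continuous.
Qed.

Let fNy : f @ -oo --> (0:R). Proof. exact/fine_cvg/cvg_cdfNy0. Qed.
Let fy : f @ +oo --> (1:R). Proof. exact/fine_cvg/cvg_cdfy1. Qed.

HB.instance Definition _ := isCumulative.Build R _ R f f_nd f_rc.
HB.instance Definition _ := isCumulativeBounded.Build R 0 1 f fNy fy.

Lemma dfun_of_measure : exists F : dfun R,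
  (forall x, F x = fine (mu `]-oo, x]%classic)) /\
  forall u, cintegral (LS F) u = cintegral mu u.
Proof.
exists f; split => [x|u].
  by rewrite /f /cdf /distribution /pushforward.
apply: cintegral_eq_measure => A mA.
exact: (lebesgue_stieltjes_cdf_id P mA).
Qed.

End dfun_of_measure.

Section convolution.
Context {R : realType}.
Local Notation TR := (measurableTypeR R).
Local Notation LS := lebesgue_stieltjes_measure.

Let plus (z : TR * TR) : TR := z.1 + z.2.

Let mplus : measurable_fun setT plus.
Proof. by apply: measurable_funD; [exact: mfst|exact: msnd]. Qed.

HB.instance Definition _ := @isMeasurableFun.Build _ _ _ _ plus mplus.

Lemma sum_measure (m1 m2 : {finite_measure set TR -> \bar R}) :
  exists nu : {finite_measure set TR -> \bar R},
  forall g, bmf g -> \int[nu]_x g x = \int[m1]_x (\int[m2]_y g (x + y)).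
Proof.
pose M := pushforward (m1 \x m2)%E plus.
have Mfin : (M setT < +oo)%E.
  rewrite /M /pushforward preimage_setT.
  exact: product_measure_fin.
have [nu hnu] := finite_measure_of_mass Mfin.
exists nu => g bg.
have bgp : bmf (fun z : TR * TR => g (plus z)).
  have [mg [N hN]] := bg; split; last by exists N.
  exact: (measurableT_comp mg mplus).
have ip := bmf_integrable_prod m1 m2 bgp.
rewrite /Rintegral (eq_measure_integral M); last by move=> A mA _; exact: hnu.
have mEg : measurable_fun setT (EFin \o g).
  by apply/measurable_EFinP; case: bg.
have ip' : (m1 \x m2)%E.-integrable (plus @^-1` setT) ((EFin \o g) \o plus).
  by rewrite preimage_setT.
rewrite (integral_pushforward mplus mEg ip' measurableT).
rewrite preimage_setT -(integral12_prod_meas1 ip); congr fine.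
apply: eq_integral => x _; rewrite fineK//.
apply: integrable_fin_num => //.
exact: (@bmf_integrable _ _ _ m2 (fun y => g (x + y)) (bmf_section1 x bgp)).
Qed.

(** The convolution is the distribution function of the image of the product
measure under addition, so it is again a distribution function and its
characteristic function is the product. *)
Lemma conv_dfun (F H : dfun R) : exists K : dfun R,
  (K : R -> R) = Defs.conv F H /\ forall t, charfun K t = charfun F t * charfun H t.
Proof.
pose mF : {finite_measure set TR -> \bar R} := LS F.
pose mH : {finite_measure set TR -> \bar R} := LS H.
have p1 (G : dfun R) : LS G setT = 1%E by exact: probability_setT.
have mF1 : mF setT = 1%E := p1 F.
have mH1 : mH setT = 1%E := p1 H.
have [nu hnu] := sum_measure mF mH.
have bI (b : R) : bmf (\1_`]-oo, b] : TR -> R).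
  split; first exact: measurable_indic.
  by exists 1 => x; rewrite indicE; case: (_ \in _); rewrite ?normr1 ?normr0.
have intI (m : {finite_measure set TR -> \bar R}) b :
    \int[m]_x \1_`]-oo, b] x = fine (m `]-oo, b]%classic).
  by rewrite /Rintegral integral_indic// setIT.
have nu1 : nu setT = 1%E.
  have := hnu _ (bmf_cst 1).
  rewrite !Rintegral_cst// !mul1r mF1 mH1 mulr1 => h.
  by rewrite -[LHS]fineK ?fin_num_measure// h.
have [K [KE Kint]] := dfun_of_measure nu1.
exists K; split.
  apply/funext => b; rewrite KE -intI hnu// /Defs.conv.
  have bz : bmf (fun z : TR * TR => \1_`]-oo, b] (z.1 + z.2) : R).
    have [mg [N hN]] := bI b; split; last by exists N.
    exact: (measurableT_comp mg mplus).
  rewrite (bmf_Fubini mF mH bz); apply: eq_Rintegral => y _ /=.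
  have -> : F (b - y) = fine (mF `]-oo, b - y]%classic).
    exact/esym/(congr1 fine (dfun_Ny F (b - y))).
  rewrite -intI.
  apply: eq_Rintegral => x _; rewrite !indicE; congr (_%:R); congr nat_of_bool.
  by rewrite !mem_setE !in_itv/= lerBrDr.
move=> t; have bc := bmc_character t.
pose A := cintegral mH (fun x => cis (t * x)).
have -> : charfun F t * charfun H t = cintegral mF (fun x => cis (t * x)) * A.
  by [].
have -> : charfun K t = cintegral mF (fun x =>
    cintegral mH (fun y => cis (t * (x + y)))).
  rewrite /charfun Kint.
  by apply: complex_ext; [exact: (hnu _ bc.1)|exact: (hnu _ bc.2)].
rewrite [RHS]mulrC -(cintegralZ _ A bc); congr cintegral; apply/funext => x.
rewrite [RHS]mulrC -(cintegralZ _ _ bc); congr cintegral; apply/funext => y.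
by rewrite mulrDr cisD.
Qed.

Lemma charfun_inj (F G : dfun R) :
  (forall t, charfun F t = charfun G t) -> (F : R -> R) = G.
Proof.
move=> FG; apply/funext => b; apply/EFin_inj; rewrite -!dfun_Ny.
exact: (@cf_unique _ (LS F) (LS G)).
Qed.

Lemma conv_pow_dfun (n : nat) (F : dfun R) : exists K : dfun R,
  (K : R -> R) = conv_pow n.+1 F /\ forall t, charfun K t = charfun F t ^+ n.+1.
Proof.
elim: n => [|n [K [KE Kc]]]; first by exists F; split => // t; rewrite expr1.
have [L [LE Lc]] := conv_dfun K F.
exists L; split; first by rewrite LE KE.
by move=> t; rewrite Lc Kc [RHS]exprSr.
Qed.

(** By uniqueness of characteristic functions, convolution roots can be looked
for among the roots of the characteristic function. *)
Lemma charfun_root_infinitely_divisible (F : dfun R) :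
  (forall n, exists Fn : dfun R, forall t, charfun F t = charfun Fn t ^+ n.+1) ->
  infinitely_divisible F.
Proof.
move=> h [//|n] _; have [Fn hn] := h n; exists Fn.
have [K [<- Kc]] := conv_pow_dfun n Fn.
by apply: charfun_inj => t; rewrite Kc hn.
Qed.

End convolution.

(** * The kernel of the representation *)

Section kernels.
Context {R : realType}.
Local Notation TR := (measurableTypeR R).
Implicit Types (t h x : R).

Lemma measurable_punctured (g : R -> R) :
  (forall x, x != 0 -> {for x, continuous g}) -> measurable_fun setT (g : TR -> R).
Proof.
move=> cg.
have -> : [set: R] = [set x : R | x != 0] `|` [set 0].
  by apply/seteqP; split => x //= _; have [->|] := eqVneq x 0; [right|left].
apply/measurable_funU => //; first by apply: open_measurable; exact: open_neq.
split; last exact: measurable_fun_set1.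
apply: open_continuous_measurable_fun.
  exact: open_neq.
by move=> x; rewrite inE /= => x0; exact: cg.
Qed.

Lemma measurable_if0 (g : R -> R) (a : R) :
  (forall x, x != 0 -> {for x, continuous g}) ->
  measurable_fun setT (fun x : TR => if x == 0 then a else g x).
Proof.
move=> cg; apply: measurable_fun_ifT => //; last exact: measurable_punctured.
by apply: measurable_fun_eqr; [exact: measurable_id|exact: measurable_cst].
Qed.

Definition levy_weight (x : R) : R := (1 + x ^+ 2) / x ^+ 2.

Lemma levy_weight_ge0 x : 0 <= levy_weight x.
Proof. by rewrite divr_ge0 ?sqr_ge0// addr_ge0// sqr_ge0. Qed.

Lemma levy_weightE x : x != 0 -> levy_weight x = 1 + (x ^+ 2)^-1.
Proof. by move=> x0; rewrite /levy_weight mulrDl mul1r mulfV ?expf_neq0// addrC. Qed.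

Lemma levy_weight_continuous x : x != 0 -> {for x, continuous levy_weight}.
Proof.
move=> x0; apply: cvgM.
  by apply: cvgD; [exact: cvg_cst|exact: exprn_continuous].
by apply: cvgV; [rewrite expf_neq0|exact: exprn_continuous].
Qed.

(** The weight is 1 + 1/x^2: a bounded function that is O(x^2) at the origin
stays bounded after multiplication by it. *)
Lemma levy_weight_le (u b q x : R) : x != 0 -> `|u| <= b -> `|u| <= q * x ^+ 2 ->
  `|u * levy_weight x| <= b + q.
Proof.
move=> x0 ub uq; rewrite normrM (ger0_norm (levy_weight_ge0 _)) levy_weightE//.
rewrite mulrDr mulr1 lerD// ler_pdivrMr//.
by rewrite lt_neqAle eq_sym expf_neq0//= sqr_ge0.
Qed.

Lemma Re_ker_LK t x : Re (ker_LK t x) =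
  if x == 0 then - (t ^+ 2 / 2) else (cos (t * x) - 1) * levy_weight x.
Proof.
rewrite /ker_LK; case: ifPn => // x0.
rewrite ReM /= mulr0 subr0; congr (_ * _).
by rewrite !ReImE /=; ring.
Qed.

Lemma Im_ker_LK t x : Im (ker_LK t x) =
  if x == 0 then 0 else (sin (t * x) - t * sin x) * levy_weight x.
Proof.
rewrite /ker_LK; case: ifPn => // x0.
rewrite ImM /= mulr0 add0r; congr (_ * _).
by rewrite !ReImE Re_real; ring.
Qed.

Lemma ker_LK_le t x : normc (ker_LK t x) <= 2 * t ^+ 2 + 2 * `|t| + 3.
Proof.
have t0 := sqr_ge0 t; have t1 := normr_ge0 t.
rewrite (le_trans (normc_le_ReIm _))//.
have h1 : `|Re (ker_LK t x)| <= 2 + t ^+ 2.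
  rewrite Re_ker_LK; case: ifPn => [_|x0].
    by rewrite normrN ger0_norm; lra.
  apply: levy_weight_le => //; first exact: norm_cosB1_le2.
  by rewrite -exprMn; exact: norm_cosB1_le.
have h2 : `|Im (ker_LK t x)| <= (1 + `|t|) + (t ^+ 2 + `|t|).
  rewrite Im_ker_LK; case: ifPn => [_|x0]; first by rewrite normr0; lra.
  apply: levy_weight_le => //.
    rewrite (le_trans (ler_normB _ _))// lerD ?sin_max// normrM.
    by rewrite ler_piMr// sin_max.
  have -> : sin (t * x) - t * sin x = (sin (t * x) - t * x) - t * (sin x - x) by ring.
  rewrite (le_trans (ler_normB _ _))// mulrDl lerD//.
    by rewrite -exprMn; exact: norm_sinB_le2.
  by rewrite normrM ler_wpM2l// norm_sinB_le2.
by lra.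
Qed.

Lemma bmc_ker_LK t : bmc (ker_LK t : TR -> R[i]).
Proof.
have ccos x : {for x, continuous (fun x => cos (t * x))}.
  by apply: continuous_comp; [exact: mulrl_continuous|exact: continuous_cos].
have csin x : {for x, continuous (fun x => sin (t * x))}.
  by apply: continuous_comp; [exact: mulrl_continuous|exact: continuous_sin].
apply: bmc_intro (ker_LK_le t).
  under eq_fun do rewrite Re_ker_LK.
  apply: measurable_if0 => x x0; apply: cvgM; last exact: levy_weight_continuous.
  by apply: cvgB; [exact: ccos|exact: cvg_cst].
under eq_fun do rewrite Im_ker_LK.
apply: measurable_if0 => x x0; apply: cvgM; last exact: levy_weight_continuous.
apply: cvgB; first exact: csin.
by apply: cvgM; [exact: cvg_cst|exact: continuous_sin].
Qed.

Lemma ccvg_ker_LK (tn : nat -> R) t x :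
  tn n @[n --> \oo] --> t -> ccvg (fun n => ker_LK (tn n) x) (ker_LK t x).
Proof.
move=> tt; have tx : tn n * x @[n --> \oo] --> t * x by exact: cvgMl.
split.
  rewrite Re_ker_LK; under eq_fun do rewrite Re_ker_LK; case: ifPn => x0.
    apply: cvgN; apply: cvgMl.
    apply: (@continuous_cvg _ _ _ _ _ _ (fun y : R => y ^+ 2)) => //.
    exact: exprn_continuous.
  apply: cvgMl; apply: cvgB; last exact: cvg_cst.
  by apply: continuous_cvg => //; exact: continuous_cos.
rewrite Im_ker_LK; under eq_fun do rewrite Im_ker_LK; case: ifPn => x0.
  exact: cvg_cst.
apply: cvgMl; apply: cvgB; last exact: cvgMl.
by apply: continuous_cvg => //; exact: continuous_sin.
Qed.

Lemma ker_LK0 x : ker_LK 0 x = 0.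
Proof.
apply: complex_ext; rewrite ?Re_ker_LK ?Im_ker_LK !mul0r ?cos0 ?sin0.
  by case: ifPn => _; rewrite ?subrr ?mul0r ?oppr0//; rewrite expr0n mul0r oppr0.
by case: ifPn; rewrite ?subrr ?mul0r.
Qed.

Lemma Re_ker_LK_le0 t x : Re (ker_LK t x) <= 0.
Proof.
rewrite Re_ker_LK; case: ifPn => _.
  by rewrite oppr_le0 divr_ge0 ?sqr_ge0.
by rewrite mulr_le0_ge0 ?levy_weight_ge0// subr_le0 cos_le1.
Qed.

Let squeeze0 (u e : nat -> R) (l : R) : (forall n, `|u n - l| <= e n) ->
  e n @[n --> \oo] --> (0 : R) -> u n @[n --> \oo] --> l.
Proof.
move=> ue e0; apply/cvgrPdist_le => eps eps0; near=> n.
rewrite distrC (le_trans (ue n))// (le_trans (ler_norm _))//.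
by near: n; move/cvgr0_norm_le : e0; apply.
Unshelve. all: by end_near. Qed.

(** The value given to the kernel at the origin is its limit there, so a mass of
the measure at 0 can be moved to 1/n without changing the integral in the
limit. *)
Lemma ker_LK_cvg0 t : ccvg (fun n => ker_LK t n.+1%:R^-1) (ker_LK t 0).
Proof.
pose y n : R := n.+1%:R^-1.
have y0 n : 0 < y n by rewrite invr_gt0.
have yn0 n : y n != 0 by rewrite gt_eqF.
have y1 n : y n <= 1 by rewrite invf_le1// ler1n.
have cy : y n @[n --> \oo] --> (0 : R) by exact: cvg_harmonic.
have cy2 : y n ^+ 2 @[n --> \oo] --> (0 : R).
  rewrite -[X in _ --> X](mulr0 0); under eq_fun do rewrite expr2.
  exact: cvgM.
have cw : 1 + y n ^+ 2 @[n --> \oo] --> (1 : R).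
  by rewrite -[X in _ --> X]addr0; apply: cvgD => //; exact: cvg_cst.
split.
  have hs : sin (t / 2 * y n) / y n @[n --> \oo] --> t / 2.
    apply: (squeeze0 (e := fun n => `|t / 2| ^+ 3 * y n ^+ 2)); last first.
      by rewrite -[X in _ --> X](mulr0 (`|t / 2| ^+ 3)); exact: cvgMr.
    move=> n; have -> : sin (t / 2 * y n) / y n - t / 2 =
        (sin (t / 2 * y n) - t / 2 * y n) / y n by field.
    rewrite normrM normfV (gtr0_norm (y0 n)) ler_pdivrMr//.
    rewrite (le_trans (norm_sinB_le3 _))// normrM (gtr0_norm (y0 n)).
    by rewrite exprMn -[leRHS]mulrA -[y n ^+ 2 * y n]exprSr.
  have -> : (fun n => Re (ker_LK t n.+1%:R^-1)) =
      (fun n => - (2 * (sin (t / 2 * y n) / y n * (sin (t / 2 * y n) / y n))) *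
        (1 + y n ^+ 2)).
    apply/funext => n; rewrite Re_ker_LK -/(y n) (negbTE (yn0 n)) /levy_weight.
    have -> : cos (t * y n) - 1 = - (2 * sin (t / 2 * y n) ^+ 2).
      have -> : t * y n = (t / 2 * y n) *+ 2 by rewrite mulr2n; field.
      by rewrite cos_mulr2n sin2cos2 mulr2n; ring.
    by field.
  rewrite Re_ker_LK eqxx -[X in _ --> X]mulr1; apply: cvgM => //.
  rewrite (_ : t ^+ 2 / 2 = 2 * (t / 2 * (t / 2))); last by field.
  by apply: cvgN; apply: cvgMr; exact: cvgM.
rewrite Im_ker_LK eqxx.
apply: (squeeze0 (e := fun n => 2 * (`|t| ^+ 3 + `|t|) * y n)); last first.
  by rewrite -[X in _ --> X](mulr0 (2 * (`|t| ^+ 3 + `|t|))); exact: cvgMr.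
move=> n; rewrite subr0 Im_ker_LK -/(y n) (negbTE (yn0 n)) normrM.
have h : `|sin (t * y n) - t * sin (y n)| <= (`|t| ^+ 3 + `|t|) * y n ^+ 3.
  have -> : sin (t * y n) - t * sin (y n) =
    (sin (t * y n) - t * y n) - t * (sin (y n) - y n) by ring.
  rewrite (le_trans (ler_normB _ _))// mulrDl lerD//.
    by rewrite (le_trans (norm_sinB_le3 _))// normrM (gtr0_norm (y0 n)) exprMn.
  rewrite normrM ler_wpM2l// (le_trans (norm_sinB_le3 _))//.
  by rewrite (gtr0_norm (y0 n)).
rewrite (ger0_norm (levy_weight_ge0 _)).
have -> : 2 * (`|t| ^+ 3 + `|t|) * y n =
    (`|t| ^+ 3 + `|t|) * y n ^+ 3 * (2 / y n ^+ 2) by field.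
apply: ler_pM => //; first exact: levy_weight_ge0.
rewrite /levy_weight ler_wpM2r ?invr_ge0 ?sqr_ge0//.
by have := expr_le1 (n := 2) isT (ltW (y0 n)); rewrite y1; lra.
Qed.

End kernels.

(** * Exponentials of Levy-Khinchine exponents *)

Section exponential_limit.
Context {R : realType}.
Implicit Types (a b m : R[i]).

Lemma ccvg_squeeze_near (u : nat -> R[i]) (l : R[i]) (e : nat -> R) :
  (\forall n \near \oo, normc (u n - l) <= e n) ->
  e n @[n --> \oo] --> (0 : R) -> ccvg u l.
Proof.
move=> ue e0; split; apply/cvgrPdist_le => eps eps0; near=> n.
  rewrite distrC -ReN -ReD (le_trans (Re_le_normc _))//.
  rewrite (@le_trans _ _ (e n))//; first by near: n.
  rewrite (le_trans (ler_norm _))//.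
  by near: n; move/cvgr0_norm_le : e0; apply.
rewrite distrC -ImN -ImD (le_trans (Im_le_normc _))//.
rewrite (@le_trans _ _ (e n))//; first by near: n.
rewrite (le_trans (ler_norm _))//.
by near: n; move/cvgr0_norm_le : e0; apply.
Unshelve. all: by end_near. Qed.

Lemma normc_subX a b (r : R) n : 1 <= r -> normc a <= r -> normc b <= r ->
  normc (a ^+ n - b ^+ n) <= n%:R * normc (a - b) * r ^+ n.
Proof.
move=> r1 ar br; have r0 : 0 <= r by lra.
elim: n => [|n IH]; first by rewrite !expr0 subrr Normc.normc0 mul0r mul0r.
have -> : a ^+ n.+1 - b ^+ n.+1 = a * (a ^+ n - b ^+ n) + (a - b) * b ^+ n.
  by rewrite !exprS; ring.
rewrite (le_trans (normcD _ _))// !normcM normcX.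
rewrite -natr1 !mulrDl mul1r lerD//.
  rewrite exprS mulrCA ler_pM ?normc_ge0//.
rewrite ler_wpM2l ?normc_ge0// exprS.
rewrite (@le_trans _ _ (r ^+ n))//; first by rewrite lerXn2r// nnegrE normc_ge0.
by rewrite ler_peMl// exprn_ge0.
Qed.

Let step m (n : nat) : R[i] := 1 + m * (n.+1%:R^-1)%:C.

Let normc_div m n : normc (m * (n.+1%:R^-1)%:C) = normc m / n.+1%:R.
Proof. by rewrite normcM normc_real ger0_norm. Qed.

Let step_le m n : normc (step m n) <= expR (normc m / n.+1%:R).
Proof.
rewrite (le_trans (normcD _ _))// Normc.normc1 normc_div.
exact: expR_ge1Dx.
Qed.

Lemma normc_stepX m n :
  normc ((1 + m * (n.+1%:R^-1)%:C) ^+ n.+1) <= expR (normc m).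
Proof.
rewrite normcX (le_trans (lerXn2r n.+1 _ _ (step_le m n)))//.
- by rewrite nnegrE normc_ge0.
- by rewrite nnegrE expR_ge0.
- by rewrite -expRM_natl mulrC divfK ?pnatr_eq0.
Qed.

(** The exponential is reached through powers because those are sums of products
with nonnegative coefficients, which preserve positivity of transforms. *)
Lemma ccvg_stepX m :
  ccvg (fun n => (1 + m * (n.+1%:R^-1)%:C) ^+ n.+1) (cexp m).
Proof.
apply: (ccvg_squeeze_near
  (e := fun n => 4 * normc m ^+ 2 * expR (normc m) * n.+1%:R^-1)); last first.
  rewrite -[X in _ --> X](mulr0 (4 * normc m ^+ 2 * expR (normc m))).
  by apply: cvgMr; exact: cvg_harmonic.
near=> n.
set w := m * (n.+1%:R^-1)%:C.
have N0 : n.+1%:R != 0 :> R by rewrite pnatr_eq0.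
have wm : w *+ n.+1 = m.
  rewrite /w -mulr_natr -mulrA -(rmorph_nat (real_complex R)) -rmorphM/=.
  by rewrite mulVf// mulr1.
have w2 : normc w <= 1 / 2.
  rewrite normc_div ler_pdivrMr ?ltr0n//.
  have : 2 * normc m <= n.+1%:R.
    rewrite (@le_trans _ _ n%:R) ?ler_nat//.
    by near: n; exact: nbhs_infty_ger.
  by lra.
have -> : cexp m = cexp w ^+ n.+1 by rewrite -cexpMn wm.
rewrite -normcN opprB.
set r := expR (normc m / n.+1%:R).
have r1 : 1 <= r.
  by rewrite -[leLHS]expR0 ler_expR divr_ge0// normc_ge0.
have wr : normc (cexp w) <= r.
  rewrite normc_cexp ler_expR -normc_div.
  exact: (le_trans (ler_norm _) (Re_le_normc _)).
apply: (le_trans (normc_subX n.+1 r1 wr (step_le m n))).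
rewrite -expRM_natl [n.+1%:R * (_ / _)]mulrCA mulfV// mulr1.
have -> : cexp w - step m n = cexp w - 1 - w by rewrite /step -/w; ring.
have hw := normc_cexpB_le w2; rewrite normc_div in hw.
rewrite [leRHS]mulrAC ler_wpM2r ?expR_ge0//.
apply: (le_trans (ler_wpM2l _ hw)) => //.
have -> : n.+1%:R * (4 * (normc m / n.+1%:R) ^+ 2) =
  4 * normc m ^+ 2 / n.+1%:R by field.
exact: lexx.
Unshelve. all: by end_near. Qed.

End exponential_limit.

Section positive_class.
Context {R : realType}.
Local Notation TR := (measurableTypeR R).
Variable lap : {finite_measure set TR -> \bar R}.

Lemma ge0_complex (z : R[i]) : (0 <= z) = (Im z == 0) && (0 <= Re z).
Proof. by rewrite lecE. Qed.

Lemma ge0_ccvg (u : nat -> R[i]) (l : R[i]) :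
  (forall n, 0 <= u n) -> ccvg u l -> 0 <= l.
Proof.
move=> u0 [rl il]; rewrite ge0_complex; apply/andP; split.
  have h : Im (u n) @[n --> \oo] --> (0 : R).
    have -> : (fun n => Im (u n)) = (fun=> 0).
      by apply/funext => n; have := u0 n; rewrite ge0_complex => /andP[/eqP].
    exact: cvg_cst.
  by apply/eqP; exact: (cvg_unique _ il h).
have h : (fun n => - Re (u n)) @ \oo --> - Re l by exact: cvgN.
rewrite -oppr_le0; apply: (cvgr_to_le h); apply: nearW => n.
by have := u0 n; rewrite ge0_complex oppr_le0 => /andP[].
Qed.

Lemma ge0_cintegral d (T : measurableType d) (mu : {measure set T -> \bar R})
  (u : T -> R[i]) : (forall x, 0 <= u x) -> 0 <= cintegral mu u.
Proof.
move=> u0; have u0' x := andP (etrans (esym (ge0_complex (u x))) (u0 x)).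
rewrite ge0_complex /=; apply/andP; split.
  rewrite (@eq_Rintegral _ _ _ _ _ (cst 0)); last first.
    by move=> x _; have [/eqP ->] := u0' x.
  by rewrite Rintegral_cst// mul0r.
by apply: Rintegral_ge0 => x _; have [] := u0' x.
Qed.

Local Notation pos := (pos_transform lap).

Lemma pos_limit (psin : nat -> TR -> R[i]) (psi : TR -> R[i]) M :
  (forall n, bmc (psin n)) -> (forall n t, normc (psin n t) <= M) ->
  (forall t, ccvg (fun n => psin n t) (psi t)) -> (forall n, pos (psin n)) ->
  pos psi.
Proof.
move=> bpsi psiM cpsi ppsi x; apply: (ge0_ccvg (fun n => ppsi n x)).
apply: (@cbounded_convergence _ _ _ _ _ _ M).
- by move=> n; apply: bmcM => //; exact: bmc_characterN.
- by move=> n t; rewrite normcM normc_cis mulr1.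
- by move=> t; apply: ccvgM => //; exact: ccvg_cst.
Qed.

Lemma pos_scale (r : R) psi : bmc (psi : TR -> R[i]) -> 0 <= r -> pos psi ->
  pos (fun t => r%:C * psi t).
Proof.
move=> bpsi r0 ppsi x.
have -> : (fun t => r%:C * psi t * cis (- (x * t))) =
  (fun t => r%:C * (psi t * cis (- (x * t)))).
  by apply/funext => t; rewrite mulrA.
rewrite cintegralZ; last by apply: bmcM => //; exact: bmc_characterN.
by rewrite mulr_ge0// ler0c.
Qed.

(** Multiplication by a character translates the transform. *)
Lemma pos_translate (b : R) psi : pos psi -> pos (fun t => cis (t * b) * psi t).
Proof.
move=> ppsi x; have := ppsi (x - b); congr (0 <= _); congr cintegral.
apply/funext => t.
by rewrite (_ : - ((x - b) * t) = t * b + - (x * t)) ?cisD; ring.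
Qed.

(** Multiplication by the transform of a nonnegative measure averages
translates. *)
Lemma pos_mixture d (T : measurableType d) (mu : {finite_measure set T -> \bar R})
    (w s : T -> R) (psi : TR -> R[i]) :
  bmc psi -> pos psi -> bmf w -> (forall y, 0 <= w y) -> measurable_fun setT s ->
  pos (fun t => psi t * cintegral mu (fun y => (w y)%:C * cis (t * s y))).
Proof.
move=> bpsi ppsi bw w0 ms x.
have bwr : bmc (fun y => (w y)%:C) by exact: bmc_real.
have bsec t : bmc (fun y => (w y)%:C * cis (t * s y)).
  by apply: bmcM => //; apply: bmc_cis; apply: measurable_funM.
have -> : (fun t => psi t * cintegral mu (fun y => (w y)%:C * cis (t * s y)) *
    cis (- (x * t))) =
  (fun t => cintegral mu (fun y =>
    psi t * cis (- (x * t)) * ((w y)%:C * cis (t * s y)))).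
  by apply/funext => t; rewrite cintegralZ// mulrAC.
have bz : bmc (fun z : TR * T =>
    psi z.1 * cis (- (x * z.1)) * ((w z.2)%:C * cis (z.1 * s z.2))).
  apply: bmcM; apply: bmcM.
  - exact: (bmc_fst bpsi).
  - exact: (bmc_fst (bmc_characterN x)).
  - exact: (bmc_snd bwr).
  - apply: bmc_cis; apply: measurable_funM; first exact: measurable_fst.
    exact: (measurableT_comp ms measurable_snd).
rewrite (bmc_Fubini lap mu bz); apply: ge0_cintegral => y /=.
have -> : (fun t => psi t * cis (- (x * t)) * ((w y)%:C * cis (t * s y))) =
  (fun t => (w y)%:C * (cis (t * s y) * psi t * cis (- (x * t)))).
  by apply/funext => t; ring.
have btr : bmc (fun t : TR => cis (t * s y) * psi t).
  by apply: bmcM => //; under eq_fun do rewrite mulrC; exact: bmc_character.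
rewrite cintegralZ; last by apply: bmcM => //; exact: bmc_characterN.
by rewrite mulr_ge0 ?ler0c//; exact: pos_translate.
Qed.

Lemma posD (psi1 psi2 : TR -> R[i]) : bmc psi1 -> bmc psi2 ->
  pos psi1 -> pos psi2 -> pos (fun t => psi1 t + psi2 t).
Proof.
move=> b1 b2 p1 p2 x.
have -> : (fun t => (psi1 t + psi2 t) * cis (- (x * t))) =
  (fun t => psi1 t * cis (- (x * t)) + psi2 t * cis (- (x * t))).
  by apply/funext => t; rewrite mulrDl.
rewrite cintegralD ?addr_ge0//; apply: bmcM => //; exact: bmc_characterN.
Qed.

Lemma pos1 c : 0 < c -> is_laplace c lap -> pos (fun=> 1).
Proof.
move=> c0 [_ h] x; have -> : (fun t => 1 * cis (- (x * t))) =
  (fun t => cis (- x * t)) by apply/funext => t; rewrite mul1r mulNr.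
rewrite h ler0c divr_ge0 ?addr_ge0 ?sqr_ge0//.
by rewrite mulr_ge0// ltW.
Qed.

End positive_class.

Section compound_poisson.
Context {R : realType}.
Local Notation TR := (measurableTypeR R).
Variables (lap mu : {finite_measure set TR -> \bar R}) (w s : TR -> R).
Hypotheses (bw : bmf w) (w0 : forall y, 0 <= w y) (ms : measurable_fun setT s).

(** The transform of the image under s of the measure with density w. *)
Definition mixture (t : R) : R[i] :=
  cintegral mu (fun y => (w y)%:C * cis (t * s y)).

Lemma bmc_mixture : bmc (mixture : TR -> R[i]).
Proof.
have bz : bmc (fun z : TR * TR => (w z.2)%:C * cis (z.1 * s z.2)).
  apply: bmcM; first exact: (bmc_snd (bmc_real bw)).
  apply: bmc_cis_prod; first exact: mfst.
  exact: (measurableT_comp ms measurable_snd).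
exact: (bmc_int2 mu mu bz).
Qed.

(** The characteristic function of a compound Poisson law, up to its
normalization. *)
Lemma exp_mixture_pos (c : R) : 0 < c -> is_laplace c lap ->
  pos_transform lap (fun t => cexp (mixture t)).
Proof.
move=> c0 lapc.
have bm := bmc_mixture.
have [M hM] := bmc_bounded bm.
pose stepf n t := 1 + mixture t * (n.+1%:R^-1)%:C.
have bstep n : bmc (stepf n : TR -> R[i]).
  by apply: bmcD; [exact: bmc_cst|apply: bmcM => //; exact: bmc_cst].
have bpow n k : bmc (fun t : TR => stepf n t ^+ k).
  elim: k => [|k IH]; first by under eq_fun do rewrite expr0; exact: bmc_cst.
  by under eq_fun do rewrite exprS; exact: bmcM.
have ppow n k : pos_transform lap (fun t => stepf n t ^+ k).
  elim: k => [|k IH].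
    by under eq_fun do rewrite expr0; exact: (pos1 c0 lapc).
  have -> : (fun t => stepf n t ^+ k.+1) = (fun t => stepf n t ^+ k +
      (n.+1%:R^-1)%:C * (stepf n t ^+ k * mixture t)).
    by apply/funext => t; rewrite exprS {1}/stepf; ring.
  have bk : bmc (fun t : TR => stepf n t ^+ k * mixture t) by exact: bmcM.
  apply: posD => //; first by apply: bmcM => //; exact: bmc_cst.
  apply: pos_scale => //; exact: pos_mixture.
apply: (pos_limit (psin := fun n t => stepf n t ^+ n.+1) (M := expR M)) => //.
- move=> n t; rewrite (le_trans (normc_stepX _ _))// ler_expR; exact: hM.
- by move=> t; exact: ccvg_stepX.
Qed.

End compound_poisson.

Lemma cisE (R : realType) (t : R) : cis t = cexp ('i * t%:C).
Proof. by []. Qed.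

Lemma Re_i_real (R : realType) (t : R) : Re ('i * t%:C) = 0.
Proof. by rewrite ReM Re_i Im_i Re_real Im_real; ring. Qed.

Lemma Re_real_mul (R : realType) (a : R) (z : R[i]) : Re (a%:C * z) = a * Re z.
Proof. by rewrite ReM Re_real Im_real mul0r subr0. Qed.

Section levy_khinchine.
Context {R : realType}.
Local Notation TR := (measurableTypeR R).
Variable mu : {finite_measure set TR -> \bar R}.

Lemma ccvg_int_ker_LK (tn : nat -> R) (t : R) : tn n @[n --> \oo] --> t ->
  ccvg (fun n => cintegral mu (ker_LK (tn n))) (cintegral mu (ker_LK t)).
Proof.
move=> tt; have [A hA] : exists A, forall n, `|tn n| <= A.
  have [A [_ h]] := cvg_seq_bounded (cvgP _ tt).
  by exists (A + 1) => n; apply: (h (A + 1)) => //; rewrite ltrDl.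
have A0 : 0 <= A by apply: le_trans (hA 0%N).
apply: (@cbounded_convergence _ _ _ _ _ _ (2 * A ^+ 2 + 2 * A + 3)).
- by move=> n; exact: bmc_ker_LK.
- move=> n x; rewrite (le_trans (ker_LK_le _ _))//.
  rewrite lerD2r lerD// ler_wpM2l//.
  by rewrite -(real_normK (num_real (tn n))) lerXn2r// nnegrE.
- by move=> x; exact: ccvg_ker_LK.
Qed.

Lemma Re_int_le0 (u : TR -> R[i]) : bmc u -> (forall x, Re (u x) <= 0) ->
  Re (cintegral mu u) <= 0.
Proof.
move=> [ru _] u0 /=; apply: (@le_trans _ _ (\int[mu]_x (0 : R))).
  apply: le_Rintegral => //; first exact: (@bmf_integrable _ _ _ mu _ ru).
  exact: (@bmf_integrable _ _ _ mu _ (bmf_cst 0)).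
by rewrite Rintegral_cst// mul0r.
Qed.

Let y (n : nat) : R := n.+1%:R^-1.
(** Points closer to 0 than y n are moved to y n, where the weight is
bounded. *)
Let s (n : nat) (x : TR) : TR := if `|x| < y n then y n else x.

Let y0 n : 0 < y n. Proof. by rewrite invr_gt0. Qed.

Let s_le n x : y n <= `|s n x|.
Proof. by rewrite /s; case: ltP => // _; exact: ler_norm. Qed.

Let s_neq0 n x : s n x != 0.
Proof. by rewrite -normr_gt0 (lt_le_trans (y0 n)). Qed.

Let ms n : measurable_fun setT (s n).
Proof.
apply: measurable_fun_ifT; first by apply: measurable_fun_ltr;
  [exact: normr_measurable|exact: measurable_cst].
  exact: measurable_cst.
exact: measurable_id.
Qed.

(** With s n x in place of x, the exponent is that of a compound Poisson law
with a drift, whose exponential has a nonnegative transform; this survives the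
limit in n, and inversion produces the distribution function. *)
Lemma levy_khinchine_dfun (g a c : R) : 0 <= a -> 0 < c ->
  exists F : dfun R, forall t, charfun F t =
    cexp ('i * (t * g)%:C + a%:C * cintegral mu (ker_LK t) - (c * `|t|)%:C).
Proof.
move=> a0 c0.
pose psi t := cexp ('i * (t * g)%:C + a%:C * cintegral mu (ker_LK t)).
pose w n (x : TR) := a * levy_weight (s n x).
have w0 n x : 0 <= w n x by rewrite mulr_ge0// levy_weight_ge0.
have bw n : bmf (w n).
  split.
    apply: measurable_funM; first exact: measurable_cst.
    exact: (measurableT_comp (measurable_punctured (@levy_weight_continuous R)) (ms n)).
  exists (a * (1 + (y n ^+ 2)^-1)) => x.
  rewrite (ger0_norm (w0 n x)) ler_wpM2l// levy_weightE// lerD2l.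
  have y2 : 0 < y n ^+ 2 by rewrite exprn_gt0.
  have ys : y n ^+ 2 <= s n x ^+ 2.
    by rewrite -(real_normK (num_real (s n x))) lerXn2r ?s_le// nnegrE// ltW.
  by rewrite lef_pV2 ?posrE// (lt_le_trans y2).
have bws n : bmf (fun x => w n x * sin (s n x)).
  apply: bmfM => //; split; last by exists 1 => x; exact: sin_max.
  exact: (measurableT_comp (continuous_measurable_fun (@continuous_sin R)) (ms n)).
pose L n := \int[mu]_x w n x.
pose b n := \int[mu]_x (w n x * sin (s n x)).
pose psin n t := cexp ('i * (t * g)%:C +
  a%:C * cintegral mu (fun x => ker_LK t (s n x))).
have bker n t : bmc (fun x : TR => ker_LK t (s n x)).
  have [[mr [M hM]] [mi [N hN]]] := bmc_ker_LK t; split; split.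
  - exact: (measurableT_comp mr (ms n)).
  - by exists M => x; exact: hM.
  - exact: (measurableT_comp mi (ms n)).
  - by exists N => x; exact: hN.
have psinE n t : psin n t =
    (expR (- L n))%:C * (cis (t * (g - b n)) * cexp (mixture mu (w n) (s n) t)).
  have bcis : bmc (fun x => (w n x)%:C * cis (t * s n x)).
    apply: bmcM; first exact: bmc_real.
    by apply: bmc_cis; apply: measurable_funM; [exact: measurable_cst|exact: ms].
  rewrite /psin -(cintegralZ _ _ (bker n t)).
  have -> : (fun x => a%:C * ker_LK t (s n x)) = (fun x =>
      (w n x)%:C * cis (t * s n x) - (w n x)%:C -
      ('i * t%:C) * (w n x * sin (s n x))%:C).
    apply/funext => x; rewrite /ker_LK (negbTE (s_neq0 n x)) -/(levy_weight _).
    by rewrite /w !rmorphM/=; ring.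
  rewrite cintegralB; last 2 first.
  - by apply: bmcB => //; exact: bmc_real.
  - by apply: bmcM; [exact: bmc_cst|exact: bmc_real].
  rewrite cintegralB//; last exact: bmc_real.
  rewrite cintegralZ; last exact: bmc_real.
  rewrite !cintegral_real -/(L n) -/(b n) -/(mixture mu (w n) (s n) t).
  rewrite -cexp_real cisE -!cexpD; congr cexp.
  by rewrite !rmorphM/= rmorphB rmorphN/=; ring.
have psi_le (u : TR -> R[i]) t : bmc u -> (forall x, Re (u x) <= 0) ->
    normc (cexp ('i * (t * g)%:C + a%:C * cintegral mu u)) <= 1.
  move=> bu u0; rewrite normc_cexp expR_le1 ReD Re_i_real Re_real_mul add0r.
  by rewrite mulr_ge0_le0// Re_int_le0.
have psin_le n t : normc (psin n t) <= 1.
  by apply: psi_le => // x; exact: Re_ker_LK_le0.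
have cpsin t : ccvg (fun n => psin n t) (psi t).
  apply: ccvg_cexp; apply: ccvgD; first exact: ccvg_cst.
  apply: ccvgM; first exact: ccvg_cst.
  apply: (@cbounded_convergence _ _ _ _ _ _ (2 * t ^+ 2 + 2 * `|t| + 3)) => //.
  - by move=> n x; exact: ker_LK_le.
  - move=> x; have [->|x0] := eqVneq x 0.
      have -> : (fun n => ker_LK t (s n 0)) = (fun n => ker_LK t n.+1%:R^-1).
        by apply/funext => n; rewrite /s normr0 y0.
      exact: ker_LK_cvg0.
    have ev : \forall n \near \oo, y n < `|x|.
      have x1 : 0 < `|x| by rewrite normr_gt0.
      exact: (cvgr_lt _ (@cvg_harmonic R) _ x1).
    apply: (@ccvg_squeeze_near _ _ _ (cst 0)); last exact: cvg_cst.
    apply: filterS ev => n yx.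
    by rewrite /s ltNge (ltW yx) subrr Normc.normc0.
have psi_seq (tn : nat -> R) t : tn n @[n --> \oo] --> t ->
    ccvg (fun n => psi (tn n)) (psi t).
  move=> tt; apply: ccvg_cexp; apply: ccvgD.
    apply: ccvgM; first exact: ccvg_cst.
    by apply: ccvg_real; exact: cvgMl.
  by apply: ccvgM; [exact: ccvg_cst|exact: ccvg_int_ker_LK].
have psi0 : psi 0 = 1.
  rewrite /psi mul0r; have -> : ker_LK 0 = (fun=> 0) :> (TR -> R[i]).
    by apply/funext => x; exact: ker_LK0.
  by rewrite cintegral_cst mul0r !mulr0 addr0 cexp0.
have [lap lapc] := laplace_measure c0.
have bcis u : bmc (fun t : TR => cis (t * u)).
  by under eq_fun do rewrite mulrC; exact: bmc_character.
have bexp n : bmc (fun t : TR => cexp (mixture mu (w n) (s n) t)).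
  have [[mr _] [mi _]] := bmc_mixture mu (bw n) (ms n).
  have [M hM] := bmc_bounded (bmc_mixture mu (bw n) (ms n)).
  have mer : measurable_fun setT (fun t : TR => expR (Re (mixture mu (w n) (s n) t))).
    exact: (measurableT_comp (@measurable_expR R) mr).
  apply: (@bmc_intro _ _ _ _ (expR M)) => [||t].
  - under eq_fun do rewrite Re_cexp; apply: measurable_funM => //.
    exact: (measurableT_comp (continuous_measurable_fun (@continuous_cos R)) mi).
  - under eq_fun do rewrite Im_cexp; apply: measurable_funM => //.
    exact: (measurableT_comp (continuous_measurable_fun (@continuous_sin R)) mi).
  - rewrite normc_cexp ler_expR (le_trans (ler_norm _))//.
    exact: (le_trans (Re_le_normc _)).
have ppsi : pos_transform lap psi.
  apply: (pos_limit (psin := psin) (M := 1)) => // n.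
    have -> : psin n = (fun t =>
        (expR (- L n))%:C * (cis (t * (g - b n)) * cexp (mixture mu (w n) (s n) t))).
      by apply/funext => t; exact: psinE.
    by apply: bmcM; [exact: bmc_cst|apply: bmcM].
  have -> : psin n = (fun t =>
      (expR (- L n))%:C * (cis (t * (g - b n)) * cexp (mixture mu (w n) (s n) t))).
    by apply/funext => t; exact: psinE.
  apply: pos_scale; [exact: bmcM|exact: expR_ge0|].
  apply: pos_translate; exact: (exp_mixture_pos mu (bw n) (w0 n) (ms n) c0 lapc).
have [] := @positive_inversion _ c lap psi 1 c0 lapc _ _ _ psi0 ppsi.
- by move=> t; apply/(@cvg_nbhsP _ R^o) => u ut; have [] := psi_seq u t ut.
- by move=> t; apply/(@cvg_nbhsP _ R^o) => u ut; have [] := psi_seq u t ut.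
- by move=> t; apply: psi_le => [|x]; [exact: bmc_ker_LK|exact: Re_ker_LK_le0].
move=> P [P1 cfP]; have [F [_ Fint]] := dfun_of_measure P1.
exists F => t; rewrite /charfun Fint cfP /psi mulNr -cexp_real -cexpD.
by rewrite rmorphN.
Qed.

End levy_khinchine.

(** * Continuous arguments *)

Section lifting.
Context {R : realType}.

Lemma unit_cis (z : R[i]) : normc z = 1 -> 0 < Re z -> z = cis (asin (Im z)).
Proof.
move=> z1 z0; have := sqr_normcE z; rewrite z1 expr1n => e.
have i1 : -1 <= Im z <= 1 by rewrite -ler_norml -z1 Im_le_normc.
apply: complex_ext; last by rewrite Im_cis asinK// in_itv.
rewrite Re_cis cos_asin// (_ : 1 - Im z ^+ 2 = Re z ^+ 2); last by rewrite e; ring.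
by rewrite sqrtr_sqr gtr0_norm.
Qed.

Let asin_0 : asin 0 = 0 :> R.
Proof.
by rewrite -[X in asin X]sin0 sinK// in_itv/= oppr_le0 divr_ge0 ?pi_ge0.
Qed.

Section unimodular.
Variable g : R -> R[i].
Hypothesis gr : continuous (fun t => Re (g t)).
Hypothesis gi : continuous (fun t => Im (g t)).
Hypothesis g1 : forall t, normc (g t) = 1.

(** The angle is relative to the value at a and is extended by 0 to the left, so
that angles on consecutive intervals are glued by addition. *)
Definition angle_on (a b : R) (B : R -> R) :=
  [/\ continuous B, forall t, t <= a -> B t = 0 &
    forall t, a <= t <= b -> g t = cis (B t) * g a].

Let gV (s : R) : (g s)^* * g s = 1.
Proof.
have e : Re (g s) ^+ 2 + Im (g s) ^+ 2 = 1 by rewrite -sqr_normcE g1 expr1n.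
apply: complex_ext.
  by rewrite ReM Re_conj Im_conj -[RHS]e; ring.
by rewrite ImM Re_conj Im_conj Im_1; ring.
Qed.

Let cmin b : continuous (fun t : R => Num.min t b).
Proof.
move=> t; apply: (@continuous_min _ _ id (cst b)).
  exact: cvg_id.
exact: cvg_cst.
Qed.

Let cmax b : continuous (fun t : R => Num.max b t).
Proof.
move=> t; apply: (@continuous_max _ _ (cst b) id).
  exact: cvg_cst.
exact: cvg_id.
Qed.

Lemma angle_on_cat a b c B1 B2 : a <= b -> b <= c ->
  angle_on a b B1 -> angle_on b c B2 ->
  angle_on a c (fun t => B1 (Num.min t b) + B2 t).
Proof.
move=> ab bc [c1 z1 e1] [c2 z2 e2]; split.
- move=> t; apply: cvgD; last exact: c2.
  apply: continuous_cvg; first exact: c1.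
  exact: cmin.
- by move=> t ta; rewrite min_l ?(le_trans ta)// z1// z2 ?addr0// (le_trans ta).
- move=> t /andP[aT tc]; have [tb|/ltW bt] := leP t b.
    by rewrite z2// addr0 e1// aT.
  rewrite e2 ?bt// cisD (e1 b) ?ab ?lexx//; ring.
Qed.

(** As long as g stays in the open half plane around g a, the angle is the
arcsine of the imaginary part. *)
Lemma angle_on_short a b : a <= b ->
  (forall t, a <= t <= b -> 0 < Re (g t * (g a)^*)) ->
  exists B, angle_on a b B.
Proof.
move=> ab pos.
pose cl t := Num.max a (Num.min t b).
have clab t : a <= cl t <= b.
  by rewrite /cl le_max lexx/= ge_max ab/= ge_min lexx orbT.
have ccl : continuous cl.
  move=> t; apply: (@continuous_comp _ _ _ (fun t => Num.min t b) (Num.max a)).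
    exact: cmin.
  exact: cmax.
pose q t := g t * (g a)^*.
have q1 t : normc (q t) = 1 by rewrite normcM normc_conj !g1 mulr1.
have iq t : a <= t <= b -> -1 < Im (q t) < 1.
  move=> tab; have := sqr_normcE (q t); rewrite q1 expr1n.
  by have := pos _ tab; rewrite -/(q t); set u := Re _; set v := Im _; nra.
have ciq : continuous (fun t => Im (q t)).
  have E : (fun t => Im (q t)) =
      (fun t => Re (g t) * - Im (g a) + Im (g t) * Re (g a)).
    by apply/funext => t; rewrite /q ImM Re_conj Im_conj.
  by rewrite E => t; apply: cvgD; apply: cvgMl; [exact: gr|exact: gi].
exists (fun t => asin (Im (q (cl t)))); split.
- move=> t; apply: (@continuous_comp _ _ _ (fun t => Im (q (cl t))) asin).
    apply: (@continuous_comp _ _ _ cl (fun t => Im (q t))); first exact: ccl.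
    exact: ciq.
  by apply: continuous_asin; exact: iq (clab t).
- move=> t ta; have -> : cl t = a by rewrite /cl min_l ?(le_trans ta)// max_l.
  by rewrite /q mulrC gV Im_1 asin_0.
- move=> t /andP[aT tb].
  have -> : cl t = t by rewrite /cl min_l// max_r.
  by rewrite -unit_cis ?pos ?aT// /q -mulrA gV mulr1.
Qed.

Let local t : exists2 d, 0 < d & forall s u, `|t - s| < d -> `|t - u| < d ->
  0 < Re (g u * (g s)^*).
Proof.
have e4 : (0 : R) < 1 / 4 by lra.
have hr : \forall y \near t, `|Re (g t) - Re (g y)| < 1 / 4.
  exact: (cvgr_dist_lt _ _ (@gr t) _ e4).
have hi : \forall y \near t, `|Im (g t) - Im (g y)| < 1 / 4.
  exact: (cvgr_dist_lt _ _ (@gi t) _ e4).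
have [d /= d0 hd] := filterI hr hi.
exists d => // s u ds du.
have [sr si] := hd s ds; have [ur ui] := hd u du.
rewrite ReM Re_conj Im_conj.
have es := sqr_normcE (g s); rewrite g1 expr1n in es.
have eu := sqr_normcE (g u); rewrite g1 expr1n in eu.
have et := sqr_normcE (g t); rewrite g1 expr1n in et.
move: sr si ur ui; rewrite !ltr_norml => /andP[? ?] /andP[? ?] /andP[? ?] /andP[? ?].
have h1 : (Re (g u) - Re (g s)) ^+ 2 <= 1 / 4 by nra.
have h2 : (Im (g u) - Im (g s)) ^+ 2 <= 1 / 4 by nra.
by nra.
Qed.

(** The points reachable from a with a continuous angle have no proper least
upper bound, because near any point the angle can be prolonged. *)
Lemma angle_on_exists a b : a <= b -> exists B, angle_on a b B.
Proof.
move=> ab.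
pose S := [set T | a <= T <= b /\ exists B, angle_on a T B].
have Sa : S a.
  split; first by rewrite lexx.
  exists (fun=> 0); split => //; first by move=> t; exact: cvg_cst.
  by move=> t /le_anti <-; rewrite cis0 mul1r.
have Sub : has_ubound S by exists b => T [/andP[]].
have supS : has_sup S by split; [exists a|].
have asup : a <= sup S by exact: ub_le_sup.
have supb : sup S <= b by apply: ge_sup; [exists a|move=> T [/andP[]]].
have [d d0 hd] := local (sup S).
have [s [/andP[as_ sb] [B1 hB1]] ds] := sup_adherent d0 supS.
have ssup : s <= sup S by apply: ub_le_sup => //; split; [rewrite as_|exists B1].
pose u := Num.min b (sup S + d / 2).
have su : s <= u by rewrite /u le_min sb/= (le_trans ssup)// lerDl divr_ge0// ltW.
have [B2 hB2] : exists B, angle_on s u B.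
  apply: angle_on_short => // t /andP[st tu]; apply: hd.
    by rewrite ger0_norm ?subr_ge0//; lra.
  have : t <= sup S + d / 2 by rewrite (le_trans tu)// /u ge_min lexx orbT.
  by rewrite ltr_norml; lra.
have Su : S u.
  split; first by rewrite (le_trans as_ su)/= /u ge_min lexx.
  by exists (fun t => B1 (Num.min t s) + B2 t); exact: angle_on_cat.
have usup : u <= sup S by exact: ub_le_sup.
have ub : u = b.
  move: usup; rewrite /u; case: (leP b (sup S + d / 2)) => //.
  by move=> _ h; exfalso; move: h; rewrite gerDl leNgt divr_gt0.
by move: Su; rewrite ub => -[].
Qed.

(** The angles on unit intervals are added up; near a given time only finitely
many of them contribute. *)
Lemma half_line_angle : exists a : R -> R, [/\ continuous a,
  forall t, t <= 0 -> a t = 0 & forall t, 0 <= t -> g t = cis (a t) * g 0].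
Proof.
have ex j : exists A, angle_on j%:R j.+1%:R A.
  by apply: angle_on_exists; rewrite ler_nat.
have [A hA] := choice ex.
pose S (N : nat) (t : R) : R := \sum_(j < N) A j (Num.min t j.+1%:R).
have SS N : S N.+1 = (fun t : R => S N t + A N (Num.min t N.+1%:R)).
  by apply/funext => t; rewrite /S big_ord_recr.
have cS N : continuous (S N).
  elim: N => [|N IH].
    have -> : S 0%N = cst 0 by apply/funext => t; rewrite /S big_ord0.
    exact: cst_continuous.
  rewrite SS => t; apply: cvgD; first exact: IH.
  apply: (@continuous_comp _ _ _ (fun t : R => Num.min t N.+1%:R) (A N)).
    exact: cmin.
  by have [cA _ _] := hA N; exact: cA.
have S0 N t : t <= 0 -> S N t = 0.
  move=> t0; rewrite /S big1// => j _; have [_ zA _] := hA j.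
  by apply: zA; rewrite ge_min (le_trans t0)// ler0n.
have Sst N k t : t <= N%:R -> S (N + k)%N t = S N t.
  move=> tN; elim: k => [|k IH]; first by rewrite addn0.
  rewrite addnS {1}/S big_ord_recr/= -/(S _ _) IH.
  have [_ zA _] := hA (N + k)%N; rewrite zA ?addr0// ge_min.
  by rewrite (le_trans tN)// ler_nat leq_addr.
have gS N t : 0 <= t -> t <= N%:R -> g t = cis (S N t) * g 0.
  elim: N t => [|N IH] t t0 tN.
    have -> : t = 0 by apply: le_anti; rewrite t0 tN.
    by rewrite S0// cis0 mul1r.
  have [tn|/ltW nt] := leP t N%:R; first by rewrite -addn1 Sst// IH.
  have [_ _ eA] := hA N; rewrite eA ?nt// (IH N%:R)//.
  rewrite mulrA -cisD addrC; congr (cis _ * _).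
  rewrite /S big_ord_recr/= (min_l tN); congr (_ + _).
  apply: eq_bigr => j _; rewrite !min_r// ?ler_nat//.
  by rewrite (le_trans _ nt)// ler_nat.
pose N (t : R) := (Num.truncn `|t|).+1.
have tN t : t < (N t)%:R.
  by rewrite (le_lt_trans (ler_norm _))// truncnS_gt.
have Sany t M : t <= M%:R -> S M t = S (N t) t.
  move=> tM; have [NM|/ltnW MN] := leqP (N t) M.
    by rewrite -(subnKC NM) Sst// ltW.
  by rewrite -(subnKC MN) Sst.
exists (fun t => S (N t) t); split.
- move=> t.
  have near_eq : \forall y \near t, S (N t) y = S (N y) y.
    near=> y; apply: Sany; apply: ltW; near: y; apply: lt_nbhsl; exact: tN.
  by apply: cvg_trans (cS (N t) t); apply: near_eq_cvg.
- by move=> t t0; exact: S0.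
- by move=> t t0; apply: gS => //; exact/ltW/tN.
Unshelve. all: by end_near. Qed.

End unimodular.

Lemma continuous_normc (f : R -> R[i]) :
  continuous (fun t => Re (f t)) -> continuous (fun t => Im (f t)) ->
  continuous (fun t => normc (f t)).
Proof.
move=> fr fi.
have -> : (fun t => normc (f t)) =
    (fun t => Num.sqrt (Re (f t) * Re (f t) + Im (f t) * Im (f t))).
  by apply/funext => t; rewrite normcE2 !expr2.
move=> t; apply: continuous_cvg; first exact: sqrt_continuous.
by apply: cvgD; apply: cvgM; [exact: fr|exact: fr|exact: fi|exact: fi].
Qed.

(** The two half lines are handled separately, the left one after a reflection,
for the direction of f. *)
Lemma continuous_argument (f : R -> R[i]) :
  continuous (fun t => Re (f t)) -> continuous (fun t => Im (f t)) ->
  (forall t, f t != 0) -> f 0 = 1 ->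
  exists a : R -> R, [/\ continuous a, a 0 = 0 &
    forall t, f t = (normc (f t))%:C * cis (a t)].
Proof.
move=> fr fi f0 f01.
pose g t := f t * ((normc (f t))^-1)%:C.
have n0 t : normc (f t) != 0 by rewrite normc_eq0.
have cn := continuous_normc fr fi.
have zr (z : R[i]) (x : R) : Re (z * x%:C) = Re z * x.
  by rewrite ReM/= mulr0 subr0.
have zi (z : R[i]) (x : R) : Im (z * x%:C) = Im z * x.
  by rewrite ImM/= mulr0 add0r.
have gr : continuous (fun t => Re (g t)).
  have -> : (fun t => Re (g t)) = (fun t => Re (f t) * (normc (f t))^-1).
    by apply/funext => t; rewrite zr.
  by move=> t; apply: cvgM; [exact: fr|apply: cvgV; [exact: n0|exact: cn]].
have gi : continuous (fun t => Im (g t)).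
  have -> : (fun t => Im (g t)) = (fun t => Im (f t) * (normc (f t))^-1).
    by apply/funext => t; rewrite zi.
  by move=> t; apply: cvgM; [exact: fi|apply: cvgV; [exact: n0|exact: cn]].
have g1 t : normc (g t) = 1.
  by rewrite normcM normc_real ger0_norm ?invr_ge0 ?normc_ge0// mulfV.
have g0 : g 0 = 1 by rewrite /g f01 Normc.normc1 invr1 mulr1.
have cN : continuous (fun t : R => - t) by move=> t; exact: oppr_continuous.
have grN : continuous (fun t => Re (g (- t))).
  by move=> t; apply: (@continuous_comp _ _ _ -%R (fun t => Re (g t)));
    [exact: cN|exact: gr].
have giN : continuous (fun t => Im (g (- t))).
  by move=> t; apply: (@continuous_comp _ _ _ -%R (fun t => Im (g t)));
    [exact: cN|exact: gi].
have [a [ca za ea]] := half_line_angle gr gi g1.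
have [b [cb zb eb]] := half_line_angle (g := fun t => g (- t)) grN giN
  (fun t => g1 (- t)).
exists (fun t => a t + b (- t)); split.
- move=> t; apply: cvgD; first exact: ca.
  by apply: (@continuous_comp _ _ _ -%R b); [exact: cN|exact: cb].
- by rewrite oppr0 za// zb// addr0.
- move=> t; have <- : g t = cis (a t + b (- t)).
    have [t0|/ltW t0] := leP 0 t.
      by rewrite zb ?oppr_le0// addr0 ea// g0 mulr1.
    by rewrite za// add0r -{1}(opprK t) eb ?oppr_ge0// oppr0 g0 mulr1.
  by rewrite /g mulrCA -rmorphM/= mulfV// mulr1.
Qed.

End lifting.

(** * Tools for the grid *)

Section uniform_continuity.
Context {R : realType}.

(** The second point is allowed to leave the segment, as the grid points next to
the end of an interval do. *)
Lemma uniform_continuity_segment (f : R -> R) (a b e : R) :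
  continuous f -> 0 < e ->
  exists2 d, 0 < d & forall s u, a <= s <= b -> `|s - u| < d -> `|f s - f u| < e.
Proof.
move=> cf e0.
have cov : forall x : R, `[a, b]%classic x ->
    \forall x' \near x & d \near 0^'+, forall y, `|x' - y| < d -> `|f x' - f y| < e.
  move=> x _.
  have e2 : 0 < e / 2 by rewrite divr_gt0.
  have hx : \forall y \near x, `|f x - f y| < e / 2.
    exact: (cvgr_dist_lt _ _ (@cf x) _ e2).
  have [r /= r0 hr] := hx.
  exists (ball x (r / 2), [set d | d < r / 2]) => /=.
    split; first by apply: nbhsx_ballx; rewrite divr_gt0.
    by apply: nbhs_right_lt; rewrite divr_gt0.
  move=> [x' d] /= [xx' dr] y x'y.
  have hx' : `|x - x'| < r by rewrite (lt_le_trans xx')//; lra.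
  have hy : `|x - y| < r.
    have -> : x - y = (x - x') + (x' - y) by ring.
    rewrite (le_lt_trans (ler_normD _ _))//.
    by move: xx'; rewrite /ball/=; lra.
  have -> : f x' - f y = (f x - f y) - (f x - f x') by ring.
  rewrite (le_lt_trans (ler_normB _ _))//.
  by have := hr _ hx'; have := hr _ hy; rewrite /=; lra.
have /compact_near_coveringP H := @segment_compact R a b.
have [r /= r0 hr] := H _ _ _ _ cov.
exists (r / 2); first by rewrite divr_gt0.
have hr2 : `|0 - r / 2| < r by rewrite sub0r normrN gtr0_norm ?divr_gt0//; lra.
have r2 : 0 < r / 2 by rewrite divr_gt0.
move=> s u sab; apply: (hr _ hr2 r2 s).
by rewrite /= in_itv.
Qed.

End uniform_continuity.

Section stieltjes_measures.
Context {R : realType}.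
Local Notation TR := (measurableTypeR R).
Local Notation LS := lebesgue_stieltjes_measure.

Lemma stieltjes_measure_lty (F : cumulative R R) (M : R) :
  (forall a b, a <= b -> F b - F a <= M) -> (LS F setT < +oo)%E.
Proof.
move=> FM; rewrite -(bigcup_itvT false false).
pose I n : set R := `]- (n%:R), n%:R]%classic.
have cvI : (LS F \o I) n @[n --> \oo] --> LS F (\bigcup_n I n).
  apply: nondecreasing_cvg_mu; rewrite /I//; first exact: bigcup_measurable.
  by move=> *; apply/subsetPset/subset_itv; rewrite leBSide/= ?lerN2 ler_nat.
apply: (@le_lt_trans _ _ M%:E); last exact: ltry.
apply: (cvge_to_le cvI); apply: nearW => n.
rewrite /= /LS /measure_extension measurable_mu_extE/=; last exact: is_ocitv.
rewrite wlength_itv_bnd//; last by rewrite ge0_cp.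
by rewrite lee_fin FM// ge0_cp.
Qed.

Lemma classV_variation (G : classV R) :
  exists M : R, forall a b, a <= b -> fine (total_variation a b G) <= M.
Proof.
have [M hM] := classV_bv G; exists M => a b ab.
by rewrite -lee_fin fineK ?classV_tv_fin// hM.
Qed.

(** Bounded variation bounds both parts of the Jordan decomposition, so the
integral against G is a difference of integrals against finite measures. *)
Lemma stieltjes_measures (G : classV R) :
  exists mp mn : {finite_measure set TR -> \bar R},
    forall u, stieltjes G u = cintegral mp u - cintegral mn u.
Proof.
have [M hM] := classV_variation G.
have bound a b : a <= b ->
    `|G b - G a| <= fine (total_variation a b G) /\
    tv_upto G b - tv_upto G a = fine (total_variation a b G).
  by move=> ab; split; [exact: classV_tv_ge|exact: tv_uptoB].
have pfin : (LS (pos_part G) setT < +oo)%E.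
  apply: (@stieltjes_measure_lty _ M) => a b ab.
  have [] := bound a b ab; have := hM a b ab.
  by rewrite ler_norml /= /pos_part => ? /andP[? ?] ?; lra.
have nfin : (LS (neg_part G) setT < +oo)%E.
  apply: (@stieltjes_measure_lty _ M) => a b ab.
  have [] := bound a b ab; have := hM a b ab.
  by rewrite ler_norml /= /neg_part => ? /andP[? ?] ?; lra.
have [mp hp] := finite_measure_of_mass pfin.
have [mn hn] := finite_measure_of_mass nfin.
exists mp, mn => u; rewrite /stieltjes.
by congr (_ - _); apply: cintegral_eq_measure => A mA; rewrite ?hp ?hn.
Qed.

End stieltjes_measures.

Section second_differences.
Context {R : realType}.
Implicit Types (z : nat -> R[i]) (h x : R).

(** Discrete Taylor formula: summing second differences twice. *)
Lemma sum_second_diff z m : z 0%N = 0 ->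
  \sum_(j < m) (m - j)%:R * (2 * z j.+1 - z j - z j.+2) =
  m.+1%:R * z 1%N - z m.+1.
Proof.
move=> z0.
have tel n : \sum_(j < n) (2 * z j.+1 - z j - z j.+2) =
    z 1%N - (z n.+1 - z n).
  elim: n => [|n IH]; first by rewrite big_ord0 z0; ring.
  by rewrite big_ord_recr/= IH; ring.
elim: m => [|m IH]; first by rewrite big_ord0 mul1r subrr.
have -> : \sum_(j < m.+1) (m.+1 - j)%:R * (2 * z j.+1 - z j - z j.+2) =
    \sum_(j < m) (m - j)%:R * (2 * z j.+1 - z j - z j.+2) +
    \sum_(j < m.+1) (2 * z j.+1 - z j - z j.+2).
  rewrite big_ord_recr/= [in RHS]big_ord_recr/= addrA -big_split/= subSnn mul1r.
  congr (_ + _); apply: eq_bigr => j _.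
  by rewrite subSn ?(ltnW (ltn_ord j))// -natr1 mulrDl mul1r.
rewrite IH tel -[m.+2%:R]natr1; ring.
Qed.

(** The weighted sum of second differences recovers the last value, up to a
multiple of the first; half of the term of index 0 turns that first value into
its imaginary part. *)
Lemma sum_second_diff_sym z (w0 : R[i]) m : z 0%N = 0 ->
  m.+1%:R / 2 * w0 +
  \sum_(j < m) (m - j)%:R * (2 * z j.+1 - z j - z j.+2) =
  m.+1%:R * (z 1%N + w0 / 2) - z m.+1.
Proof.
by move=> z0; rewrite sum_second_diff//; field.
Qed.

Lemma ker_cosE h x : ker_cos h x = - Re (ker_LK h x).
Proof.
rewrite Re_ker_LK /ker_cos; case: ifPn => _; first by rewrite opprK.
by rewrite -mulNr opprB.
Qed.

(** The same summation for the function cis(. x) - 1, whose second difference at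
k h is cis(k h x) times 2 (1 - cos(h x)). The halved term of index 0 leaves
i sin(h x) as first value, and the correction i t sin x of the kernel is linear
in t, hence invisible to second differences. *)
Lemma ker_LK_sum h x m :
  m.+1%:R / 2 * (2 * (cis (0%:R * h * x) * (ker_cos h x)%:C)) +
  \sum_(j < m) (m - j)%:R * (2 * (cis (j.+1%:R * h * x) * (ker_cos h x)%:C)) =
  'i * (m.+1%:R * Im (ker_LK h x))%:C - ker_LK (m.+1%:R * h) x.
Proof.
have natC (n : nat) : (n%:R : R)%:C = n%:R :> R[i] by rewrite rmorph_nat.
rewrite Im_ker_LK /ker_LK /ker_cos; case: (eqVneq x 0) => [->|x0].
  pose z (n : nat) : R[i] := - (n%:R ^+ 2 / 2).
  have z0 : z 0%N = 0 by rewrite /z expr0n mul0r oppr0.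
  have s1 := @sum_second_diff_sym z 1 m z0.
  have c1 : (h ^+ 2)%:C = (h%:C) ^+ 2 by rewrite rmorphXn.
  transitivity ((h%:C) ^+ 2 * (m.+1%:R / 2 * 1 +
     \sum_(j < m) (m - j)%:R * (2 * z j.+1 - z j - z j.+2))).
    rewrite mulrDr mulr_sumr; congr (_ + _).
      by rewrite mulr0 cis0 rmorphM/= c1 fmorphV/= natC; field.
    apply: eq_bigr => j _.
    by rewrite mulr0 cis0 rmorphM/= c1 fmorphV/= natC /z -!natr1; field.
  rewrite s1 /z mulr0 rmorphN/= rmorphM/= rmorphXn rmorphM/= fmorphV/= !natC.
  by rewrite !mulr0 sub0r; field.
pose z (n : nat) : R[i] := cis (n%:R * h * x) - 1.
pose c : R[i] := (1 - cos (h * x))%:C.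
pose K : R[i] := ((1 + x ^+ 2) / x ^+ 2)%:C.
have z0 : z 0%N = 0 by rewrite /z !mul0r cis0 subrr.
have cc : 2 * c = 2 - (cis (h * x) + cis (- (h * x))).
  rewrite cisN; apply: complex_ext; rewrite !ReImE /c ?Re_real ?Im_real; ring.
have s1 := @sum_second_diff_sym z (2 * c) m z0.
transitivity (K * (m.+1%:R / 2 * (2 * c) +
     \sum_(j < m) (m - j)%:R * (2 * z j.+1 - z j - z j.+2))).
  rewrite mulrDr mulr_sumr; congr (_ + _).
    by rewrite !mul0r cis0 rmorphM/= -/c -/K; ring.
  apply: eq_bigr => j _.
  have -> : 2 * z j.+1 - z j - z j.+2 = cis (j.+1%:R * h * x) * (2 * c).
    have e1 : cis (j%:R * h * x) = cis (j.+1%:R * h * x) * cis (- (h * x)) :> R[i].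
      by rewrite -cisD; congr cis; rewrite -natr1; ring.
    have e2 : cis (j.+2%:R * h * x) = cis (j.+1%:R * h * x) * cis (h * x) :> R[i].
      by rewrite -cisD; congr cis; rewrite -[j.+2%:R]natr1; ring.
    by rewrite cc /z e1 e2; ring.
  by rewrite rmorphM/= -/c -/K; ring.
have z1 : z 1%N + 2 * c / 2 = 'i * (sin (h * x))%:C.
  rewrite /z mul1r (_ : 2 * c / 2 = c); last by field.
  by apply: complex_ext; rewrite !ReImE /c ?Re_real ?Im_real; ring.
rewrite s1 z1 /z /levy_weight !rmorphM/= rmorphB/= !rmorphM/= natC -/K.
ring.
Qed.

End second_differences.

(** * The representation from second differences *)

Section representation.
Context {R : realType}.
Local Notation TR := (measurableTypeR R).
Variables (f : R -> R[i]) (a : R -> R) (eps : int) (I rho : R -> R -> R[i]).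
Variables (G : classV R) (hl : nat -> R).
Hypothesis fr : continuous (fun t => Re (f t)).
Hypothesis fi : continuous (fun t => Im (f t)).
Hypothesis f0 : f 0 = 1.
Hypothesis f_neq0 : forall t, f t != 0.
Hypothesis a_cont : continuous a.
Hypothesis a0 : a 0 = 0.
Hypothesis fa : forall t, f t = (normc (f t))%:C * cis (a t).
Hypothesis f_conj : forall t, f (- t) = (f t)^*.
Hypothesis eps_sign : eps = 1 \/ eps = -1.
Hypothesis hl_gt0 : forall l, 0 < hl l.
Hypothesis hl_cvg0 : hl l @[l --> \oo] --> (0 : R).
Hypothesis phiE : forall t h, 0 <= t -> 0 < h ->
  phi eps f t h = eps%:~R * 2 * I t h + rho t h.
Hypothesis IE : forall t h, 0 <= t -> 0 < h ->
  I t h = stieltjes G (fun x => cis (t * x) * (ker_cos h x)%:C).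
Hypothesis rho_cvg0 : forall t, 0 < t ->
  (let n l := Num.truncn (t / hl l) in
   \sum_(k < n l) (n l - k)%:R * Normc.normc (rho (k%:R * hl l) (hl l)))
     @[l --> \oo] --> (0 : R).
Hypothesis phi_cvg0 : forall t, 0 < t ->
  (let n l := Num.truncn (t / hl l) in
   \sum_(k < n l) (n l - k)%:R *
     Normc.normc (phi eps f (k%:R * hl l) (hl l)) ^+ 2)
     @[l --> \oo] --> (0 : R).

Let L (t : R) : R[i] := ln (normc (f t)) +i* a t.
Let psi (t : R) : R[i] := stieltjes G (ker_LK t).

Let ReL t : Re (L t) = ln (normc (f t)). Proof. by []. Qed.
Let ImL t : Im (L t) = a t. Proof. by []. Qed.

Let cexpL t : cexp (L t) = f t.
Proof.
have n0 : 0 < normc (f t) by rewrite normc_gt0.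
rewrite [RHS]fa cisE -[in RHS](lnK n0) -cexp_real -cexpD; congr cexp.
by apply: complex_ext; rewrite ?ReL ?ImL !ReImE ?Re_real ?Im_real; ring.
Qed.

Let L0 : L 0 = 0.
Proof. by rewrite /L f0 a0 Normc.normc1 ln1. Qed.

Let cReL : continuous (fun t => Re (L t)).
Proof.
rewrite (_ : (fun t => _) = (fun t => ln (normc (f t)))) // => t.
apply: (@continuous_comp _ _ _ (fun t => normc (f t)) (@ln R)); last first.
  by apply: continuous_ln; rewrite normc_gt0.
exact: (continuous_normc fr fi).
Qed.

(** The second differences of L at the grid points. At the origin, L(- h) is
replaced by the conjugate of L(h), which is legitimate as the values of f at
opposite points are conjugate. *)
Let w (h : R) (k : nat) : R[i] :=
  if k is j.+1 then 2 * L (j.+1%:R * h) - L (j%:R * h) - L (j.+2%:R * h)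
  else (- 2 * Re (L h))%:C.

Let cexp_w h k :
  cexp (w h k) = f (k%:R * h) ^+ 2 / (f (k%:R * h - h) * f (k%:R * h + h)).
Proof.
case: k => [|j].
  have -> : w h 0 = - ((L h)^* + L h).
    rewrite /w; apply: complex_ext.
      by rewrite Re_real !ReImE; ring.
    by rewrite Im_real !ReImE; ring.
  by rewrite mul0r f0 expr1n sub0r add0r f_conj mul1r cexpN cexpD cexp_conj cexpL.
rewrite /w.
have -> : j.+1%:R * h - h = j%:R * h by rewrite -natr1; ring.
have -> : j.+1%:R * h + h = j.+2%:R * h by rewrite -[j.+2%:R]natr1; ring.
rewrite -!cexpL -cexpD -cexpN expr2 -!cexpD; congr cexp; ring.
Qed.

Let epsN : normc (eps%:~R : R[i]) = 1.
Proof.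
by case: eps_sign => ->; rewrite ?mulrN1z ?normcN Normc.normc1.
Qed.

Let cexp_eps h k : cexp (eps%:~R * w h k) - 1 = phi eps f (k%:R * h) h.
Proof.
rewrite /phi; congr (_ - _); case: eps_sign => ->.
  by rewrite mul1r expr1z cexp_w.
by rewrite mulrN1z mulN1r cexpN cexp_w exprN1.
Qed.

(** The sign is transferred to the second difference, so that both choices are
covered by the same estimate of the logarithm. *)
Let w_estimate h k : 0 < h -> normc (w h k) <= 1 / 8 ->
  normc (w h k - 2 * I (k%:R * h) h) <=
  16 * normc (phi eps f (k%:R * h) h) ^+ 2 + normc (rho (k%:R * h) h).
Proof.
move=> h0 wk.
have := @normc_cexp_log _ (eps%:~R * w h k).
rewrite normcM epsN mul1r cexp_eps => /(_ wk) est.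
have ee : (eps%:~R : R[i]) * eps%:~R = 1.
  by case: eps_sign => ->; rewrite ?mulrN1z ?mulrNN mulr1.
have kh : 0 <= k%:R * h by rewrite mulr_ge0// ltW.
have -> : w h k - 2 * I (k%:R * h) h =
    eps%:~R * (eps%:~R * w h k - phi eps f (k%:R * h) h) +
    eps%:~R * rho (k%:R * h) h.
  transitivity (eps%:~R * eps%:~R * (w h k - 2 * I (k%:R * h) h)).
    by rewrite ee mul1r.
  by rewrite (phiE kh h0); ring.
rewrite (le_trans (normcD _ _))// !normcM epsN !mul1r.
by rewrite lerD2r.
Qed.

Let psi_sum h m : 0 < h ->
  m.+1%:R / 2 * (2 * I (0%:R * h) h) +
  \sum_(j < m) (m - j)%:R * (2 * I (j.+1%:R * h) h) =
  'i * (m.+1%:R * Im (psi h))%:C - psi (m.+1%:R * h).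
Proof.
move=> h0; have [mp [mn SE]] := stieltjes_measures G.
have bcos : bmc (fun x : TR => (ker_cos h x)%:C).
  apply: bmc_real.
  rewrite (_ : ker_cos h = (fun x => - Re (ker_LK h x))); last first.
    by apply/funext => x; exact: ker_cosE.
  by apply: bmfN; have [] := bmc_ker_LK h.
have bk (k : nat) : bmc (fun x : TR => cis (k%:R * h * x) * (ker_cos h x)%:C).
  by apply: bmcM => //; exact: bmc_character.
have bi : bmf (fun x : TR => Im (ker_LK h x)) by have [] := bmc_ker_LK h.
have kh (k : nat) : 0 <= k%:R * h by rewrite mulr_ge0// ltW.
have one (mu : {finite_measure set TR -> \bar R}) :
  m.+1%:R / 2 * (2 * cintegral mu (fun x => cis (0%:R * h * x) * (ker_cos h x)%:C)) +
  \sum_(j < m) (m - j)%:R *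
    (2 * cintegral mu (fun x => cis (j.+1%:R * h * x) * (ker_cos h x)%:C)) =
  'i * (m.+1%:R * Im (cintegral mu (ker_LK h)))%:C -
    cintegral mu (ker_LK (m.+1%:R * h)).
  transitivity (cintegral mu (fun x =>
      'i * (m.+1%:R * Im (ker_LK h x))%:C - ker_LK (m.+1%:R * h) x)).
    have -> : (fun x => 'i * (m.+1%:R * Im (ker_LK h x))%:C -
        ker_LK (m.+1%:R * h) x) = (fun x =>
      m.+1%:R / 2 * (2 * (cis (0%:R * h * x) * (ker_cos h x)%:C)) +
      \sum_(j < m) (m - j)%:R *
        (2 * (cis (j.+1%:R * h * x) * (ker_cos h x)%:C))).
      by apply/funext => x; rewrite ker_LK_sum.
    have b2 k : bmc (fun x : TR => 2 * (cis (k%:R * h * x) * (ker_cos h x)%:C)).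
      by apply: bmcM => //; exact: bmc_cst.
    have b3 (c : R[i]) k : bmc (fun x : TR =>
        c * (2 * (cis (k%:R * h * x) * (ker_cos h x)%:C))).
      by apply: bmcM => //; exact: bmc_cst.
    rewrite cintegralD//; last by apply: bmc_sum => j; exact: (b3 _ j.+1).
    rewrite cintegral_sum; last by move=> j; exact: (b3 _ j.+1).
    congr (_ + _); first by rewrite !cintegralZ.
    by apply: eq_bigr => j _; rewrite !cintegralZ.
  rewrite cintegralB; last 2 first.
  - apply: bmcM; first exact: bmc_cst.
    by apply: bmc_real; apply: bmfM => //; exact: bmf_cst.
  - exact: bmc_ker_LK.
  congr (_ - _).
  rewrite cintegralZ; last first.
    by apply: bmc_real; apply: bmfM => //; exact: bmf_cst.
  congr (_ * _); rewrite cintegral_real; congr (_%:C).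
  by rewrite RintegralZl//; exact: (@bmf_integrable _ _ _ mu _ bi).
pose P (mu : {finite_measure set TR -> \bar R}) (k : nat) :=
  cintegral mu (fun x => cis (k%:R * h * x) * (ker_cos h x)%:C).
have I2 k : 2 * I (k%:R * h) h = 2 * P mp k - 2 * P mn k.
  by rewrite (IE (kh k) h0) SE mulrBr.
have {}one mu : m.+1%:R / 2 * (2 * P mu 0%N) +
    \sum_(j < m) (m - j)%:R * (2 * P mu j.+1) =
  'i * (m.+1%:R * Im (cintegral mu (ker_LK h)))%:C -
    cintegral mu (ker_LK (m.+1%:R * h)) by exact: one.
have op := one mp; have on := one mn.
move: I2 op on; move: (P mp) (P mn) => p n I2 op on.
rewrite I2; under eq_bigr do rewrite I2 mulrBr.
rewrite sumrB mulrBr.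
set a1 := _ * (2 * p _) in op *.
set a2 := _ * (2 * n _) in on *.
set b1 := \sum_(i < m) _ in op *.
set b2 := \sum_(i < m) _ in on *.
have -> : a1 - a2 + (b1 - b2) = (a1 + b1) - (a2 + b2) by ring.
rewrite op on /psi !SE.
have -> (x y : R[i]) : (m.+1%:R * Im (x - y))%:C =
    (m.+1%:R * Im x)%:C - (m.+1%:R * Im y)%:C :> R[i].
  by rewrite ImD ImN mulrBr rmorphB.
set c1 := (_ * Im (cintegral mp _))%:C.
set c2 := (_ * Im (cintegral mn _))%:C.
set u := cintegral mp _; set v := cintegral mn _.
by rewrite mulrBr opprD addrACA opprK [- u + v]addrC opprB [v - u]addrC.
Qed.

(** With all second differences small, the logarithm and the candidate exponent
differ on the grid by an imaginary linear function, up to the errors summed in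
the hypotheses. *)
Let grid_estimate h m : 0 < h -> (forall k, (k < m.+1)%N -> normc (w h k) <= 1 / 8) ->
  normc (L (m.+1%:R * h) - psi (m.+1%:R * h) -
    'i * (m.+1%:R * (Im (L h) - Im (psi h)))%:C) <=
  16 * \sum_(k < m.+1) (m.+1 - k)%:R * normc (phi eps f (k%:R * h) h) ^+ 2 +
  \sum_(k < m.+1) (m.+1 - k)%:R * normc (rho (k%:R * h) h).
Proof.
move=> h0 ws.
pose z (n : nat) := L (n%:R * h).
have z0 : z 0%N = 0 by rewrite /z mul0r L0.
have s1 := @sum_second_diff_sym _ z (w h 0) m z0.
have s2 := psi_sum m h0.
have z1 : z 1%N + w h 0 / 2 = 'i * (Im (L h))%:C.
  rewrite /z mul1r /= rmorphM/= rmorphN/= rmorph_nat.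
  have {1}-> : L h = (Re (L h))%:C + 'i * (Im (L h))%:C.
    by apply: complex_ext; rewrite !ReImE ?Re_real ?Im_real; ring.
  by field.
pose d k := w h k - 2 * I (k%:R * h) h.
have -> : L (m.+1%:R * h) - psi (m.+1%:R * h) -
    'i * (m.+1%:R * (Im (L h) - Im (psi h)))%:C =
  - (m.+1%:R / 2 * d 0%N + \sum_(j < m) (m - j)%:R * d j.+1).
  have -> : m.+1%:R / 2 * d 0%N + \sum_(j < m) (m - j)%:R * d j.+1 =
    (m.+1%:R / 2 * w h 0 +
      \sum_(j < m) (m - j)%:R * (2 * z j.+1 - z j - z j.+2)) -
    (m.+1%:R / 2 * (2 * I (0%:R * h) h) +
      \sum_(j < m) (m - j)%:R * (2 * I (j.+1%:R * h) h)).
    rewrite opprD addrACA -sumrB; congr (_ + _); first by rewrite /d; ring.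
    by apply: eq_bigr => j _; rewrite /d /= /z; ring.
  have e (x y : R) : 'i * (m.+1%:R * (x - y))%:C =
      m.+1%:R * ('i * x%:C) - 'i * (m.+1%:R * y)%:C :> R[i].
    by rewrite mulrBr rmorphB mulrBr rmorphM/= rmorph_nat mulrCA.
  rewrite s1 s2 z1 e /z.
  set u := L (_ * _); set v := psi (_ * _).
  set c1 := m.+1%:R * _; set c2 := 'i * _.
  by move: u v c1 c2 => u v c1 c2; ring.
rewrite normcN (le_trans (normcD _ _))//.
rewrite mulr_sumr -big_split/= big_ord_recl/=.
have nn (n : nat) : normc (n%:R : R[i]) = n%:R.
  by rewrite -(rmorph_nat (real_complex R)) normc_real ger0_norm.
apply: lerD.
  rewrite subn0 normcM (mulrCA 16) -mulrDr ler_pM ?normc_ge0//.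
    rewrite normcM nn Normc.normcV nn ler_piMr// invf_le1 ?ler1n//.
  exact: (w_estimate h0 (ws 0%N _)).
rewrite (le_trans (normc_sum _ _))// ler_sum// => j _.
rewrite /bump/= add1n subSS normcM nn (mulrCA 16) -mulrDr ler_wpM2l//.
by apply: (w_estimate h0 (ws j.+1 _)); rewrite ltnS.
Qed.

Let n_ (t : R) (l : nat) : nat := Num.truncn (t / hl l).

Let n_le t l : 0 < t -> (n_ t l)%:R * hl l <= t.
Proof. by move=> t0; rewrite -ler_pdivlMr// truncn_le divr_ge0// ltW. Qed.

Let n_gt t l : t - hl l < (n_ t l)%:R * hl l.
Proof.
have : t / hl l < (n_ t l).+1%:R by exact: truncnS_gt.
by rewrite ltr_pdivrMr// -natr1 mulrDl mul1r ltrBlDr.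
Qed.

Let grid_cvg t : 0 < t -> (n_ t l)%:R * hl l @[l --> \oo] --> t.
Proof.
move=> t0; apply: (@squeeze_cvgr _ _ _ _ (fun l => t - hl l) (fun=> t)).
- by apply: nearW => l; rewrite (ltW (n_gt t l)) n_le.
- by rewrite -[X in _ --> X]subr0; apply: cvgB => //; exact: cvg_cst.
- exact: cvg_cst.
Qed.

(** Uniform continuity of the logarithm on a bounded interval makes all second
differences up to time t small at once. *)
Let w_small t : 0 < t ->
  \forall l \near \oo, forall k, (k < n_ t l)%N -> normc (w (hl l) k) <= 1 / 8.
Proof.
move=> t0; have e0 : 0 < 1 / 32 :> R by lra.
have [d1 d10 h1] := @uniform_continuity_segment _ _ 0 t _ cReL e0.
have [d2 d20 h2] := @uniform_continuity_segment _ _ 0 t _ a_cont e0.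
have ev1 : \forall l \near \oo, hl l < d1 by exact: (cvgr_lt _ hl_cvg0 _ d10).
have ev2 : \forall l \near \oo, hl l < d2 by exact: (cvgr_lt _ hl_cvg0 _ d20).
near=> l.
have hd1 : hl l < d1 by near: l.
have hd2 : hl l < d2 by near: l.
have h0 := hl_gt0 l.
case=> [|j] kn.
  rewrite /w normc_real normrM normrN normr_nat.
  have : `|Re (L 0) - Re (L (hl l))| < 1 / 32.
    by apply: h1; [rewrite lexx ltW|rewrite sub0r normrN gtr0_norm].
  by rewrite L0 Re_0 sub0r normrN; lra.
have jh : 0 <= j.+1%:R * hl l <= t.
  rewrite mulr_ge0 ?(ltW h0)//=; apply: le_trans (n_le l t0).
  by rewrite ler_pM2r// ler_nat ltnW.
have d0 : `|j.+1%:R * hl l - j%:R * hl l| = hl l.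
  by rewrite -natr1 mulrDl mul1r addrAC subrr add0r gtr0_norm.
have d2' : `|j.+1%:R * hl l - j.+2%:R * hl l| = hl l.
  by rewrite -[j.+2%:R]natr1 mulrDl mul1r opprD addrA subrr sub0r normrN gtr0_norm.
have := h1 _ (j%:R * hl l) jh; rewrite d0 => /(_ hd1) r0.
have := h1 _ (j.+2%:R * hl l) jh; rewrite d2' => /(_ hd1) r2.
have := h2 _ (j%:R * hl l) jh; rewrite d0 => /(_ hd2) i0.
have := h2 _ (j.+2%:R * hl l) jh; rewrite d2' => /(_ hd2) i2.
rewrite (le_trans (normc_le_ReIm _))// /w.
rewrite !ReD !ImD !ReN !ImN ReM ImM Re_nat Im_nat !ImL.
move: r0 r2 i0 i2; rewrite !ltr_norml => /andP[? ?] /andP[? ?] /andP[? ?] /andP[? ?].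
by rewrite (_ : 1 / 8 = 1 / 16 + 1 / 16); [apply: lerD; rewrite ler_norml; lra|lra].
Unshelve. all: by end_near. Qed.

Let beta l := Im (L (hl l)) - Im (psi (hl l)).

Let grid_limit t : 0 < t ->
  ccvg (fun l => L ((n_ t l)%:R * hl l) - psi ((n_ t l)%:R * hl l) -
    'i * ((n_ t l)%:R * beta l)%:C) 0.
Proof.
move=> t0.
pose e l := 16 * \sum_(k < n_ t l) (n_ t l - k)%:R *
    normc (phi eps f (k%:R * hl l) (hl l)) ^+ 2 +
  \sum_(k < n_ t l) (n_ t l - k)%:R * normc (rho (k%:R * hl l) (hl l)).
apply: (@ccvg_squeeze_near _ _ _ e); last first.
  rewrite -[X in _ --> X]addr0; apply: cvgD; last exact: rho_cvg0.
  by rewrite -[X in _ --> X](mulr0 16); apply: cvgMr; exact: phi_cvg0.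
have ev : \forall l \near \oo, hl l < t by exact: (cvgr_lt _ hl_cvg0 _ t0).
have := w_small t0; apply: filterS2 ev => l ht ws.
rewrite subr0 /e /beta; case: (n_ t l) (n_gt t l) ws => [|m] nt ws.
  by move: nt; rewrite mul0r; lra.
exact: grid_estimate.
Qed.

Let psi_seq (u : nat -> R) t : u n @[n --> \oo] --> t ->
  ccvg (fun n => psi (u n)) (psi t).
Proof.
move=> ut; have [mp [mn SE]] := stieltjes_measures G.
rewrite /psi SE; under [X in ccvg X _]eq_fun do rewrite SE.
by apply: ccvgB; exact: ccvg_int_ker_LK.
Qed.

Let L_seq (u : nat -> R) t : u n @[n --> \oo] --> t -> ccvg (fun n => L (u n)) (L t).
Proof.
move=> ut; split; first exact: (continuous_cvg _ (@cReL t) ut).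
exact: (continuous_cvg _ (@a_cont t) ut).
Qed.

Let nbeta_cvg t : 0 < t -> Re (L t) = Re (psi t) /\
  (n_ t l)%:R * beta l @[l --> \oo] --> a t - Im (psi t).
Proof.
move=> t0; have g := grid_cvg t0.
have [hr hi] : ccvg (fun l => 'i * ((n_ t l)%:R * beta l)%:C) (L t - psi t).
  rewrite -[X in ccvg _ X]subr0.
  rewrite (_ : (fun l => _) = (fun l =>
    (L ((n_ t l)%:R * hl l) - psi ((n_ t l)%:R * hl l)) -
    (L ((n_ t l)%:R * hl l) - psi ((n_ t l)%:R * hl l) -
     'i * ((n_ t l)%:R * beta l)%:C))); last first.
    by apply/funext => l; move: (L _) (psi _) ('i * _) => u v c; ring.
  by apply: ccvgB (grid_limit t0); apply: ccvgB; [exact: L_seq|exact: psi_seq].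
split.
  have : Re (L t - psi t) = 0.
    apply: (cvg_unique _ hr) => //.
    rewrite (_ : (fun l => _) = (fun=> 0 : R)); first exact: cvg_cst.
    by apply/funext => l; rewrite Re_i_real.
  by rewrite ReD ReN => /eqP; rewrite subr_eq0 => /eqP.
move: hi; rewrite ImD ImN ImL; apply: cvg_trans; apply: near_eq_cvg.
by apply: nearW => l; rewrite ImM Re_i Im_i Re_real mul0r mul1r add0r.
Qed.

Let Im_psi1 : Im (psi 1) = 0.
Proof.
have [mp [mn SE]] := stieltjes_measures G.
have z (mu : {finite_measure set TR -> \bar R}) : Im (cintegral mu (ker_LK 1)) = 0.
  rewrite /cintegral /=.
  under eq_Rintegral do rewrite Im_ker_LK mul1r mul1r subrr mul0r if_same.
  by rewrite Rintegral_cst// mul0r.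
by rewrite /psi SE ImD ImN !z subrr.
Qed.

(** The slope of the linear part is found by comparing with time 1, where the
imaginary part of the integral vanishes. *)
Let representation_gt0 t : 0 < t -> L t = 'i * (t * a 1)%:C + psi t.
Proof.
move=> t0; have [Ret bt] := nbeta_cvg t0; have [_ b1] := nbeta_cvg ltr01.
rewrite Im_psi1 subr0 in b1.
have slope (s v : R) : 0 < s -> (n_ s l)%:R * beta l @[l --> \oo] --> v ->
    beta l / hl l @[l --> \oo] --> v / s.
  move=> s0 bv.
  have : (n_ s l)%:R * beta l / ((n_ s l)%:R * hl l) @[l --> \oo] --> v / s.
    by apply: cvgM => //; apply: cvgV; [rewrite gt_eqF|exact: grid_cvg].
  apply: cvg_trans; apply: near_eq_cvg.
  have ev : \forall l \near \oo, hl l < s by exact: (cvgr_lt _ hl_cvg0 _ s0).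
  apply: filterS ev => l hs; have h0 := hl_gt0 l.
  have n0 : (n_ s l)%:R != 0 :> R.
    by apply/eqP => e; have := n_gt s l; rewrite e mul0r; lra.
  by field; rewrite n0 gt_eqF.
have e : (a t - Im (psi t)) / t = a 1 / 1.
  by apply: (cvg_unique _ (slope _ _ t0 bt) (slope _ _ ltr01 b1)).
have {e} e : a t = t * a 1 + Im (psi t).
  rewrite divr1 in e; rewrite -e mulrCA mulfV ?gt_eqF// mulr1; ring.
apply: complex_ext.
  by rewrite Ret [RHS]ReD Re_i_real add0r.
by rewrite ImL e [RHS]ImD ImM Re_i Im_i Re_real mul0r mul1r add0r.
Qed.

Let psiN t : psi (- t) = (psi t)^*.
Proof.
have [mp [mn SE]] := stieltjes_measures G.
rewrite /psi !SE.
have z (mu : {finite_measure set TR -> \bar R}) :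
    cintegral mu (ker_LK (- t)) = (cintegral mu (ker_LK t))^*.
  rewrite -cintegral_conj; last exact: bmc_ker_LK.
  congr cintegral; apply/funext => x; apply: complex_ext.
    by rewrite Re_conj !Re_ker_LK sqrrN mulNr cosN.
  rewrite Im_conj !Im_ker_LK; case: ifPn => _; first by rewrite oppr0.
  by rewrite mulNr sinN mulNr; ring.
by rewrite !z; apply: complex_ext; rewrite !ReImE; ring.
Qed.

(** Negative times follow by conjugation. *)
Lemma exponential_representation t :
  f t = cexp ('i * (t * a 1)%:C + stieltjes G (ker_LK t)).
Proof.
have gt0 s : 0 < s -> f s = cexp ('i * (s * a 1)%:C + psi s).
  by move=> s0; rewrite -representation_gt0.
rewrite -/(psi t); have [t0|t0|t0] := ltgtP t 0; last 1 first.
- have [mp [mn SE]] := stieltjes_measures G.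
  rewrite t0 f0 /psi mul0r mulr0 SE.
  have -> : ker_LK 0 = (fun=> 0) :> (TR -> R[i]).
    by apply/funext => x; exact: ker_LK0.
  by rewrite !cintegral_cst !mul0r subrr addr0 cexp0.
- have -> : f t = (f (- t))^* by rewrite -f_conj opprK.
  rewrite gt0 ?oppr_gt0// -cexp_conj; congr cexp.
  rewrite psiN; move: (psi t) => z.
  by apply: complex_ext; rewrite !ReImE ?Re_real ?Im_real; ring.
- exact: gt0.
Qed.

End representation.

(** * Quotients of infinitely divisible characteristic functions *)

Section rational_infinite_divisibility.
Context {R : realType}.
Local Notation TR := (measurableTypeR R).

Lemma continuous_complex (f : R -> R[i]) : continuous (f : R -> R[i]^o) ->
  continuous (fun t => Re (f t)) /\ continuous (fun t => Im (f t)).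
Proof.
move=> cf.
have cfN t (e : R) : 0 < e -> \forall u \near t, normc (f t - f u) < e.
  move=> e0; have e0C : 0 < e%:C :> R[i] by rewrite ltcR.
  have := proj1 (@cvgrPdist_lt R[i] R[i]^o _ _ _ (f : R -> R[i]^o) (f t : R[i]^o))
    (cf t) _ e0C.
  move=> /(_ _); apply: filterS => u.
  rewrite (_ : `|_ - _| = (normc (f t - f u))%:C); last first.
    by case: (f t - f u).
  by rewrite ltcR.
split=> t; apply/cvgrPdist_lt => e e0; have := cfN t e e0; apply: filterS => u.
  by rewrite -ReN -ReD; apply: le_lt_trans; exact: Re_le_normc.
by rewrite -ImN -ImD; apply: le_lt_trans; exact: Im_le_normc.
Qed.

Lemma ArgP (f : R -> R[i]) :
  continuous (fun t => Re (f t)) -> continuous (fun t => Im (f t)) ->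
  (forall t, f t != 0) -> f 0 = 1 ->
  [/\ continuous (Arg f), Arg f 0 = 0 &
    forall t, f t = (normc (f t))%:C * cis (Arg f t)].
Proof.
move=> fr fi f0 f01.
have [a ha] := continuous_argument fr fi f0 f01.
exact: (getPex (ex_intro (fun b : R -> R => [/\ continuous b, b 0 = 0 & _]) a ha)).
Qed.

Lemma charfunN (F : dfun R) t : charfun F (- t) = (charfun F t)^*.
Proof.
pose mF : {finite_measure set TR -> \bar R} := lebesgue_stieltjes_measure F.
rewrite /charfun -(@cintegral_conj _ _ _ mF _ (bmc_character t)).
by congr cintegral; apply/funext => x; rewrite mulNr cisN.
Qed.

(** Dividing drift, measure and Cauchy factor by n gives an n-th root of the same
form. *)
Lemma smoothed_levy_khinchine (mu : {finite_measure set TR -> \bar R}) (g : R) :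
  exists F : dfun R, infinitely_divisible F /\ forall t, charfun F t =
    cexp ('i * (t * g)%:C + cintegral mu (ker_LK t) - `|t|%:C).
Proof.
have [F FE] := @levy_khinchine_dfun _ mu g 1 1 ler01 ltr01.
exists F; split; last by move=> t; rewrite FE mul1r mul1r.
apply: charfun_root_infinitely_divisible => n.
have n0 : 0 < n.+1%:R^-1 :> R by rewrite invr_gt0.
have [H HE] := levy_khinchine_dfun mu (g / n.+1%:R) (ltW n0) n0.
exists H => t; rewrite HE FE -cexpMn; congr cexp.
rewrite !mul1r -[RHS]mulr_natl mulrBr mulrDr.
have nC : n.+1%:R = (n.+1%:R : R)%:C :> R[i] by rewrite rmorph_nat.
have nn : n.+1%:R * n.+1%:R^-1 = 1 :> R by rewrite mulfV// pnatr_eq0.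
rewrite nC mulrCA -rmorphM mulrCA [n.+1%:R * _]mulrCA nn mulr1.
by rewrite mulrA -rmorphM nn mul1r -rmorphM mulrA nn mul1r.
Qed.

End rational_infinite_divisibility.
Theorem theorem2 (R : realType) (f : R -> R[i])
  (f_cont : continuous (f : R -> R[i]^o))
  (f0 : f 0 = 1)
  (f_neq0 : forall t, f t != 0)
  (eps : int) (eps_sign : eps = 1 \/ eps = -1)
  (I rho : R -> R -> R[i]) (G : classV R)
  (hl : nat -> R) (hl_gt0 : forall l, 0 < hl l)
  (hl_cvg0 : hl l @[l --> \oo] --> (0 : R))
  (phiE : forall t h, 0 <= t -> 0 < h ->
    phi eps f t h = eps%:~R * 2 * I t h + rho t h)
  (IE : forall t h, 0 <= t -> 0 < h ->
    I t h = stieltjes G (fun x => cis (t * x) * (ker_cos h x)%:C))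
  (rho_cvg0 : forall t, 0 < t ->
    (let n l := Num.truncn (t / hl l) in
     \sum_(k < n l) (n l - k)%:R * Normc.normc (rho (k%:R * hl l) (hl l)))
       @[l --> \oo] --> (0 : R))
  (phi_cvg0 : forall t, 0 < t ->
    (let n l := Num.truncn (t / hl l) in
     \sum_(k < n l) (n l - k)%:R *
       Normc.normc (phi eps f (k%:R * hl l) (hl l)) ^+ 2)
       @[l --> \oo] --> (0 : R)) :
  let gamma := Arg f 1 in
  (* Without f (-t) = conj (f t), which the formula itself entails, the
     formula fails, e.g. for f t = e^t and G = 0. *)
  ((forall t, f (- t) = (f t)^*) ->
   forall t, f t = cexp ('i * (t * gamma)%:C + stieltjes G (ker_LK t))) /\
  (forall F : dfun R, (forall t, f t = charfun F t) -> classQ F).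

Proof.
move=> gamma.
have [fr fi] := continuous_complex f_cont.
have [a_cont a0 fa] := ArgP fr fi f_neq0 f0.
have rep : (forall t, f (- t) = (f t)^*) ->
    forall t, f t = cexp ('i * (t * gamma)%:C + stieltjes G (ker_LK t)).
  move=> f_conj t.
  exact: (exponential_representation fr fi f0 f_neq0 a_cont a0 fa f_conj
    eps_sign hl_gt0 hl_cvg0 phiE IE rho_cvg0 phi_cvg0).
split=> // F fF.
have {}rep := rep _.
have [mp [mn SE]] := stieltjes_measures G.
(* The drift goes to the numerator; the equal Cauchy factors cancel. *)
have [F1 [id1 F1E]] := smoothed_levy_khinchine mp gamma.
have [F2 [id2 F2E]] := smoothed_levy_khinchine mn 0.
exists F1, F2; split => //.
have [H [HE HF]] := conv_dfun F F2.
rewrite -HE; congr (_ : R -> R); apply: charfun_inj => t.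
rewrite HF F1E F2E -fF rep; last by move=> s; rewrite !fF charfunN.
rewrite -cexpD SE mulr0; congr cexp.
ring.
Qed.
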